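(* Let $d\geq n$ and let $X\in\mathbb{R}^{n\times d}$ be a random matrix whose rows $\mathbf{x}_1^\top,\ldots,\mathbf{x}_n^\top$ are i.i.d. random vectors. Let $\Sigma:=\mathbb{E}\left[\frac{1}{n}X^\top X\right]\in\mathbb{R}^{d\times d}$, assume that $\Sigma$ is invertible, and let $\hat{\Sigma}:=\frac{1}{n}X^\top X$. Assume further that $\mathbf{z}_i:=\Sigma^{-1/2}\mathbf{x}_i$ satisfy $\|\mathbf{z}_i\|=\sqrt{d}$ almost surely for every $i\in[n]$. 1. If the $\mathbf{z}_i$ are also sub-gaussian, then there are constants $C_K,c_K>0$, depending only on the sub-gaussian norm $K=\max_i\|\mathbf{z}_i\|_{\psi_2}$ (and not otherwise on $n$, $d$ or the distribution), such that for any $t\geq 0$, setting $\epsilon:=C_K\sqrt{\frac{n}{d}} + \frac{t}{\sqrt{d}}$, with probability at least $1-2\exp(-c_Kt^2)$ it holds that for all $i\in[n]$, $$\lambda_{i+d-n}(\Sigma)\left(1 - \max(\epsilon, \epsilon^2)\right) \leq \frac{n}{d}\, \lambda_i(\hat\Sigma) \leq \lambda_i(\Sigma)\left(1 + \max(\epsilon, \epsilon^2)\right).$$ 2. For any positive integer $p$ let $K(p) := \max_{i\in[n]}\sup_{x\in\mathbb{S}^{d-1}}\left(\mathbb{E}\left[|\langle \mathbf{z}_i, x \rangle|^{p}\right]\right)^{1/p}$. There is an absolute constant $C>0$ (independent of $n$, $d$, $p$ and the distribution) such that for any positive integer $p$ and all $i\in[n]$, $$\lambda_{i+d-n}(\Sigma)\left(1-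 \epsilon\right) \leq \frac{n}{d}\,\mathbb{E}\left[\lambda_i(\hat\Sigma)\right] \leq \lambda_i(\Sigma)\left(1+ \epsilon \right),$$ where $\epsilon=\sqrt{\frac{B(n,p)}{d}}$ with $$B(n, p) := C\,\frac{p}{\log(p+1)}\,n^{1/p}\max\left(n,\ n^{1/p}K(2p)^2\right) \log(n).$$
   Context: $\lambda_i(\cdot)$ denotes the $i$-th largest eigenvalue of a symmetric matrix ($\lambda_1\geq\lambda_2\geq\dots$), $[n]=\{1,\ldots,n\}$, $\|\cdot\|$ of a vector is the Euclidean norm, and $\mathbb{S}^{d-1}$ is the Euclidean unit sphere in $\mathbb{R}^d$. A random vector $\mathbf{z}\in\mathbb{R}^d$ is sub-gaussian if $$\|\mathbf{z}\|_{\psi_2}:=\sup_{\mathbf{u}:\|\mathbf{u}\|=1}\ \sup_{p\geq 1}\frac{1}{\sqrt{p}}\left(\mathbb{E}\left[|\langle \mathbf{z}, \mathbf{u}\rangle|^p\right]\right)^{1/p}<\infty.$$ *)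

(* Defs.v *)
From HB Require Import structures.
From mathcomp Require Export all_boot all_order all_algebra.
From mathcomp Require Export all_classical all_reals all_analysis.

Set Implicit Arguments.
Unset Strict Implicit.
Unset Printing Implicit Defensive.

Import Order.TTheory GRing.Theory Num.Theory numFieldNormedType.Exports.
Local Open Scope classical_set_scope.
Local Open Scope ring_scope.

Section Euclidean.
Context {R : realType} {d : nat}.

(* The library norm on matrices is the sup norm, so the Euclidean structure
   is written out. *)
Definition dotv (u v : 'cV[R]_d) : R := \sum_(j < d) u j 0 * v j 0.
Definition enorm (u : 'cV[R]_d) : R := Num.sqrt (dotv u u).
Definition sphere : set 'cV[R]_d := [set u | enorm u = 1].

(* The topology of the sup norm is that of the Euclidean norm. *)
Definition borel_cV : set (set 'cV[R]_d) := <<s [set B | open B] >>.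

(* Eigenvalues with algebraic multiplicity, in nonincreasing order. Such a
   sequence exists for every symmetric matrix, and is then unique; the value
   is [::] when the characteristic polynomial does not split over R. *)
Definition eigvals (A : 'M[R]_d) : seq R :=
  xget [::] [set s | char_poly A = \prod_(a <- s) ('X - a%:P) /\
                     sorted (fun a b => b <= a) s].

(* Indices start at 1: [lambda 1 A] is the largest eigenvalue. *)
Definition lambda (i : nat) (A : 'M[R]_d) : R := (eigvals A)`_i.-1.

Definition psd (S : 'M[R]_d) : Prop :=
  S^T = S /\ forall v : 'cV[R]_d, 0 <= dotv v (S *m v).

(* The square root of a positive semidefinite matrix; 0 on other matrices. *)
Definition sqrtmx (A : 'M[R]_d) : 'M[R]_d :=
  xget 0 [set S | psd S /\ S *m S = A].

End Euclidean.

Arguments sphere R d : clear implicits.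

Section Moments.
Context {dsp : measure_display} {T : measurableType dsp} {R : realType}.
Variable P : probability T R.

Local Open Scope ereal_scope.

Definition psi2_norm d (z : T -> 'cV[R]_d) : \bar R :=
  ereal_sup [set x | exists (u : 'cV[R]_d) (p : R),
    [/\ sphere R d u, (1 <= p)%R &
        x = ((Num.sqrt p)^-1)%:E * 'N[P]_(p%:E)[(fun w => (dotv (z w) u)%:E)] ] ].

Definition subgaussian d (z : T -> 'cV[R]_d) : Prop := psi2_norm z < +oo.

(* max over k of the sup over unit vectors u of (E |<z_k, u>|^p)^(1/p) *)
Definition max_moment n d (z : 'I_n -> T -> 'cV[R]_d) (p : nat) : \bar R :=
  \big[maxe/-oo]_(k < n)
    ereal_sup [set 'N[P]_((p%:R : R)%:E)[(fun w => (dotv (z k w) u)%:E)]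
              | u in sphere R d].

End Moments.

Section Design.
Context {dsp : measure_display} {T : measurableType dsp} {R : realType}.
Context {n d : nat}.
Variables (P : probability T R) (X : T -> 'M[R]_(n, d)).

(* the k-th row of X, as a column vector *)
Definition rowvec (k : 'I_n) (w : T) : 'cV[R]_d := (row k (X w))^T.

Definition sample_cov (w : T) : 'M[R]_d := n%:R^-1 *: ((X w)^T *m X w).

(* Entrywise expectation; it is the true one as soon as all entries of
   [sample_cov] are integrable. *)
Definition pop_cov : 'M[R]_d :=
  \matrix_(a, b) fine ('E_P[(fun w => sample_cov w a b)])%E.

Definition whitened (k : 'I_n) (w : T) : 'cV[R]_d :=
  invmx (sqrtmx pop_cov) *m rowvec k w.

Definition independent_rows : Prop :=
  forall (J : {set 'I_n}) (B : 'I_n -> set 'cV[R]_d),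
    (forall k, k \in J -> borel_cV (B k)) ->
    P [set w | forall k, k \in J -> B k (rowvec k w)] =
    (\prod_(k in J) P (rowvec k @^-1` B k))%E.

Definition identically_distributed_rows : Prop :=
  forall (k l : 'I_n) (B : set 'cV[R]_d), borel_cV B ->
    P (rowvec k @^-1` B) = P (rowvec l @^-1` B).

Record random_design : Prop := RandomDesign {
  design_measurable : forall k j, measurable_fun [set: T] (fun w => X w k j);
  design_independent : independent_rows;
  design_identical : identically_distributed_rows;
  (* the expectation defining [pop_cov] exists *)
  design_integrable : forall a b,
    P.-integrable [set: T] (fun w => (sample_cov w a b)%:E);
  design_invertible : pop_cov \in unitmx;
  design_norm : forall k, {ae P, forall w,
    enorm (whitened k w) = Num.sqrt d%:R} }.

End Design.

(* The bound B(n, p); [M] stands for the real value of the maximal L^(2p)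
   moment [max_moment] P z (2 * p). *)
Definition moment_bound {R : realType} (C : R) (n p : nat) (M : R) : R :=
  C * (p%:R / ln (p%:R + 1)) * n%:R `^ p%:R^-1
    * Num.max n%:R (n%:R `^ p%:R^-1 * M ^+ 2) * ln n%:R.

(* Main.v *)
(* Write z_1, ..., z_n for the whitened rows and Z for the n x d matrix with
   these rows, so that X = Z S with S the square root of Sigma. By
   Courant-Fischer, a |v|^2 <= |v Z|^2 <= b |v|^2 for all row vectors v implies
   a lambda_(i+d-n)(Sigma) <= lambda_i(X^T X) <= b lambda_i(Sigma). Since
   |z_k|^2 = d, only the off-diagonal part of the Gram matrix Z Z^T has to be
   compared with d.

   In expectation: decoupling over subsets T of the rows reduces the
   off-diagonal form to the rows in T against those outside T; the p-th trace
   moment of the decoupled Gram matrix is bounded by a matrix Rosenthal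
   inequality, obtained by removing one row at a time. For p above log n the
   bound is applied with p replaced by about log n.

   With high probability: decoupling and conditioning bound the largest
   exponential moment of the off-diagonal form over subsets of rows by the
   square root of itself, which makes it finite with explicit constants; a
   union bound over a lattice net in the sphere finishes the proof. *)
From HB Require Import structures.
From mathcomp Require Import perm.
From mathcomp Require Import complex spectral sesquilinear.
Require Import Defs.
From mathcomp Require Import all_boot all_order all_algebra.
From mathcomp Require Import all_classical all_reals all_analysis.
From mathcomp Require Import measurable_realfun.
From mathcomp Require Import ring lra zify.

Set Implicit Arguments.
Unset Strict Implicit.
Unset Printing Implicit Defensive.

Import Order.TTheory GRing.Theory Num.Theory numFieldNormedType.Exports.
Local Open Scope classical_set_scope.
Local Open Scope ring_scope.

(** * Eigenvalues of symmetric matrices *)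

(** In the trace moments the matrices do not commute, and a power of the sum depends on the row
    being averaged. With [Y] the sum of the terms y_k^T y_k, the trace of Y^(r+1) is the sum of the
    numbers y_k Y^r y_k^T; splitting y_k off costs a factor (1 + delta)^r and leaves a remainder
    that involves |y_k| alone. Balancing [delta] produces p/log(p+1). In B(n, p) the first n^(1/p)
    is the price of a trace in dimension n, and the one inside the maximum comes from summing the
    moments of n rows.

    The rows have norm sqrt(d) only almost surely. Modifying them on a null set makes the random
    quantities of these estimates bounded, so that all means are finite and part of a moment can be
    moved from one side of an inequality to the other. Conditioning is Fubini's theorem for the
    identity map of the sample space, read with two independent sigma-algebras.

    In the sub-gaussian part the zero diagonal is exploited in the rounding to the lattice, so no
    factor is lost between net and sphere. The maximum of eps and eps^2 arises because exponential
    moments are controlled only for small parameters. *)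

Section SpectralTheorem.
Variable R : rcfType.

(** Over the complex numbers the matrix is Hermitian, hence normal with a real spectrum. A spectral
    value is a root of the characteristic polynomial of [S] itself, so it has an eigenvector over
    [R], which is then normalised. *)
Lemma sym_eigenvector n (S : 'M[R]_n.+1) : S^T = S ->
  exists a (v : 'rV[R]_n.+1), v *m v^T = 1%:M /\ v *m S = a *: v.
Proof.
move=> symS.
pose f : {rmorphism R -> complex R} := [the {rmorphism _ -> _} of real_complex R].
pose A := map_mx f S.
have hA : A \is hermsymmx.
  apply: realsym_hermsym; first by apply/is_hermitianmxP; rewrite expr0 scale1r map_mx_id // /A map_trmx symS.
  apply/mxOverP => i j; rewrite mxE; apply/complex_realP; by exists (S i j).
have /orthomx_spectralP EA := hermitian_normalmx hA.
have dr := hermitian_spectral_diag_real hA.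
have /mxOverP/(_ 0 0)/complex_realP [a Ea] := dr.
have evA : eigenvalue A (f a).
  apply/eigenvalueP; exists (row 0 (spectralmx A)).
    rewrite {2}EA !mulmxA rowE -!mulmxA (mulmxA (spectralmx A)) mulmxV ?spectral_unit //.
    rewrite mul1mx mulmxA -!rowE row_diag_mx -scalemxAl -rowE /=; congr (_ *: _).
    by rewrite Ea.
  apply/eqP => /(congr1 (mulmx^~ (invmx (spectralmx A)))).
  rewrite mul0mx rowE -mulmxA mulmxV ?spectral_unit // mulmx1 => /matrixP /(_ 0 0) /eqP.
  by rewrite !mxE !eqxx oner_eq0.
have evS : eigenvalue S a.
  rewrite eigenvalue_root_char; move: evA.
  by rewrite eigenvalue_root_char /A -map_char_poly fmorph_root.
have /eigenvalueP [v vS v0] := evS.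
have vv : 0 < (v *m v^T) 0 0.
  rewrite mxE lt_neqAle sumr_ge0 ?andbT; last by move=> i _; rewrite mxE -expr2 sqr_ge0.
  apply: contra v0; rewrite eq_sym psumr_eq0; last by move=> i _; rewrite mxE -expr2 sqr_ge0.
  move=> /allP h; apply/eqP/rowP => j; rewrite mxE.
  have := h j (mem_index_enum j); rewrite implyTb mxE -expr2 sqrf_eq0.
  by move/eqP.
exists a, ((Num.sqrt ((v *m v^T) 0 0))^-1 *: v); split; last first.
  by rewrite -scalemxAl vS !scalerA mulrC.
rewrite linearZ /= -scalemxAl -scalemxAr scalerA.
move: vv; have := mx11_scalar (v *m v^T); move: ((v *m v^T) 0 0) => c -> c0.
rewrite scale_scalar_mx.
rewrite -expr2 exprVn sqr_sqrtr ?ltW // mulVf ?gt_eqF //.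
Qed.

(** The Householder reflection that exchanges [v] and the first basis vector [e] is symmetric and
    orthogonal. It degenerates for [v = e], where the identity serves. *)
Lemma orthogonal_first_row n (v : 'rV[R]_n.+1) : v *m v^T = 1%:M ->
  exists H : 'M[R]_n.+1, H *m H^T = 1%:M /\ row 0 H = v.
Proof.
move=> v1; pose e : 'rV[R]_n.+1 := delta_mx 0 0.
have e1 : e *m e^T = 1%:M.
  by rewrite /e trmx_delta mul_delta_mx; apply/matrixP => i j; rewrite !ord1 !mxE.
have [->|ve] := eqVneq v e.
  by exists 1%:M; rewrite trmx1 mulmx1; split => //; rewrite row1.
pose u := v - e.
pose c : R := (e *m v^T) 0 0.
have cE : e *m v^T = c%:M by rewrite [LHS]mx11_scalar.
have cE' : v *m e^T = c%:M by rewrite -[LHS]trmxK trmx_mul trmxK cE tr_scalar_mx.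
have uu : u *m u^T = (2 - 2 * c)%:M.
  rewrite /u linearB /= mulmxBl !mulmxBr v1 e1 cE cE' -!raddfB /=; congr (_%:M); ring.
have c2 : 2 - 2 * c != 0.
  apply: contra ve => /eqP h; move: uu; rewrite h => /matrixP /(_ 0 0); rewrite !mxE /=.
  move/eqP; rewrite psumr_eq0; last by move=> i _; rewrite !mxE -expr2 sqr_ge0.
  move=> /allP hh; rewrite -subr_eq0; apply/eqP/rowP => j; rewrite [RHS]mxE.
  have := hh j (mem_index_enum j); rewrite implyTb [_^T _ _]mxE -expr2 sqrf_eq0.
  by move/eqP.
pose k := 2 / (2 - 2 * c).
have [uE kE] : u = v - e /\ k * (2 - 2 * c) = 2 by split; rewrite // /k divfK.
clearbody u k.
have sH : (1%:M - k *: (u^T *m u))^T = 1%:M - k *: (u^T *m u).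
  by rewrite linearB /= linearZ /= trmx1 trmx_mul trmxK.
exists (1%:M - k *: (u^T *m u)); rewrite sH; split.
  rewrite mulmxBl mul1mx mulmxBr mulmx1 -scalemxAl -scalemxAr.
  rewrite mulmxA -(mulmxA u^T) uu mul_mx_scalar -scalemxAl !scalerA.
  have -> : k * (k * (2 - 2 * c)) = k + k by rewrite kE; ring.
  by rewrite scalerDl opprB addrK subrK.
rewrite rowE -/e mulmxBr mulmx1 -scalemxAr mulmxA [X in _ *: (_ *m X^T *m _)]uE linearB /= mulmxBr cE e1 -raddfB /=.
rewrite mul_scalar_mx scalerA.
have -> : k * (c - 1) = -1.
  apply: (mulIf c2); rewrite mulrAC kE mulN1r mulrBr mulr1 opprB; done.
by rewrite scaleN1r opprK uE addrC subrK.
Qed.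

(** Deflation: in an orthonormal basis that starts with a unit eigenvector, symmetry clears the
    first row and column outside the corner, and the induction hypothesis applies to the remaining
    block. *)
Lemma spectral_real n (S : 'M[R]_n) : S^T = S ->
  exists (Q : 'M[R]_n) (d : 'rV[R]_n), Q *m Q^T = 1%:M /\ S = Q^T *m diag_mx d *m Q.
Proof.
elim: n S => [|n IH] S symS.
  by exists 1%:M, 0; split; apply/matrixP => - [].
have [a [v [v1 vS]]] := sym_eigenvector symS.
have [H [HH H0]] := orthogonal_first_row v1.
have HH' : H^T *m H = 1%:M by exact: mulmx1C.
pose B : 'M[R]_(1 + n) := H *m S *m H^T.
have symB : B^T = B by rewrite /B !trmx_mul trmxK symS mulmxA.
have rB : row 0 B = a *: delta_mx 0 0.
  rewrite /B !row_mul H0 vS -scalemxAl -H0 rowE -mulmxA HH mulmx1; done.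
have uB : usubmx B = a *: delta_mx 0 0.
  apply/rowP => j; rewrite !mxE; move/rowP/(_ j): rB; rewrite !mxE.
  by rewrite (_ : lshift n 0 = 0) //; apply: val_inj.
have ur : ursubmx B = 0.
  apply/rowP => j; move/rowP/(_ (rshift 1 j)): uB; rewrite !mxE => ->.
  by rewrite eqxx /= mulr0.
have ul : ulsubmx B = a%:M.
  apply/rowP => j; move/rowP/(_ (lshift n j)): uB; rewrite !mxE => ->.
  by rewrite !ord1 eqxx /= mulr1.
have dl : dlsubmx B = 0.
  by rewrite -[B]symB -trmx_ursub ur trmx0.
have symD : (drsubmx B)^T = drsubmx B by rewrite trmx_drsub symB.
have [Q [d [QQ E]]] := IH _ symD.
have EB : B = block_mx a%:M 0 0 (drsubmx B) by rewrite -{1}[B]submxK ul ur dl.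
pose P : 'M[R]_(1 + n) := block_mx 1%:M 0 0 Q.
have PP : P *m P^T = 1%:M.
  rewrite /P tr_block_mx mulmx_block !trmx0 trmx1 !mulmx0 !mul0mx mulmx1 QQ !addr0 add0r.
  by rewrite -scalar_mx_block.
have ES : S = H^T *m B *m H.
  by rewrite /B !mulmxA HH' mul1mx -mulmxA HH' mulmx1.
pose D : 'rV[R]_(1 + n) := row_mx a%:M d.
have ED : B = P^T *m diag_mx D *m P.
  rewrite diag_mx_row EB E /P tr_block_mx !mulmx_block !trmx0 trmx1.
  rewrite !mulmx0 !mul0mx !mul1mx !mulmx1 !addr0 ?add0r; rewrite ?mul0mx; congr block_mx.
  by apply/matrixP => i j; rewrite !ord1 !mxE eqxx.
exists (P *m H); exists D; split; first by rewrite trmx_mul mulmxA -(mulmxA P) HH mulmx1.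
by rewrite (trmx_mul P H) -!mulmxA {1}ES ED !mulmxA.
Qed.

End SpectralTheorem.

Section SymmetricEigenvalues.
Variable R : realType.

Lemma sorted_tuple_perm n (s : n.-tuple R) : exists p : 'S_n,
  forall i j : 'I_n, (i <= j)%N -> tnth s (p j) <= tnth s (p i).
Proof.
have /tuple_permP [p Ep] : perm_eq (sort (fun a b => b <= a) s) s by rewrite perm_sort.
exists p => i j ij.
have srt : sorted (fun a b : R => b <= a) (sort (fun a b => b <= a) s).
  by apply: sort_sorted => a b; exact: le_total.
have sz : size (sort (fun a b : R => b <= a) s) = n by rewrite size_sort size_tuple.
have E k : tnth s (p k) = nth 0 (sort (fun a b : R => b <= a) s) k.
  by rewrite Ep -[in RHS](tnth_nth 0 [tuple tnth s (p i) | i < n] k) tnth_mktuple.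
rewrite !E; apply: (@sorted_leq_nth _ (fun a b : R => b <= a)) => //.
- by move=> x y z yx zy; exact: le_trans zy yx.
- by rewrite inE sz.
- by rewrite inE sz.
Qed.

Lemma spectral_sorted n (S : 'M[R]_n) : S^T = S ->
  exists (Q : 'M[R]_n) (d : 'rV[R]_n),
  [/\ Q *m Q^T = 1%:M, S = Q^T *m diag_mx d *m Q &
      forall i j : 'I_n, (i <= j)%N -> d 0 j <= d 0 i].
Proof.
move=> /spectral_real [Q [d [QQ E]]].
have [p Hp] := sorted_tuple_perm [tuple d 0 i | i < n].
have Ed (i j : 'I_n) : (i <= j)%N -> d 0 (p j) <= d 0 (p i).
  by move=> /Hp; rewrite !tnth_mktuple.
exists (row_perm p Q), (col_perm p d); split.
- rewrite row_permE trmx_mul mulmxA -(mulmxA _ Q) QQ mulmx1.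
  by rewrite tr_perm_mx -perm_mxM mulgV perm_mx1.
- rewrite E; apply/matrixP => i j; rewrite !mxE (reindex_inj (@perm_inj _ p)) /=.
  apply: eq_bigr => k _; rewrite !mul_mx_diag !mxE.
  done.
- by move=> i j ij; rewrite !mxE; exact: Ed.
Qed.

Lemma char_poly_orth n (Q D : 'M[R]_n) : Q *m Q^T = 1%:M ->
  char_poly (Q^T *m D *m Q) = char_poly D.
Proof.
move=> QQ; have QQ' := mulmx1C QQ.
have E : char_poly_mx (Q^T *m D *m Q) =
    map_mx polyC Q^T *m char_poly_mx D *m map_mx polyC Q.
  rewrite /char_poly_mx !map_mxM mulmxBr mulmxBl; congr (_ - _).
  rewrite mul_mx_scalar -scalemxAl -map_mxM QQ' map_mx1.
  by apply/matrixP => i j; rewrite !mxE mulr_natr.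
rewrite /char_poly E !det_mulmx mulrAC -det_mulmx -map_mxM QQ' map_mx1 det1 mul1r.
done.
Qed.

Lemma nth_map_enum n (f : 'I_n -> R) i (lt_in : (i < n)%N) :
  [seq f i | i <- enum 'I_n]`_i = f (Ordinal lt_in).
Proof.
rewrite (nth_map (Ordinal lt_in)) ?size_enum_ord //; congr f.
by apply: val_inj; rewrite /= nth_enum_ord.
Qed.

(** [eigvals] is a choice. The characteristic polynomial determines the multiset of its roots, and a
    multiset has one nonincreasing ordering, so every ordered diagonalisation computes it. *)
Lemma eigvals_diag n (Q : 'M[R]_n) (d : 'rV[R]_n) : Q *m Q^T = 1%:M ->
  (forall i j : 'I_n, (i <= j)%N -> d 0 j <= d 0 i) ->
  eigvals (Q^T *m diag_mx d *m Q) = [seq d 0 i | i <- enum 'I_n].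
Proof.
move=> QQ dm.
have srt : sorted (fun a b : R => b <= a) [seq d 0 i | i <- enum 'I_n].
  apply/(sortedP 0) => i; rewrite size_map size_enum_ord => iln.
  by rewrite (nth_map_enum _ (ltnW iln)) nth_map_enum; apply: dm => /=.
have cp : char_poly (Q^T *m diag_mx d *m Q) =
    \prod_(a <- [seq d 0 i | i <- enum 'I_n]) ('X - a%:P).
  rewrite char_poly_orth // char_poly_trig; last exact: diag_mx_is_trig.
  rewrite big_map big_enum /=.
  by apply: eq_bigr => i _; rewrite !mxE eqxx.
rewrite /eigvals; apply: xget_unique => [|s [ps ss]]; first by split.
apply: (@sorted_eq _ (fun a b : R => b <= a)) => //.
- by move=> x y z yx zy; exact: le_trans zy yx.
- by move=> x y; rewrite andbC; exact: le_anti.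
- by apply: prod_XsubC_eq; rewrite -ps cp.
Qed.

Lemma spectral_lambda n (S : 'M[R]_n) : S^T = S -> exists Q : 'M[R]_n,
  [/\ Q *m Q^T = 1%:M, Q^T *m Q = 1%:M &
      S = Q^T *m diag_mx (\row_i lambda i.+1 S) *m Q].
Proof.
move=> /spectral_sorted [Q [d [QQ E dm]]]; exists Q; split => //; first exact: mulmx1C.
rewrite {1}E; congr (_ *m diag_mx _ *m _); apply/rowP => i; rewrite mxE /lambda /= E.
by rewrite eigvals_diag // (nth_map i) ?size_enum_ord // nth_ord_enum.
Qed.

Lemma lambda_mono n (S : 'M[R]_n) i j : S^T = S -> (0 < i)%N -> (i <= j <= n)%N ->
  lambda j S <= lambda i S.
Proof.
move=> /spectral_sorted [Q [d [QQ E dm]]] i0 /andP[ij jn].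
have j0 : (0 < j)%N := leq_trans i0 ij.
have jl : (j.-1 < n)%N by rewrite prednK.
have il : (i.-1 < n)%N by rewrite prednK // (leq_trans ij).
rewrite /lambda E eigvals_diag // (nth_map_enum _ jl) (nth_map_enum _ il).
by apply: dm => /=; lia.
Qed.

(** Vectors are rows, so that subspaces are row spaces; [qform 1%:M v] is the squared Euclidean
    norm. *)
Definition qform n (A : 'M[R]_n) (v : 'rV[R]_n) : R := (v *m A *m v^T) 0 0.

Lemma qform1E n (v : 'rV[R]_n) : qform 1%:M v = \sum_j v 0 j ^+ 2.
Proof. by rewrite /qform mulmx1 mxE; apply: eq_bigr => j _; rewrite mxE expr2. Qed.

Lemma qform1_ge0 n (v : 'rV[R]_n) : 0 <= qform 1%:M v.
Proof. by rewrite qform1E sumr_ge0 // => j _; exact: sqr_ge0. Qed.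

Lemma qform1_gt0 n (v : 'rV[R]_n) : v != 0 -> 0 < qform 1%:M v.
Proof.
move=> v0; rewrite lt_neqAle qform1_ge0 andbT eq_sym; apply: contra v0.
rewrite qform1E psumr_eq0 => [/allP h|i _]; last exact: sqr_ge0.
apply/eqP/rowP => j; rewrite mxE; apply/eqP.
by have := h j (mem_index_enum j); rewrite implyTb sqrf_eq0.
Qed.

Lemma qformZ n (A : 'M[R]_n) (v : 'rV[R]_n) c : qform A (c *: v) = c ^+ 2 * qform A v.
Proof.
rewrite /qform [(c *: v)^T]linearZ /= -!scalemxAl -scalemxAr scalerA [LHS]mxE.
by rewrite expr2.
Qed.

Lemma qform_spectral n (Q : 'M[R]_n) (d v : 'rV[R]_n) :
  qform (Q^T *m diag_mx d *m Q) v = \sum_j d 0 j * (v *m Q^T) 0 j ^+ 2.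
Proof.
rewrite /qform !mulmxA -mulmxA -[X in _ *m X]trmxK trmx_mul trmxK mxE.
by apply: eq_bigr => j _; rewrite mul_mx_diag !mxE mulrC mulrA mulrC -expr2 mulrC.
Qed.

Lemma qform1_orth n (Q : 'M[R]_n) (v : 'rV[R]_n) : Q^T *m Q = 1%:M ->
  qform 1%:M v = \sum_j (v *m Q^T) 0 j ^+ 2.
Proof.
move=> QQ; rewrite -QQ -[X in X *m Q]mulmx1 -diag_const_mx qform_spectral.
by apply: eq_bigr => j _; rewrite mxE mul1r.
Qed.

Lemma mul_row_pid_mx n r (x : 'rV[R]_n) j :
  (x *m (pid_mx r : 'M[R]_n)) 0 j = x 0 j *+ (j < r)%N.
Proof.
rewrite mxE (bigD1 j) //= big1 ?addr0 => [|k kj]; rewrite !mxE.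
  by rewrite eqxx mulr_natr.
by rewrite val_eqE (negPf kj) mulr0.
Qed.

(** One half of Courant-Fischer: the dimensions of [U] and of the span [V] of the first i
    eigenvectors add up to more than n, so they share a nonzero vector, on which the form is at
    least [lambda i A] times the squared norm. *)
Lemma lambda_le n m (A : 'M[R]_n) (U : 'M[R]_(m, n)) i c : A^T = A ->
  (0 < i <= n)%N -> (n < i + \rank U)%N ->
  (forall v, (v <= U)%MS -> qform A v <= c * qform 1%:M v) -> lambda i A <= c.
Proof.
move=> symA /andP[i0 iln] rk h.
have [Q [QQ QQ' E]] := spectral_lambda symA.
have rQ : row_free Q by apply/row_freeP; exists Q^T.
pose V := (pid_mx i : 'M[R]_n) *m Q.
have rV : \rank V = i by rewrite /V mxrankMfree // rank_pid_mx.
have : (U :&: V)%MS != 0.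
  rewrite -mxrank_eq0 -lt0n -(ltn_add2l (\rank (U + V)%MS)) addn0.
  by rewrite mxrank_sum_cap rV addnC (leq_ltn_trans (rank_leq_col _)).
move=> /rowV0Pn [v]; rewrite sub_capmx => /andP[vU vV] v0.
have vv := qform1_gt0 v0.
have qA : qform A v = \sum_(j < n) lambda j.+1 A * (v *m Q^T) 0 j ^+ 2.
  by rewrite {1}E qform_spectral; under eq_bigr do rewrite [(\row_k _) 0 _]mxE.
rewrite -(ler_pM2r vv) (le_trans _ (h v vU)) // qA (qform1_orth v QQ') mulr_sumr.
have /submxP [x Ex] := vV.
apply: ler_sum => j _.
have -> : (v *m Q^T) 0 j = x 0 j *+ (j < i)%N.
  by rewrite Ex /V -!mulmxA QQ mulmx1 mul_row_pid_mx.
have [ji|] := ltnP j i; last by rewrite mulr0n expr2 mul0r !mulr0.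
apply: ler_wpM2r; first exact: sqr_ge0.
by apply: lambda_mono => //; rewrite ji iln.
Qed.

(** The dual half, with [V] the span of the eigenvectors i, ..., n. Its dimension is n - i + 1,
    hence the predecessor in [copid_mx i.-1]. *)
Lemma lambda_ge n m (A : 'M[R]_n) (U : 'M[R]_(m, n)) i c : A^T = A ->
  (0 < i <= n)%N -> (i <= \rank U)%N ->
  (forall v, (v <= U)%MS -> c * qform 1%:M v <= qform A v) -> c <= lambda i A.
Proof.
move=> symA /andP[i0 iln] rk h.
have [Q [QQ QQ' E]] := spectral_lambda symA.
have rQ : row_free Q by apply/row_freeP; exists Q^T.
pose V := (copid_mx i.-1 : 'M[R]_n) *m Q.
have rV : \rank V = (n - i.-1)%N.
  by rewrite /V mxrankMfree // rank_copid_mx // (leq_trans (leq_pred _)).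
have : (U :&: V)%MS != 0.
  rewrite -mxrank_eq0 -lt0n -(ltn_add2l (\rank (U + V)%MS)) addn0.
  rewrite mxrank_sum_cap rV (leq_ltn_trans (rank_leq_col _)) //; lia.
move=> /rowV0Pn [v]; rewrite sub_capmx => /andP[vU vV] v0.
have vv := qform1_gt0 v0.
have qA : qform A v = \sum_(j < n) lambda j.+1 A * (v *m Q^T) 0 j ^+ 2.
  by rewrite {1}E qform_spectral; under eq_bigr do rewrite [(\row_k _) 0 _]mxE.
rewrite -(ler_pM2r vv) (le_trans (h v vU)) // qA (qform1_orth v QQ') mulr_sumr.
have /submxP [x Ex] := vV.
apply: ler_sum => j _.
have -> : (v *m Q^T) 0 j = x 0 j *+ (i.-1 <= j)%N.
  rewrite Ex /V -!mulmxA QQ mulmx1 /copid_mx mulmxBr mulmx1 2!mxE.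
  by rewrite mul_row_pid_mx (leqNgt i.-1 j); case: (ltnP j i.-1) => _; rewrite ?mulr1n ?mulr0n ?subrr ?subr0.
have [ji|] := leqP i.-1 j; last by rewrite mulr0n expr2 mul0r !mulr0.
apply: ler_wpM2r; first exact: sqr_ge0.
by apply: lambda_mono => //; have := ltn_ord j; lia.
Qed.

End SymmetricEigenvalues.

(** * Positive semidefinite matrices and comparison of eigenvalues *)

Section PositiveSemidefinite.
Variable R : realType.

Lemma psdP n (S : 'M[R]_n) :
  psd S <-> S^T = S /\ forall v : 'rV[R]_n, 0 <= qform S v.
Proof.
have E (v : 'cV[R]_n) : dotv v (S *m v) = qform S v^T.
  by rewrite /qform trmxK -mulmxA mxE; apply: eq_bigr => j _; rewrite [v^T _ _]mxE.
split=> -[symS h]; split=> // v; last by rewrite E.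
by rewrite -[v]trmxK -E.
Qed.

Lemma lambda_ge0 n (S : 'M[R]_n) i : psd S -> (0 < i <= n)%N -> 0 <= lambda i S.
Proof.
move=> /psdP [symS S0] i0n; apply: (@lambda_ge _ _ _ _ 1%:M) => //.
  by rewrite mxrank1; case/andP: i0n.
by move=> v _; rewrite mul0r.
Qed.

Lemma psd_spectral n (S : 'M[R]_n) : psd S -> exists (Q : 'M[R]_n) (mu : 'rV[R]_n),
  [/\ Q *m Q^T = 1%:M, Q^T *m Q = 1%:M, S = Q^T *m diag_mx mu *m Q &
      forall j, 0 <= mu 0 j].
Proof.
move=> psdS; have [symS _] := psdS.
have [Q [QQ QQ' E]] := spectral_lambda symS.
exists Q, (\row_j lambda j.+1 S); split => // j; rewrite mxE.
by apply: lambda_ge0 => //=.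
Qed.

Lemma psd_conj_diag n (Q : 'M[R]_n) (mu : 'rV[R]_n) : (forall j, 0 <= mu 0 j) ->
  psd (Q^T *m diag_mx mu *m Q).
Proof.
move=> mu0; apply/psdP; split.
  by rewrite !trmx_mul trmxK tr_diag_mx mulmxA.
by move=> v; rewrite qform_spectral sumr_ge0 // => j _; rewrite mulr_ge0 ?sqr_ge0.
Qed.

Lemma bottom_eigenspace n (A : 'M[R]_n) i : A^T = A -> (0 < i <= n)%N ->
  exists U : 'M[R]_n, \rank U = (n - i.-1)%N /\
    forall v, (v <= U)%MS -> qform A v <= lambda i A * qform 1%:M v.
Proof.
move=> symA /andP[i0 iln]; have [Q [QQ QQ' E]] := spectral_lambda symA.
have rQ : row_free Q by apply/row_freeP; exists Q^T.
exists ((copid_mx i.-1 : 'M[R]_n) *m Q); split.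
  by rewrite mxrankMfree // rank_copid_mx // (leq_trans (leq_pred _)).
move=> v /submxP [x Ex]; rewrite {1}E qform_spectral (qform1_orth v QQ') mulr_sumr.
apply: ler_sum => j _; rewrite [(\row_k _) 0 j]mxE.
have -> : (v *m Q^T) 0 j = x 0 j *+ (i.-1 <= j)%N.
  rewrite Ex -!mulmxA QQ mulmx1 /copid_mx mulmxBr mulmx1 2!mxE mul_row_pid_mx (leqNgt i.-1 j).
  by case: (ltnP j i.-1) => _; rewrite ?mulr1n ?mulr0n ?subrr ?subr0.
have [ji|] := leqP i.-1 j; last by rewrite mulr0n expr2 mul0r !mulr0.
apply: ler_wpM2r; first exact: sqr_ge0.
by apply: lambda_mono => //; have := ltn_ord j; lia.
Qed.

Lemma top_eigenspace n (A : 'M[R]_n) i : A^T = A -> (0 < i <= n)%N ->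
  exists U : 'M[R]_n, \rank U = i /\
    forall v, (v <= U)%MS -> lambda i A * qform 1%:M v <= qform A v.
Proof.
move=> symA /andP[i0 iln]; have [Q [QQ QQ' E]] := spectral_lambda symA.
have rQ : row_free Q by apply/row_freeP; exists Q^T.
exists ((pid_mx i : 'M[R]_n) *m Q); split.
  by rewrite mxrankMfree // rank_pid_mx.
move=> v /submxP [x Ex]; rewrite [in X in _ <= X]E qform_spectral (qform1_orth v QQ') mulr_sumr.
apply: ler_sum => j _; rewrite [(\row_k _) 0 j]mxE.
have -> : (v *m Q^T) 0 j = x 0 j *+ (j < i)%N.
  by rewrite Ex -!mulmxA QQ mulmx1 mul_row_pid_mx.
have [ji|] := ltnP j i; last by rewrite mulr0n expr2 mul0r !mulr0.
apply: ler_wpM2r; first exact: sqr_ge0.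
by apply: lambda_mono => //; rewrite ji iln.
Qed.

(** Weyl's inequality: the bottom eigenspace of [B] serves as test space for [A]. *)
Lemma lambda_le_perturb n (A B : 'M[R]_n) i c : A^T = A -> B^T = B -> (0 < i <= n)%N ->
  (forall v, qform A v <= qform B v + c * qform 1%:M v) ->
  lambda i A <= lambda i B + c.
Proof.
move=> symA symB i0n h; have [U [rU hU]] := bottom_eigenspace symB i0n.
apply: (lambda_le (U := U)) => //; first by rewrite rU; move: i0n; lia.
by move=> v /hU hv; rewrite mulrDl (le_trans (h v)) // lerD2r.
Qed.

Lemma cauchy_young m (a b : 'rV[R]_m) (c : R) : 0 < c ->
  2 * (a *m b^T) 0 0 <= c * qform 1%:M a + c^-1 * qform 1%:M b.
Proof.
move=> c0; rewrite !qform1E mxE !mulr_sumr -big_split /=; apply: ler_sum => j _.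
rewrite mxE -subr_ge0.
have -> : c * a 0 j ^+ 2 + c^-1 * b 0 j ^+ 2 - 2 * (a 0 j * b 0 j) =
  c * (a 0 j - c^-1 * b 0 j) ^+ 2.
  by field; rewrite gt_eqF.
by rewrite mulr_ge0 ?sqr_ge0 // ltW.
Qed.

Section Ostrowski.
Variables (n d : nat) (S Q : 'M[R]_d) (Z : 'M[R]_(n, d)).
Hypotheses (psdS : psd S) (unitS : S \in unitmx) (QQ : Q *m Q = S) (psdQ : psd Q).

Let X := Z *m Q.

Let qX (c : R) v : qform (c *: (X^T *m X)) v = c * qform 1%:M (v *m Q *m Z^T).
Proof.
have [symQ _] := psdQ; rewrite /X /qform -scalemxAr -scalemxAl [LHS]mxE; congr (_ * _).
by rewrite mulmx1 !trmx_mul symQ trmxK !mulmxA.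
Qed.

Let qS v : qform S v = qform 1%:M (v *m Q).
Proof. by have [symQ _] := psdQ; rewrite /qform mulmx1 -QQ trmx_mul symQ !mulmxA. Qed.

(** Here [S] is the covariance and [Q] its root. The hypothesis bounds the norm of the map y -> yZ,
    while the form of X^T X involves the adjoint map. The passage is |y|^2 = <w, yZ> for y = wZ^T,
    followed by Young's inequality. *)
Lemma lambda_sandwich_le i (c b : R) : 0 <= c -> 0 < b -> (0 < i <= d)%N ->
  (forall y : 'rV[R]_n, qform 1%:M (y *m Z) <= b * qform 1%:M y) ->
  lambda i (c *: (X^T *m X)) <= c * b * lambda i S.
Proof.
move=> c0 b0 i0d hb; have [symS _] := psdS.
have [U [rU hU]] := bottom_eigenspace symS i0d.
apply: (lambda_le (U := U)) => //.
- by rewrite linearZ /= trmx_mul trmxK.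
- by rewrite rU; move: i0d; lia.
move=> v /hU; rewrite qX qS => hv; rewrite -!mulrA ler_wpM2l //.
apply: le_trans (_ : b * qform 1%:M (v *m Q) <= _); last by rewrite ler_wpM2l // ltW.
set w := v *m Q; set y := w *m Z^T.
have E : qform 1%:M y = (w *m (y *m Z)^T) 0 0.
  by rewrite /qform mulmx1 /y !trmx_mul trmxK !mulmxA.
have := cauchy_young w (y *m Z) b0; rewrite -E => h.
have h2 : b^-1 * qform 1%:M (y *m Z) <= qform 1%:M y by rewrite ler_pdivrMl.
lra.
Qed.

(** The test space is the intersection of the top eigenspace of [S], of dimension i + d - n, with
    the row space of Z Q^(-1), of dimension n. Its dimension is at least i, which explains the shift
    of the index. On it vQ = yZ, and the lower bound passes to the adjoint map as before. *)
Lemma lambda_sandwich_ge i (c a : R) : 0 <= c -> (0 < i <= n)%N -> (n <= d)%N ->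
  (forall y : 'rV[R]_n, a * qform 1%:M y <= qform 1%:M (y *m Z)) ->
  c * a * lambda (i + d - n) S <= lambda i (c *: (X^T *m X)).
Proof.
move=> c0 i0n nd ha; have [symS _] := psdS.
have m0d : (0 < i + d - n <= d)%N by move: i0n; lia.
have psdX : psd (c *: (X^T *m X)).
  apply/psdP; split; first by rewrite linearZ /= trmx_mul trmxK.
  by move=> v; rewrite qX mulr_ge0 // qform1_ge0.
have i0d : (0 < i <= d)%N by move: i0n nd; lia.
(* A nonpositive [a] says nothing about the rank of [Z], but then the left-hand side is at most
   0. *)
have [a0|a0] := leP a 0.
  apply: le_trans (lambda_ge0 psdX i0d).
  by rewrite mulr_le0_ge0 ?mulr_ge0_le0 ?(lambda_ge0 psdS).
have [U [rU hU]] := top_eigenspace symS m0d.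
have unitQ : Q \in unitmx by move: unitS; rewrite -QQ unitmx_mul andbb.
have rZ : \rank (Z *m invmx Q) = n.
  rewrite mxrankMfree ?row_free_unit ?unitmx_inv //.
  apply/eqP; rewrite -/(row_free Z); apply: inj_row_free => y yZ.
  apply/eqP; apply: contraT => /qform1_gt0 y0; have := ha y.
  by rewrite yZ [X in _ <= X]/qform !mul0mx mxE leNgt mulr_gt0.
apply: (lambda_ge (U := (U :&: (Z *m invmx Q))%MS)) => //.
- by case: psdX.
- have := mxrank_sum_cap U (Z *m invmx Q); rewrite rU rZ.
  have := rank_leq_col (U + Z *m invmx Q)%MS; move: i0n nd; lia.
move=> v; rewrite sub_capmx => /andP[/hU hv /submxP [y Ey]].
rewrite qX -!mulrA ler_wpM2l //.
have vQ : v *m Q = y *m Z by rewrite Ey !mulmxA mulmxKV.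
move: hv; rewrite qS vQ => hv.
apply: le_trans (_ : a * qform 1%:M (y *m Z) <= _); first by rewrite ler_wpM2l // ltW.
set u := y *m Z *m Z^T.
have E : qform 1%:M (y *m Z) = (y *m u^T) 0 0.
  by rewrite /qform mulmx1 /u !trmx_mul trmxK !mulmxA.
have := cauchy_young y u a0; rewrite -E => h; have := ha y => h1.
by rewrite -ler_pdivlMl //; lra.
Qed.

End Ostrowski.
End PositiveSemidefinite.

(** * Scalar inequalities for powers *)

Section RealInequalities.
Variable R : realType.

Lemma tangent_pow (x y : R) k : 0 <= x -> 0 <= y ->
  y ^+ k + k%:R * y ^+ k.-1 * (x - y) <= x ^+ k.
Proof.
move=> x0 y0; case: k => [|k]; first by rewrite !expr0 mul0r mul0r addr0.
elim: k => [|k IH] /=; first by rewrite !expr1 expr0 mulr1 mul1r addrC subrK.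
rewrite [x ^+ k.+2]exprS; apply: le_trans (ler_wpM2l x0 IH).
rewrite -subr_ge0 /=.
have -> : x * (y ^+ k.+1 + k.+1%:R * y ^+ k * (x - y)) -
    (y ^+ k.+2 + k.+2%:R * y ^+ k.+1 * (x - y)) = k.+1%:R * y ^+ k * (x - y) ^+ 2.
  by rewrite !exprS -!natr1; ring.
by rewrite mulr_ge0 ?sqr_ge0 ?mulr_ge0 ?exprn_ge0 ?ler0n.
Qed.

Lemma jensen_pow (I : finType) (c mu : I -> R) k : (forall i, 0 <= c i) ->
  (forall i, 0 <= mu i) -> \sum_i c i = 1 ->
  (\sum_i c i * mu i) ^+ k <= \sum_i c i * mu i ^+ k.
Proof.
move=> c0 mu0 c1; set m := \sum_i c i * mu i.
have m0 : 0 <= m by rewrite sumr_ge0 // => i _; rewrite mulr_ge0.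
apply: le_trans (_ : \sum_i c i * (m ^+ k + k%:R * m ^+ k.-1 * (mu i - m)) <= _); last first.
  by apply: ler_sum => i _; rewrite ler_wpM2l // tangent_pow.
rewrite le_eqVlt; apply/orP; left; apply/eqP.
under eq_bigr do rewrite mulrDr mulrCA.
rewrite big_split /= -mulr_suml c1 mul1r -mulr_sumr.
under [X in _ + _ * X]eq_bigr do rewrite mulrBr.
by rewrite sumrB -mulr_suml c1 mul1r subrr mulr0 addr0.
Qed.

(** Young's inequality with crude constants: according to whether [mu] is below or above [s * m],
    one of the two terms on the right suffices. *)
Lemma young_pow (s m mu : R) q : 0 < s -> 0 <= m -> 0 <= mu ->
  mu ^+ q * m <= s ^+ q * m ^+ q.+1 + s^-1 * mu ^+ q.+1.
Proof.
move=> s0 m0 mu0; have [h|h] := leP mu (s * m).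
  rewrite -[leLHS]addr0 lerD ?mulr_ge0 ?exprn_ge0 ?invr_ge0 ?(ltW s0) //.
  by rewrite [m ^+ _]exprSr mulrA ler_wpM2r // -exprMn lerXn2r ?nnegrE // mulr_ge0 // ltW.
rewrite -[leLHS]add0r lerD ?mulr_ge0 ?exprn_ge0 ?(ltW s0) //.
by rewrite exprSr mulrCA ler_wpM2l ?exprn_ge0 // ler_pdivlMl // ltW.
Qed.

(** Weighted arithmetic-geometric mean of 1 and t^m, with weights 1 - k/m and k/m. It stands in for
    the log-convexity of moments and avoids roots. *)
Lemma amgm_pow (t : R) k m : 0 <= t -> (k <= m)%N -> (0 < m)%N ->
  t ^+ k <= 1 - k%:R / m%:R + k%:R / m%:R * t ^+ m.
Proof.
move=> t0 km m0; have mR : 0 < m%:R :> R by rewrite ltr0n.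
suff h : m%:R * t ^+ k <= m%:R - k%:R + k%:R * t ^+ m.
  rewrite -(ler_pM2l mR) (le_trans h) // le_eqVlt; apply/orP; left; apply/eqP.
  by field; rewrite gt_eqF.
have [k0|k0] := posnP k; first by rewrite k0 expr0 mulr1 subr0 mul0r addr0.
rewrite -(subnKC km); elim: (m - k)%N => [|j IH].
  by rewrite addn0 subrr add0r.
have step : t ^+ k - 1 <= k%:R * (t ^+ (k + j) * (t - 1)).
  have tg := tangent_pow k ler01 t0; rewrite expr1n in tg.
  apply: le_trans (_ : k%:R * (t ^+ k.-1 * (t - 1)) <= _).
    by rewrite mulrA; lra.
  rewrite ler_wpM2l // -subr_ge0 -mulrBl.
  have -> : (k + j = k.-1 + j.+1)%N by lia.
  rewrite exprD -[X in _ - X]mulr1 -mulrBr -mulrA mulr_ge0 ?exprn_ge0 //.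
  have [t1|t1] := leP 1 t.
    by rewrite mulr_ge0 ?subr_ge0 // exprn_ege1.
  by rewrite mulr_le0 ?subr_le0 ?(ltW t1) // exprn_ile1 // ltW.
rewrite addnS exprSr -natr1.
have -> : t ^+ (k + j) * t = t ^+ (k + j) + t ^+ (k + j) * (t - 1) by ring.
rewrite mulrDr; lra.
Qed.

End RealInequalities.

(** * Rank one perturbations of powers *)

Section PsdPowers.
Variable R : realType.

Lemma psd_powers n (S : 'M[R]_n) : psd S -> exists (Q : 'M[R]_n) (mu : 'rV[R]_n),
  [/\ Q *m Q^T = 1%:M, Q^T *m Q = 1%:M, forall j, 0 <= mu 0 j &
      forall k, S ^+ k = Q^T *m diag_mx (\row_j mu 0 j ^+ k) *m Q].
Proof.
move=> /psd_spectral [Q [mu [QQ QQ' E mu0]]]; exists Q, mu; split => // k.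
elim: k => [|k IH].
  rewrite expr0 (_ : \row_j _ = const_mx 1) ?diag_const_mx ?mulmx1 //.
  by apply/rowP => j; rewrite !mxE expr0.
rewrite exprS IH [in LHS]E -[LHS]/(_ *m _).
rewrite !mulmxA -(mulmxA _ Q) QQ mulmx1 -(mulmxA Q^T) mulmx_diag.
by congr (_ *m diag_mx _ *m _); apply/rowP => j; rewrite !mxE exprS.
Qed.

Lemma psd_pow n (S : 'M[R]_n) k : psd S -> psd (S ^+ k).
Proof.
move=> /psd_powers [Q [mu [QQ QQ' mu0 ->]]]; apply: psd_conj_diag => j.
by rewrite mxE exprn_ge0.
Qed.

Lemma psdD n (S T : 'M[R]_n) : psd S -> psd T -> psd (S + T).
Proof.
move=> /psdP [sS S0] /psdP [sT T0]; apply/psdP; split; first by rewrite linearD /= sS sT.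
by move=> v; rewrite /qform mulmxDr mulmxDl mxE addr_ge0 ?S0 ?T0.
Qed.

Lemma psd_gram n m (Y : 'M[R]_(m, n)) : psd (Y^T *m Y).
Proof.
apply/psdP; split; first by rewrite trmx_mul trmxK.
move=> v; rewrite /qform (_ : _ *m _ = (v *m Y^T) *m (v *m Y^T)^T).
  by have := qform1_ge0 (v *m Y^T); rewrite /qform mulmx1.
by rewrite trmx_mul trmxK !mulmxA.
Qed.

Lemma psd0 n : psd (0 : 'M[R]_n).
Proof.
by apply/psdP; split=> [|v]; rewrite ?trmx0 // /qform mulmx0 mul0mx mxE.
Qed.

Lemma psd_sum n (I : Type) (r : seq I) (p : pred I) (S : I -> 'M[R]_n) :
  (forall i, p i -> psd (S i)) -> psd (\sum_(i <- r | p i) S i).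
Proof. by move=> h; elim/big_ind: _ => //; [exact: psd0|exact: psdD]. Qed.

Lemma qform_row n m (Q : 'M[R]_(m, n)) (A : 'M[R]_n) j :
  qform A (row j Q) = (Q *m A *m Q^T) j j.
Proof.
rewrite /qform -row_mul mxE [RHS]mxE; apply: eq_bigr => k _.
by rewrite [row j _ _ _]mxE; congr (_ * _); rewrite !mxE.
Qed.

Lemma trace_orth n (Q A : 'M[R]_n) : Q^T *m Q = 1%:M ->
  \tr A = \sum_j qform A (row j Q).
Proof.
move=> QQ; rewrite -[in LHS](mulmx1 A) -QQ mulmxA mxtrace_mulC mulmxA.
by apply: eq_bigr => j _; rewrite qform_row.
Qed.

Lemma trace_pow_ge0 n (S : 'M[R]_n) k : psd S -> 0 <= \tr (S ^+ k).
Proof.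
move=> /(psd_pow k) /psdP [_ h]; rewrite (@trace_orth _ 1%:M) ?trmx1 ?mulmx1 //.
by rewrite sumr_ge0.
Qed.

Lemma qform_row_orth n (Q : 'M[R]_n) i : Q *m Q^T = 1%:M -> qform 1%:M (row i Q) = 1.
Proof. by move=> QQ; rewrite qform_row mulmx1 QQ mxE eqxx. Qed.

(** Jensen's inequality for the spectral measure of the unit vector [v]. *)
Lemma qform_pow_le n (S : 'M[R]_n) k v : psd S -> qform 1%:M v = 1 ->
  qform S v ^+ k <= qform (S ^+ k) v.
Proof.
move=> /psd_powers [Q [mu [QQ QQ' mu0 E]]] v1.
rewrite E -[X in qform X v ^+ _]expr1 E !qform_spectral.
under eq_bigr do rewrite mxE expr1 mulrC.
under [X in _ <= X]eq_bigr do rewrite mxE mulrC.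
by apply: jensen_pow => // [i|]; rewrite ?sqr_ge0 // -qform1_orth.
Qed.

Lemma qform_le_trace n (S : 'M[R]_n) v : psd S -> qform 1%:M v = 1 -> qform S v <= \tr S.
Proof.
move=> psdS v1; have [Q [mu [QQ QQ' E mu0]]] := psd_spectral psdS.
rewrite E qform_spectral mxtrace_mulC mulmxA QQ mul1mx mxtrace_diag.
apply: ler_sum => j _; rewrite ler_piMr //.
rewrite -v1 (qform1_orth v QQ') (bigD1 j) //= lerDl sumr_ge0 // => i _.
exact: sqr_ge0.
Qed.

(** In an eigenbasis of [Y] the trace is a sum of products of eigenvalues of [Y] and diagonal
    entries of [M]. [young_pow] splits each product, and [qform_pow_le] bounds the powers of
    diagonal entries of [M] by diagonal entries of its power. *)
Lemma trace_young n (M Y : 'M[R]_n) (s : R) q : psd M -> psd Y -> 0 < s ->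
  \tr (M *m Y ^+ q) <= s ^+ q * \tr (M ^+ q.+1) + s^-1 * \tr (Y ^+ q.+1).
Proof.
move=> psdM psdY s0; have [Q [mu [QQ QQ' mu0 E]]] := psd_powers psdY.
have -> : \tr (M *m Y ^+ q) = \sum_j mu 0 j ^+ q * qform M (row j Q).
  rewrite E !mulmxA mxtrace_mulC !mulmxA.
  apply: eq_bigr => j _; rewrite mul_mx_diag mxE [X in _ * X]mxE mulrC; congr (_ * _).
  by rewrite qform_row.
have -> : \tr (Y ^+ q.+1) = \sum_j mu 0 j ^+ q.+1.
  rewrite E mxtrace_mulC mulmxA QQ mul1mx mxtrace_diag.
  by apply: eq_bigr => j _; rewrite mxE.
rewrite (trace_orth (M ^+ q.+1) QQ') !mulr_sumr -big_split /=.
apply: ler_sum => j _; have [_ M0] := (psdP _).1 psdM.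
apply: le_trans (young_pow q s0 (M0 (row j Q)) (mu0 j)) _.
rewrite lerD2r ler_wpM2l ?exprn_ge0 ?(ltW s0) //.
by apply: qform_pow_le => //; exact: qform_row_orth.
Qed.

Section RankOne.
Variables (n : nat) (A : 'M[R]_n) (y : 'rV[R]_n).
Hypothesis psdA : psd A.
Let B := A + y^T *m y.

Let psdB : psd B.
Proof. by apply: psdD => //; exact: psd_gram. Qed.

Let a k := qform (A ^+ k) y.
Let b k := qform (B ^+ k) y.

Let a_ge0 k : 0 <= a k.
Proof. have /psdP [_ h] := psd_pow k psdA; exact: h. Qed.

Let b_ge0 k : 0 <= b k.
Proof. have /psdP [_ h] := psd_pow k psdB; exact: h. Qed.

Let yAB i k : (y *m (A ^+ i * (y^T *m y * B ^+ k)) *m y^T) 0 0 = a i * b k.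
Proof.
have -> : y *m (A ^+ i * (y^T *m y * B ^+ k)) *m y^T =
    (y *m A ^+ i *m y^T) *m (y *m B ^+ k *m y^T).
  by rewrite -[A ^+ i * _]/(A ^+ i *m (y^T *m y *m B ^+ k)) !mulmxA.
by rewrite mxE big_ord1.
Qed.

(** Expanding the factors [B = A + y^T y] one at a time gives a renewal equation in scalars, from
    which the noncommuting matrices have disappeared. *)
Let b_rec m : b m = a m + \sum_(k < m) a (m - k.+1) * b k.
Proof.
have E : forall j i, (y *m (A ^+ i * B ^+ j) *m y^T) 0 0 =
    a (i + j)%N + \sum_(k < j) a (i + (j - k.+1)) * b k.
  elim=> [|j IH] i; first by rewrite expr0 mulr1 big_ord0 addr0 addn0.
  have -> : A ^+ i * B ^+ j.+1 = A ^+ i.+1 * B ^+ j + A ^+ i * (y^T *m y * B ^+ j).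
    by rewrite exprS {1}/B mulrDl mulrDr [A ^+ i.+1]exprSr mulrA.
  rewrite mulmxDr mulmxDl mxE IH yAB big_ord_recr /= subnn addn0 addSnnS -addrA.
  congr (_ + (_ + _)); apply: eq_bigr => k _; congr (a _ * _).
  by have := ltn_ord k; lia.
by rewrite /b /qform -[B ^+ m]mul1r -(expr0 A) E.
Qed.

(** The products A^i B^k interpolate between powers of [A] and of [B]. Turning one more [A] into [B]
    adds a term with trace y A^i B^k y^T, and the same expansion shows that this number is
    nonnegative although the matrices do not commute. *)
Lemma trace_rank1_le q : \tr (A ^+ q) <= \tr ((A + y^T *m y) ^+ q).
Proof.
have yAB0 : forall k i, 0 <= (y *m (A ^+ i * B ^+ k) *m y^T) 0 0.
  elim=> [|k IH] i; first by rewrite expr0 mulr1; exact: a_ge0.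
  have -> : A ^+ i * B ^+ k.+1 = A ^+ i.+1 * B ^+ k + A ^+ i * (y^T *m y * B ^+ k).
    by rewrite exprS {1}/B mulrDl mulrDr [A ^+ i.+1]exprSr mulrA.
  by rewrite mulmxDr mulmxDl mxE yAB addr_ge0 ?mulr_ge0.
have h : forall k i, \tr (A ^+ (i + k)) <= \tr (A ^+ i * B ^+ k).
  elim=> [|k IH] i; first by rewrite addn0 expr0 mulr1.
  have -> : A ^+ i * B ^+ k.+1 = A ^+ i.+1 * B ^+ k + A ^+ i * (y^T *m y * B ^+ k).
    by rewrite exprS {1}/B mulrDl mulrDr [A ^+ i.+1]exprSr mulrA.
  rewrite mxtraceD -addSnnS -[leLHS]addr0 lerD ?IH //.
  have [[sA _] [sB _]] := (psd_pow i psdA, psd_pow k psdB).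
  rewrite -[A ^+ i * _]/(A ^+ i *m (y^T *m y *m B ^+ k)) -mxtrace_tr !trmx_mul trmxK sA sB.
  rewrite !mulmxA -(mulmxA _ y) mxtrace_mulC /mxtrace big_ord1.
  by have := yAB0 k i; rewrite -[A ^+ i * _]/(_ *m _) !mulmxA.
by have := h q 0%N; rewrite add0n expr0 mul1r.
Qed.

(** The renewal equation is compared with a geometric one: if a_k <= al tau^k for all k <= m, where
    al = |y|^2, then b_j <= al (tau + al)^j. Taking for [tau] the larger of al/delta and
    (a_m/al)^(1/m) yields the two terms of the bound. *)
Lemma rank1_pow_le m (delta : R) : 0 < delta ->
  qform ((A + y^T *m y) ^+ m) y <=
  (1 + delta) ^+ m * qform (A ^+ m) y + (1 + delta^-1) ^+ m * qform 1%:M y ^+ m.+1.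
Proof.
move=> delta0; rewrite -/B -/(b m) -/(a m).
have a0E : a 0%N = qform 1%:M y by rewrite /a expr0.
set al := qform 1%:M y; have al0 : 0 <= al by exact: qform1_ge0.
have [al_eq|al_neq] := eqVneq al 0.
  have y0 : y = 0 by apply/eqP; apply: contraT => /qform1_gt0; rewrite -/al al_eq ltxx.
  have -> : b m = 0 by rewrite /b /qform y0 !mul0mx mxE.
  by rewrite addr_ge0 // mulr_ge0 ?exprn_ge0 ?addr_ge0 ?invr_ge0 ?(ltW delta0).
have al_gt0 : 0 < al by rewrite lt_neqAle eq_sym al_neq.
have [m0|m_gt0] := posnP m.
  by rewrite m0 /b /a !expr0 !mul1r lerDl.
have bound tau : 0 < tau -> a m <= al * tau ^+ m -> b m <= al * (tau + al) ^+ m.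
  move=> tau0 am.
  (* A bound at the exponent m alone suffices: [amgm_pow], summed against the spectral measure of
     [y], interpolates between the exponents 0 and m. *)
  have ak k : (k <= m)%N -> a k <= al * tau ^+ k.
    move=> km; have [Q [mu [QQ QQ' mu0 E]]] := psd_powers psdA.
    have aE j : a j = \sum_i (y *m Q^T) 0 i ^+ 2 * mu 0 i ^+ j.
      by rewrite /a E qform_spectral; apply: eq_bigr => i _; rewrite mxE mulrC.
    have alE : al = \sum_i (y *m Q^T) 0 i ^+ 2 by rewrite /al (qform1_orth y QQ').
    have h : a k <= tau ^+ k * (al * (1 - k%:R / m%:R) + k%:R / m%:R * (a m / tau ^+ m)).
      rewrite !aE alE mulr_suml mulr_suml mulr_sumr -big_split /= mulr_sumr.
      apply: ler_sum => i _; have t0 : 0 <= mu 0 i / tau by rewrite divr_ge0 // ltW.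
      have := amgm_pow t0 km m_gt0; rewrite !expr_div_n ler_pdivrMr ?exprn_gt0 // => hh.
      have := ler_wpM2l (sqr_ge0 ((y *m Q^T) 0 i)) hh; move=> h2.
      apply: le_trans h2 _; rewrite le_eqVlt; apply/orP; left; apply/eqP; ring.
    apply: (le_trans h); rewrite mulrC ler_wpM2r ?exprn_ge0 ?(ltW tau0) //.
    have : k%:R / m%:R * (a m / tau ^+ m) <= k%:R / m%:R * al.
      by rewrite ler_wpM2l ?divr_ge0 // ler_pdivrMr ?exprn_gt0.
    lra.
  suff : forall j, (j <= m)%N -> b j <= al * (tau + al) ^+ j by apply.
  move=> j; have [N] := ubnP j; elim: N j => // N IH j; rewrite ltnS => jN jm.
  rewrite b_rec; apply: le_trans (_ : al * tau ^+ j +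
      \sum_(k < j) al * tau ^+ (j - k.+1) * (al * (tau + al) ^+ k) <= _).
    apply: lerD; first exact: ak.
    apply: ler_sum => k _; have kj := ltn_ord k.
    apply: ler_pM => //; first by apply: ak; lia.
    by apply: IH; lia.
  rewrite le_eqVlt; apply/orP; left; apply/eqP.
  (* For the majorants the renewal equation is exact: the sum is the geometric expansion of (tau +
     al)^j - tau^j. *)
  have -> : \sum_(k < j) al * tau ^+ (j - k.+1) * (al * (tau + al) ^+ k) =
     al * ((tau + al) ^+ j - tau ^+ j).
    rewrite -[_ - _]opprB subrXX [X in - (X * _)](_ : _ = - al); last by ring.
    rewrite mulNr opprK mulrA mulr_sumr; apply: eq_bigr => k _.
    by rewrite -subn1 subnAC subn1 -subnS; ring.
  by ring.
(* Here al/delta is the larger value, and al (tau + al)^m becomes the second term of the bound. *)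
have [h|h] := leP (a m) (al * (al / delta) ^+ m).
  have ald : 0 < al / delta by rewrite divr_gt0.
  apply: (le_trans (bound _ ald h)); rewrite -[leLHS]add0r lerD ?mulr_ge0 ?exprn_ge0 //.
    by rewrite addr_ge0 // ltW.
  rewrite [al ^+ m.+1]exprS mulrCA -exprMn le_eqVlt; apply/orP; left; apply/eqP.
  by congr (_ * _ ^+ m); ring.
have am0 : 0 <= a m / al by rewrite divr_ge0.
pose tau := (a m / al) `^ (m%:R^-1).
have tauE : tau ^+ m = a m / al.
  rewrite -powR_mulrn ?powR_ge0 // -powRrM mulVf ?pnatr_eq0 ?gt_eqF // powRr1 //.
have tau_gt : al / delta < tau.
  rewrite ltNge; apply/negP => tle.
  have : tau ^+ m <= (al / delta) ^+ m.
    by rewrite lerXn2r ?nnegrE ?powR_ge0 // divr_ge0 // ltW.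
  by rewrite tauE ler_pdivrMr // mulrC leNgt h.
have tau0 : 0 < tau by rewrite (lt_trans _ tau_gt) // divr_gt0.
have am : a m <= al * tau ^+ m by rewrite tauE mulrCA divff ?gt_eqF // mulr1.
apply: (le_trans (bound _ tau0 am)); rewrite -[leLHS]addr0 lerD //; last first.
  by rewrite mulr_ge0 ?exprn_ge0 // addr_ge0 // invr_ge0 ltW.
have -> : a m = al * tau ^+ m by rewrite tauE mulrCA divff ?gt_eqF // mulr1.
(* Now al < delta tau, so tau + al is at most (1 + delta) tau. *)
rewrite mulrCA -exprMn ler_wpM2l // lerXn2r ?nnegrE //.
- by rewrite addr_ge0 // ltW.
- by rewrite mulr_ge0 ?addr_ge0 ?ltW.
- by move: tau_gt; rewrite ltr_pdivrMr //; lra.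
Qed.

End RankOne.
End PsdPowers.

(** * Expectation and independence *)

Section BoundedMeasurable.
Context {dsp : measure_display} {T : measurableType dsp} {R : realType}.
Implicit Types f g : T -> R.

(** The vectors have a fixed norm, so boundedness is available throughout; unlike integrability it
    is stable under products. *)
Definition bmeas f : Prop :=
  measurable_fun [set: T] f /\ exists M, forall w, `|f w| <= M.

Lemma bmeas_cst (c : R) : bmeas (fun=> c).
Proof. by split; [exact: measurable_cst|exists `|c|]. Qed.

Lemma bmeasD f g : bmeas f -> bmeas g -> bmeas (fun w => f w + g w).
Proof.
move=> [mf [M hM]] [mg [N hN]]; split; first exact: measurable_funD.
by exists (M + N) => w; rewrite (le_trans (ler_normD _ _)) // lerD.
Qed.

Lemma bmeasM f g : bmeas f -> bmeas g -> bmeas (fun w => f w * g w).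
Proof.
move=> [mf [M hM]] [mg [N hN]]; split; first exact: measurable_funM.
by exists (M * N) => w; rewrite normrM ler_pM.
Qed.

Lemma bmeasZ c f : bmeas f -> bmeas (fun w => c * f w).
Proof. by move=> bf; apply: bmeasM => //; exact: bmeas_cst. Qed.

Lemma bmeasN f : bmeas f -> bmeas (fun w => - f w).
Proof.
move=> bf; rewrite (_ : (fun w => - f w) = (fun w => -1 * f w)); first exact: bmeasZ.
by apply/funext => w; rewrite mulN1r.
Qed.

Lemma bmeasB f g : bmeas f -> bmeas g -> bmeas (fun w => f w - g w).
Proof. by move=> bf bg; apply: bmeasD => //; exact: bmeasN. Qed.

Lemma bmeasX f k : bmeas f -> bmeas (fun w => f w ^+ k).
Proof.
move=> bf; elim: k => [|k IH]; first exact: bmeas_cst.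
rewrite (_ : (fun w => _) = (fun w => f w * f w ^+ k)); first exact: bmeasM.
by apply/funext => w; rewrite exprS.
Qed.

Lemma bmeas_sum (I : Type) (r : seq I) (p : pred I) (F : I -> T -> R) :
  (forall i, p i -> bmeas (F i)) -> bmeas (fun w => \sum_(i <- r | p i) F i w).
Proof.
move=> h; elim: r => [|i r IH].
  by under [X in bmeas X]funext do rewrite big_nil; exact: bmeas_cst.
under [X in bmeas X]funext do rewrite big_cons.
by case: (boolP (p i)) => // pi; apply: bmeasD => //; exact: h.
Qed.

Lemma bmeas_expR f : bmeas f -> bmeas (fun w => expR (f w)).
Proof.
move=> [mf [M hM]]; split; first exact: measurableT_comp.
by exists (expR M) => w; rewrite ger0_norm ?expR_ge0 // ler_expR (le_trans (ler_norm _)).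
Qed.

Variable P : probability T R.

Definition Ex f : R := Rintegral P [set: T] f.

Lemma bmeas_integrable f : bmeas f -> P.-integrable [set: T] (EFin \o f).
Proof.
move=> [mf [M hM]]; apply: measurable_bounded_integrable => //.
  by rewrite (le_lt_trans (probability_le1 P measurableT)) // ltry.
exists M; split => [|x xM w _]; first exact: num_real.
by apply: le_trans (hM w) _; exact: ltW.
Qed.

Lemma EFin_Ex f : bmeas f -> (Ex f)%:E = (\int[P]_w (f w)%:E)%E.
Proof.
move=> bf; rewrite /Ex /Rintegral fineK //.
exact: (integrable_fin_num measurableT (bmeas_integrable bf)).
Qed.

Lemma Ex_cst c : Ex (fun=> c) = c.
Proof. by rewrite /Ex Rintegral_cst // [X in fine X](@probability_setT _ _ _ P) mulr1. Qed.

Lemma ExD f g : bmeas f -> bmeas g -> Ex (fun w => f w + g w) = Ex f + Ex g.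
Proof. by move=> bf bg; apply: RintegralD => //; exact: bmeas_integrable. Qed.

Lemma ExZ c f : bmeas f -> Ex (fun w => c * f w) = c * Ex f.
Proof. by move=> bf; apply: RintegralZl => //; exact: bmeas_integrable. Qed.

Lemma Ex_sum (I : Type) (r : seq I) (p : pred I) (F : I -> T -> R) :
  (forall i, p i -> bmeas (F i)) ->
  Ex (fun w => \sum_(i <- r | p i) F i w) = \sum_(i <- r | p i) Ex (F i).
Proof.
move=> h; elim: r => [|i r IH].
  by under [X in Ex X]funext do rewrite big_nil; rewrite big_nil Ex_cst.
under [X in Ex X]funext do rewrite big_cons; rewrite big_cons.
case: (boolP (p i)) => // pi; rewrite ExD ?IH //; first exact: h.
exact: bmeas_sum.
Qed.

Lemma Ex_le f g : bmeas f -> bmeas g -> (forall w, f w <= g w) -> Ex f <= Ex g.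
Proof. by move=> bf bg fg; apply: le_Rintegral => //; exact: bmeas_integrable. Qed.

Lemma Ex_ge0 f : (forall w, 0 <= f w) -> 0 <= Ex f.
Proof. by move=> f0; apply: Rintegral_ge0. Qed.

End BoundedMeasurable.

Lemma bmeas_comp (R : realType) d1 d2 (T1 : measurableType d1) (T2 : measurableType d2)
  (phi : T1 -> T2) (f : T2 -> R) : measurable_fun [set: T1] phi -> bmeas f -> bmeas (f \o phi).
Proof.
move=> mphi [mf [M hM]]; split; first exact: measurableT_comp.
by exists M => w; exact: hM.
Qed.

Section IndependentFubini.
Context {dsp d1 d2 : measure_display} {T : measurableType dsp}.
Context {T1 : measurableType d1} {T2 : measurableType d2} {R : realType}.
Variables (P : probability T R) (X1 : {mfun T >-> T1}) (X2 : {mfun T >-> T2}).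
Hypothesis indep : forall A1 A2, measurable A1 -> measurable A2 ->
  P (X1 @^-1` A1 `&` X2 @^-1` A2) = (P (X1 @^-1` A1) * P (X2 @^-1` A2))%E.

Lemma Ex_distribution d' (T' : measurableType d') (X : {mfun T >-> T'}) (f : T' -> R) :
  bmeas f -> Ex (distribution P X) f = Ex P (f \o X).
Proof.
move=> bf; apply: EFin_inj; rewrite !EFin_Ex //; last exact: bmeas_comp.
rewrite /distribution integral_pushforward //.
  by apply/measurable_EFinP; case: bf.
rewrite preimage_setT.
exact: (bmeas_integrable P (bmeas_comp (@measurable_funPT _ _ _ _ X) bf)).
Qed.

(** Independence makes the joint law the product of the two laws, and Fubini's theorem applies to
    the bounded [F]. The first conclusion is what allows the inner integral to be compared with
    other functions under the outer one. *)
Lemma indep_Ex (F : T1 * T2 -> R) : bmeas F ->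
  bmeas (fun y => Ex P (fun w => F (X1 w, y))) /\
  Ex P (fun w => F (X1 w, X2 w)) =
  Ex P (fun w2 => Ex P (fun w1 => F (X1 w1, X2 w2))).
Proof.
move=> bF.
have mX12 : measurable_fun [set: T] (fun w => (X1 w, X2 w)).
  by apply/measurable_fun_pairP; split.
pose X12 : {mfun T >-> (T1 * T2)%type} :=
  HB.pack (fun w => (X1 w, X2 w)) (isMeasurableFun.Build _ _ _ _ _ mX12).
pose m1 := distribution P X1; pose m2 := distribution P X2.
have bF1 y : bmeas (fun x => F (x, y)).
  exact: (bmeas_comp (measurable_pair2 y) bF).
have intF : (m1 \x m2)%E.-integrable [set: T1 * T2] (EFin \o F) by exact: bmeas_integrable.
have bG : bmeas (fun y => Ex P (fun w => F (X1 w, y))).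
  have E y : Ex P (fun w => F (X1 w, y)) = fine (\int[m1]_x (F (x, y))%:E)%E.
    by rewrite -(Ex_distribution X1 (bF1 y)).
  split.
    under eq_fun do rewrite E.
    apply: measurableT_comp => //.
    by apply: (measurable_fubini_G intF).
  have [_ [M hM]] := bF; exists M => y; rewrite ler_norml; apply/andP; split.
    rewrite -[- M](Ex_cst P); apply: Ex_le => [||w]; first exact: bmeas_cst.
      exact: (bmeas_comp (@measurable_funPT _ _ _ _ X1) (bF1 y)).
    by have := hM (X1 w, y); rewrite ler_norml => /andP[].
  rewrite -[leRHS](Ex_cst P); apply: Ex_le => [||w]; last 1 first.
  - by have := hM (X1 w, y); rewrite ler_norml => /andP[].
  - exact: (bmeas_comp (@measurable_funPT _ _ _ _ X1) (bF1 y)).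
  - exact: bmeas_cst.
split => //.
rewrite -[LHS]/(Ex P (F \o X12)) -Ex_distribution //.
rewrite -[RHS]/(Ex P ((fun y => Ex P (fun w => F (X1 w, y))) \o X2)) -Ex_distribution //.
apply: EFin_inj; rewrite !EFin_Ex //.
transitivity (\int[m1 \x m2]_z (F z)%:E)%E.
  apply: eq_measure_integral => A mA _.
  apply/esym; apply: (@product_measure_unique _ _ _ _ _ m1 m2 (distribution P X12)) => //.
rewrite -(integral21_prod_meas1 intF); apply: eq_integral => y _.
by rewrite -[in RHS](Ex_distribution X1 (bF1 y)) EFin_Ex.
Qed.

End IndependentFubini.

(** * Conditioning on blocks of independent vectors *)

Section Blocks.
Context {dsp : measure_display} {T : measurableType dsp} {R : realType} {n d : nat}.
Variables (P : probability T R) (z : 'I_n -> T -> 'cV[R]_d).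

Definition independent_vectors : Prop :=
  forall (J : {set 'I_n}) (B : 'I_n -> set 'cV[R]_d),
    (forall k, k \in J -> borel_cV (B k)) ->
    P [set w | forall k, k \in J -> B k (z k w)] =
    (\prod_(k in J) P (z k @^-1` B k))%E.

(* A function on [block J] is measurable when it is a measurable function of the
   vectors with index in [J]. *)
Definition cylinders (J : {set 'I_n}) : set (set T) :=
  [set A | exists B : 'I_n -> set 'cV[R]_d, (forall k, borel_cV (B k)) /\
    A = [set w | forall k, k \in J -> B k (z k w)]].

Definition block (J : {set 'I_n}) : measurableType _ :=
  g_sigma_algebraType (cylinders J).

Lemma borel_cVT : borel_cV [set: 'cV[R]_d].
Proof. by apply: sub_gen_smallest; exact: openT. Qed.

Lemma borel_cVI (A B : set 'cV[R]_d) : borel_cV A -> borel_cV B -> borel_cV (A `&` B).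
Proof.
exact: (@measurableI _ (g_sigma_algebraType [set B : set 'cV[R]_d | open B])).
Qed.

Lemma cylindersT J : cylinders J [set: T].
Proof.
exists (fun=> setT); split; first by move=> _; exact: borel_cVT.
by apply/seteqP; split.
Qed.

Lemma cylindersI J : setI_closed (cylinders J).
Proof.
move=> _ _ [B [mB ->]] [C [mC ->]]; exists (fun k => B k `&` C k); split.
  by move=> k; exact: borel_cVI.
apply/seteqP; split => w /=; first by move=> [h1 h2] k kJ; split; [exact: h1|exact: h2].
by move=> h; split => k /h [].
Qed.

Lemma cylinders_subset (J J' : {set 'I_n}) : J \subset J' -> cylinders J `<=` cylinders J'.
Proof.
move=> JJ' _ [B [mB ->]]; exists (fun k => if k \in J then B k else setT); split.
  by move=> k; case: ifP => _; [exact: mB|exact: borel_cVT].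
apply/seteqP; split => w /= h k kJ; first by case: ifP => // /h.
by have := h k (fintype.subsetP JJ' k kJ); rewrite kJ.
Qed.

Lemma bmeas_block_subset (J J' : {set 'I_n}) (f : T -> R) : J \subset J' ->
  bmeas (f : block J -> R) -> bmeas (f : block J' -> R).
Proof.
move=> JJ' [mf bf]; split=> // _ B mB.
rewrite setTI; have := mf measurableT B mB; rewrite setTI.
apply: sub_smallest2r; first exact: smallest_sigma_algebra.
exact: cylinders_subset.
Qed.

Hypothesis zm : forall k B, borel_cV B -> measurable (z k @^-1` B).

Lemma measurable_cylinders J : cylinders J `<=` measurable.
Proof.
move=> _ [B [mB ->]].
rewrite (_ : [set w | _] = \big[setI/setT]_(k in J) (z k @^-1` B k)).
  by apply: bigsetI_measurable => k _; exact: zm.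
apply/seteqP; split => w /=.
  by move=> h; elim/big_ind: _.
by move=> h k kJ; move: h; rewrite (bigD1 k) //= => -[].
Qed.

Lemma measurable_id_block J : measurable_fun [set: T] (id : T -> block J).
Proof.
move=> _ A mA; rewrite setTI preimage_id.
have : <<s cylinders J >> `<=` measurable; last exact.
apply: smallest_sub; last exact: measurable_cylinders.
split => [|B mB|F mF].
- exact: measurable0.
- by apply: measurableD.
- exact: bigcupT_measurable.
Qed.

Lemma bmeas_block J (f : T -> R) : bmeas (f : block J -> R) -> bmeas f.
Proof. by move=> bf; exact: (bmeas_comp (@measurable_id_block J) bf). Qed.

Hypothesis zi : independent_vectors.

Lemma cylinders_indep (J1 J2 : {set 'I_n}) A1 A2 : (forall k, k \in J1 -> (k \in J2) = false) ->
  cylinders J1 A1 -> cylinders J2 A2 -> P (A1 `&` A2) = (P A1 * P A2)%E.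
Proof.
move=> dJ [B [mB ->]] [C [mC ->]].
pose D k := if k \in J1 then B k else C k.
have -> : [set w | forall k, k \in J1 -> B k (z k w)] `&`
    [set w | forall k, k \in J2 -> C k (z k w)] =
    [set w | forall k, k \in J1 :|: J2 -> D k (z k w)].
  apply/seteqP; split => w /=.
    move=> [hB hC] k; rewrite inE /D; case: ifP => [kJ _|_ /= kJ]; [exact: hB|exact: hC].
  move=> h; split => k kJ; have := h k; rewrite inE kJ ?orbT /D => /(_ isT).
    by rewrite kJ.
  by case: ifP => // k1; rewrite (dJ _ k1) in kJ.
rewrite !zi // => [|k _]; last by rewrite /D; case: ifP.
rewrite (eq_bigl [predU J1 & J2]); last by move=> k; rewrite !inE.
rewrite bigU /=; last by apply/pred0P => k /=; case: (boolP (k \in J1)) => // /dJ.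
congr (_ * _)%E; apply: eq_bigr => k kJ; rewrite /D.
  by rewrite (_ : k \in J1).
by case: ifP => // /dJ; rewrite (_ : k \in J2).
Qed.

(** As functions of [B], the measure of the intersection with [A] and the multiple P(A) P of [P] are
    measures that agree on the pi-system [G], hence on the sigma-algebra it generates. Independence
    of two blocks needs this once for each block. *)
Let indep_ext (G : set (set T)) (A : set T) : G `<=` measurable -> setI_closed G ->
  G setT -> measurable A -> (forall B, G B -> P (B `&` A) = (P A * P B)%E) ->
  forall B, <<s G >> B -> P (B `&` A) = (P A * P B)%E.
Proof.
move=> mG GI GT mA h B sB.
have PA0 : 0 <= fine (P A) by rewrite fine_ge0.
have PAE : (fine (P A))%:E = P A by rewrite fineK // fin_num_measure.
have E C : mscale (NngNum PA0) P C = (P A * P C)%E.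
  by transitivity ((fine (P A))%:E * P C)%E; [|rewrite PAE].
rewrite -E -[LHS]/(mrestr P mA B).
apply: (@g_sigma_algebra_measure_unique _ _ _ G mG (fun=> setT) (fun=> GT)) => //.
- by rewrite bigcup_const.
- by move=> C GC; exact: (etrans (h C GC) (esym (E C))).
- by move=> _; rewrite -[X in (X < _)%E]/(P (setT `&` A)) setTI ltey_eq fin_num_measure.
Qed.

Lemma block_indep (J1 J2 : {set 'I_n}) A1 A2 : (forall k, k \in J1 -> (k \in J2) = false) ->
  @measurable _ (block J1) A1 -> @measurable _ (block J2) A2 ->
  P (A1 `&` A2) = (P A1 * P A2)%E.
Proof.
move=> dJ m1 m2.
have mb J A : @measurable _ (block J) A -> @measurable _ T A.
  by move=> mA; have := measurable_id_block (J := J) measurableT mA; rewrite setTI.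
rewrite setIC; apply: (indep_ext (G := cylinders J2)) => //.
- exact: measurable_cylinders.
- exact: cylindersI.
- exact: cylindersT.
- exact: (mb J1).
move=> C2 c2; rewrite setIC muleC; apply: (indep_ext (G := cylinders J1)) => //.
- exact: measurable_cylinders.
- exact: cylindersI.
- exact: cylindersT.
- exact: (measurable_cylinders c2).
by move=> C1 c1; rewrite muleC (cylinders_indep dJ).
Qed.

(** Both coordinates are the identity of [T], read with two sigma-algebras. On the diagonal [F] is
    thus a function of two independent blocks, and it may be integrated over independent copies of
    them: this is conditioning on the rows in [J2]. *)
Lemma block_Ex (J1 J2 : {set 'I_n}) (F : block J1 * block J2 -> R) : (forall k, k \in J1 -> (k \in J2) = false) ->
  bmeas F ->
  bmeas ((fun w2 => Ex P (fun w1 => F (w1, w2))) : block J2 -> R) /\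
  Ex P (fun w => F (w, w)) = Ex P (fun w2 => Ex P (fun w1 => F (w1, w2))).
Proof.
move=> dJ bF.
pose X1 : {mfun T >-> block J1} :=
  HB.pack (id : T -> block J1) (isMeasurableFun.Build _ _ _ _ _ (@measurable_id_block J1)).
pose X2 : {mfun T >-> block J2} :=
  HB.pack (id : T -> block J2) (isMeasurableFun.Build _ _ _ _ _ (@measurable_id_block J2)).
apply: (@indep_Ex _ _ _ _ _ _ _ P X1 X2 _ F bF) => A1 A2 m1 m2.
exact: (block_indep dJ).
Qed.

End Blocks.

Section MatrixValued.
Context {dsp : measure_display} {T : measurableType dsp} {R : realType}.

Definition bmx m n (A : T -> 'M[R]_(m, n)) : Prop := forall i j, bmeas (fun w => A w i j).

Lemma bmx_mul m n p (A : T -> 'M[R]_(m, n)) (B : T -> 'M[R]_(n, p)) :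
  bmx A -> bmx B -> bmx (fun w => A w *m B w).
Proof.
move=> bA bB i j; under [X in bmeas X]funext do rewrite mxE.
by apply: bmeas_sum => k _; apply: bmeasM.
Qed.

Lemma bmx_tr m n (A : T -> 'M[R]_(m, n)) : bmx A -> bmx (fun w => (A w)^T).
Proof. by move=> bA i j; under [X in bmeas X]funext do rewrite mxE; exact: bA. Qed.

Lemma bmx_cst m n (A : 'M[R]_(m, n)) : bmx (fun=> A).
Proof. by move=> i j; exact: bmeas_cst. Qed.

Lemma bmx_sum m n (I : Type) (r : seq I) (p : pred I) (A : I -> T -> 'M[R]_(m, n)) :
  (forall i, p i -> bmx (A i)) -> bmx (fun w => \sum_(i <- r | p i) A i w).
Proof.
move=> h i j; under [X in bmeas X]funext do rewrite summxE.
by apply: bmeas_sum => k pk; exact: h.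
Qed.

Lemma bmx_pow n (A : T -> 'M[R]_n) k : bmx A -> bmx (fun w => A w ^+ k).
Proof.
move=> bA; elim: k => [|k IH].
  by under [X in bmx X]funext do rewrite expr0; exact: bmx_cst.
by under [X in bmx X]funext do rewrite exprS; exact: bmx_mul.
Qed.

Lemma bmeas_trace n (A : T -> 'M[R]_n) : bmx A -> bmeas (fun w => \tr (A w)).
Proof. by move=> bA; apply: bmeas_sum => i _; exact: bA. Qed.

Lemma bmeas_qform n (A : T -> 'M[R]_n) (v : T -> 'rV[R]_n) :
  bmx A -> bmx v -> bmeas (fun w => qform (A w) (v w)).
Proof. by move=> bA bv; apply: bmx_mul; [exact: bmx_mul|exact: bmx_tr]. Qed.

End MatrixValued.

Section Vectors.
Context {dsp : measure_display} {T : measurableType dsp} {R : realType} {n d : nat}.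
Variables (P : probability T R) (z : 'I_n -> T -> 'cV[R]_d).
Hypothesis zm : forall k B, borel_cV B -> measurable (z k @^-1` B).
Hypothesis zi : independent_vectors P z.
Hypothesis zn : forall k w, dotv (z k w) (z k w) = d%:R.

Lemma borel_cV_coord (a : 'I_d) (B : set R) : measurable B ->
  borel_cV [set u : 'cV[R]_d | B (u a 0)].
Proof.
pose bT := g_sigma_algebraType [set B : set 'cV[R]_d | open B].
suff mf : measurable_fun [set: bT] ((fun u => u a 0) : bT -> R).
  by move=> mB; have := mf measurableT B mB; rewrite setTI.
move=> mT; apply: (measurability _ (RGenOpens.measurableE R)) => //.
move=> _ [_ [x [y ->]] <-]; rewrite setTI; apply: sub_gen_smallest.
have := @coord_continuous R d 1 a 0; rewrite continuousP => /(_ `]x, y[%classic); apply.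
exact: interval_open.
Qed.

Lemma bmx_vector (J : {set 'I_n}) k : k \in J -> @bmx _ (block z J) _ _ _ (z k).
Proof.
move=> kJ a b; rewrite (ord1 b); split.
  move=> _ B mB; rewrite setTI; apply: sub_gen_smallest.
  exists (fun l => if l == k then [set u : 'cV[R]_d | B (u a 0)] else setT); split.
    by move=> l; case: ifP => _; [exact: borel_cV_coord|exact: borel_cVT].
  apply/seteqP; split => w /=; first by move=> h l _; case: eqP => [->|].
  by move=> /(_ k kJ); rewrite eqxx.
exists (Num.sqrt d%:R) => w; rewrite -sqrtr_sqr ler_wsqrtr // -(zn k w) /dotv (bigD1 a) //=.
by rewrite -expr2 lerDl sumr_ge0 // => i _; rewrite -expr2 sqr_ge0.
Qed.

Lemma bmx_block m p (J : {set 'I_n}) (A : T -> 'M[R]_(m, p)) :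
  @bmx _ (block z J) _ _ _ A -> bmx A.
Proof. by move=> bA i j; apply: (bmeas_block zm (J := J)); exact: bA. Qed.

Lemma bmeas_fst (J1 J2 : {set 'I_n}) (f : T -> R) : @bmeas _ (block z J1) R f ->
  @bmeas _ (block z J1 * block z J2)%type R (fun p => f p.1).
Proof. by move=> bf; exact: (bmeas_comp measurable_fst bf). Qed.

Lemma bmeas_snd (J1 J2 : {set 'I_n}) (f : T -> R) : @bmeas _ (block z J2) R f ->
  @bmeas _ (block z J1 * block z J2)%type R (fun p => f p.2).
Proof. by move=> bf; exact: (bmeas_comp measurable_snd bf). Qed.

Lemma bmeas_dotv d' (S : measurableType d') (u v : S -> 'cV[R]_d) :
  bmx u -> bmx v -> bmeas (fun w => dotv (u w) (v w)).
Proof. by move=> bu bv; apply: bmeas_sum => j _; apply: bmeasM. Qed.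

(** Given the rows in [J], the vector [v] and the weight [H] are constants, and only z_k is
    averaged. Stability under [G] is asked on all measurable spaces because it is applied both on a
    product of two blocks and on [T]. *)
Lemma peel_le (J : {set 'I_n}) k (G : R -> R) (v : T -> 'cV[R]_d) (b H : T -> R) :
  k \notin J ->
  (forall dsp' (S : measurableType dsp') (f : S -> R), bmeas f -> bmeas (G \o f)) ->
  @bmx _ (block z J) _ _ _ v -> @bmeas _ (block z J) _ H -> (forall w, 0 <= H w) ->
  bmeas b -> (forall w, Ex P (fun w' => G (dotv (z k w') (v w))) <= b w) ->
  Ex P (fun w => G (dotv (z k w) (v w)) * H w) <= Ex P (fun w => b w * H w).
Proof.
move=> kJ bG bv bH H0 bb hb.
pose F (p : block z [set k] * block z J) := G (dotv (z k p.1) (v p.2)) * H p.2.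
have bd : bmeas ((fun p => dotv (z k p.1) (v p.2)) : block z [set k] * block z J -> R).
  apply: bmeas_dotv => i j.
    by apply: (@bmeas_fst [set k] J (fun w => z k w i j)); apply: bmx_vector; rewrite inE.
  by apply: (@bmeas_snd [set k] J (fun w => v w i j)); exact: bv.
have bF : bmeas F by apply: bmeasM; [exact: (bG _ _ _ bd)|exact: bmeas_snd].
have dJ l : l \in [set k]%SET -> (l \in J) = false by move=> /finset.set1P ->; exact: negbTE.
have [bE E] := block_Ex zm zi dJ bF.
rewrite -[leLHS]/(Ex P (fun w => F (w, w))) E; apply: Ex_le.
- exact: (bmeas_block zm bE).
- by apply: bmeasM => //; exact: (bmeas_block zm bH).
move=> w; rewrite /F /=.
under [X in Ex P X]funext do rewrite mulrC.
have bz : bmeas (fun w' => G (dotv (z k w') (v w))).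
  apply: bG; apply: bmeas_dotv; last exact: bmx_cst.
  by apply: (@bmx_block _ _ [set k]); apply: bmx_vector; rewrite inE.
by rewrite ExZ // mulrC ler_wpM2r.
Qed.

Hypothesis ziso : forall k a b, Ex P (fun w => z k w a 0 * z k w b 0) = (a == b)%:R.

Lemma isotropic_Ex (J : {set 'I_n}) k a b (H : T -> R) : k \notin J ->
  @bmeas _ (block z J) _ H ->
  Ex P (fun w => z k w a 0 * z k w b 0 * H w) = (a == b)%:R * Ex P H.
Proof.
move=> kJ bH.
pose F (p : block z [set k] * block z J) := z k p.1 a 0 * z k p.1 b 0 * H p.2.
have bz : @bmeas _ (block z [set k]) R (fun w => z k w a 0 * z k w b 0).
  by apply: bmeasM; apply: bmx_vector; rewrite inE.
have bF : bmeas F.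
  by apply: bmeasM; [exact: (@bmeas_fst _ J _ bz)|exact: bmeas_snd].
have dJ l : l \in [set k]%SET -> (l \in J) = false by move=> /finset.set1P ->; exact: negbTE.
have [bE E] := block_Ex zm zi dJ bF.
rewrite -[LHS]/(Ex P (fun w => F (w, w))) E -ExZ; last exact: (bmeas_block zm bH).
congr (Ex P _); apply/funext => w; rewrite /F /=.
under [X in Ex P X]funext do rewrite mulrC.
by rewrite ExZ ?ziso 1?mulrC //; exact: (bmeas_block zm bz).
Qed.

Lemma isotropic_qform (J : {set 'I_n}) k m (A : T -> 'M[R]_(m, d)) (N : T -> 'M[R]_m) :
  k \notin J -> @bmx _ (block z J) _ _ _ A -> @bmx _ (block z J) _ _ _ N ->
  Ex P (fun w => qform (N w) (A w *m z k w)^T) =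
  Ex P (fun w => \tr (A w *m (A w)^T *m N w)).
Proof.
move=> kJ bA bN; pose W w := (A w)^T *m N w *m A w.
have bW : @bmx _ (block z J) _ _ _ W by apply: bmx_mul => //; apply: bmx_mul => //; exact: bmx_tr.
have bzz a b : bmeas (fun w => z k w a 0 * z k w b 0 * W w a b).
  apply: bmeasM; last exact: (bmeas_block zm (bW a b)).
  by apply: bmeasM; apply: (@bmx_block _ _ [set k]); apply: bmx_vector; rewrite inE.
have -> : (fun w => qform (N w) (A w *m z k w)^T) =
    (fun w => \sum_a \sum_b z k w a 0 * z k w b 0 * W w a b).
  apply/funext => w; rewrite /qform trmxK trmx_mul.
  rewrite (_ : _ *m _ = (z k w)^T *m W w *m z k w); last by rewrite /W !mulmxA.
  rewrite mxE exchange_big /=; apply: eq_bigr => b _; rewrite mxE mulr_suml.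
  by apply: eq_bigr => a _; rewrite mxE mulrAC.
rewrite Ex_sum; last by move=> a _; apply: bmeas_sum => b _.
transitivity (\sum_a Ex P (fun w => W w a a)).
  apply: eq_bigr => a _; rewrite Ex_sum // (bigD1 a) //= big1 => [|b ba].
    by rewrite addr0 (isotropic_Ex _ _ kJ (bW a a)) eqxx mul1r.
  by rewrite (isotropic_Ex _ _ kJ (bW a b)) eq_sym (negbTE ba) mul0r.
rewrite -Ex_sum; last by move=> a _; exact: (bmeas_block zm (bW a a)).
congr (Ex P _); apply/funext => w; rewrite -[LHS]/(\tr (W w)) /W.
by rewrite mxtrace_mulC mulmxA.
Qed.

(** * Moments of the off-diagonal Gram form *)

Section Rosenthal.
Variables (S J : {set 'I_n}) (m : nat) (A : T -> 'M[R]_(m, d)).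
Hypothesis SJ : forall k, k \in S -> k \notin J.
Hypothesis bA : @bmx _ (block z J) _ _ _ A.

Let y k w : 'rV[R]_m := (A w *m z k w)^T.

(* E(y_k N y_k^T) = E tr(N A A^T) when N does not depend on z_k; [rank1_pow_le]
   removes the dependence of the power of the sum on z_k. *)
Lemma trace_rosenthal (delta : R) r : 0 < delta ->
  Ex P (fun w => \tr ((\sum_(k in S) (y k w)^T *m y k w) ^+ r.+1)) <=
  (2 * (1 + delta) ^+ r * n%:R) ^+ r.+1 * Ex P (fun w => \tr ((A w *m (A w)^T) ^+ r.+1)) +
  2 * (1 + delta^-1) ^+ r * \sum_(k in S) Ex P (fun w => qform 1%:M (y k w) ^+ r.+1).
Proof.
move=> delta0; set D1 := (1 + delta) ^+ r; set D2 := (1 + delta^-1) ^+ r.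
have D1_gt0 : 0 < D1 by rewrite exprn_gt0 // addr_gt0.
pose Y w := \sum_(k in S) (y k w)^T *m y k w.
pose Y' j w := \sum_(k in S | k != j) (y k w)^T *m y k w.
pose M w := A w *m (A w)^T.
have psdY' j w : psd (Y' j w) by apply: psd_sum => k _; exact: psd_gram.
have psdM w : psd (M w) by have := psd_gram (A w)^T; rewrite trmxK.
have [S0|[j0 j0S]] := set_0Vmem S.
  rewrite S0; under [X in Ex P X <= _]funext do rewrite big_set0 expr0n mxtrace0.
  rewrite big_set0 mulr0 addr0 Ex_cst mulr_ge0 ?exprn_ge0 ?mulr_ge0 ?(ltW D1_gt0) //.
  by apply: Ex_ge0 => w; exact: (trace_pow_ge0 _ (psdM w)).
have n_gt0 : (0 < n)%N by rewrite (leq_ltn_trans _ (ltn_ord j0)).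
have YE j w : j \in S -> Y w = Y' j w + (y j w)^T *m y j w.
  move=> jS; rewrite /Y /Y' (bigD1 j) //= addrC; congr (_ + _).
have bAT : bmx A by exact: bmx_block bA.
have by_ k : bmx (y k).
  apply: bmx_tr; apply: bmx_mul => //.
  by apply: (@bmx_block _ _ [set k]); apply: bmx_vector; rewrite inE.
have bY : bmx Y by apply: bmx_sum => k _; apply: bmx_mul => //; exact: bmx_tr.
(* All rows that enter except z_j: those that determine [A] and the others in [S]. *)
pose Jj j := J :|: (S :\ j).
have bAJ j : @bmx _ (block z (Jj j)) _ _ _ A.
  by move=> a b; apply: bmeas_block_subset (bA a b); exact: finset.subsetUl.
have bY'J j : @bmx _ (block z (Jj j)) _ _ _ (Y' j).
  apply: bmx_sum => k /andP[kS kj].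
  have byJ : @bmx _ (block z (Jj j)) _ _ _ (y k).
    apply: bmx_tr; apply: bmx_mul.
      exact: bAJ.
    by apply: bmx_vector; rewrite !inE kj kS orbT.
  by apply: bmx_mul => //; exact: bmx_tr.
have bY' j : bmx (Y' j) by exact: bmx_block (bY'J j).
have bM : bmx M by apply: bmx_mul => //; exact: bmx_tr.
(* Chosen so that n D1 / s = 1/2: half of the trace moment can then be absorbed at the end. *)
set s := 2 * D1 * n%:R.
have s0 : 0 < s by rewrite !mulr_gt0 // ltr0n.
set X := Ex P _; set EM := Ex P (fun w => \tr (M w ^+ r.+1)).
(* For one row: [rank1_pow_le] replaces [Y] by [Y'], isotropy averages z_j out of the main term,
   [trace_young] separates [M] from [Y'], and [trace_rank1_le] returns to [Y]. *)
have step j : j \in S -> Ex P (fun w => qform (Y w ^+ r) (y j w)) <=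
    D1 * (s ^+ r * EM + s^-1 * X) + D2 * Ex P (fun w => qform 1%:M (y j w) ^+ r.+1).
  move=> jS.
  apply: le_trans (_ : Ex P (fun w => D1 * qform (Y' j w ^+ r) (y j w) +
      D2 * qform 1%:M (y j w) ^+ r.+1) <= _).
    apply: Ex_le => [||w].
    - by apply: bmeas_qform => //; exact: bmx_pow.
    - apply: bmeasD; apply: bmeasZ; first by apply: bmeas_qform => //; exact: bmx_pow.
      by apply: bmeasX; apply: bmeas_qform => //; exact: bmx_cst.
    by rewrite (YE j) //; exact: rank1_pow_le.
  rewrite ExD; first 1 last.
  - by apply: bmeasZ; apply: bmeas_qform => //; exact: bmx_pow.
  - by apply: bmeasZ; apply: bmeasX; apply: bmeas_qform => //; exact: bmx_cst.
  rewrite !ExZ; first 1 last.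
  - by apply: bmeasX; apply: bmeas_qform => //; exact: bmx_cst.
  - by apply: bmeas_qform => //; exact: bmx_pow.
  rewrite lerD2r ler_wpM2l ?(ltW D1_gt0) //.
  rewrite (@isotropic_qform (Jj j)); first 1 last.
  - by rewrite !inE eqxx orbF; exact: SJ.
  - exact: bAJ.
  - exact: bmx_pow.
  rewrite /EM /X -!ExZ; first 1 last.
  - by apply: bmeas_trace; exact: bmx_pow.
  - by apply: bmeas_trace; exact: bmx_pow.
  rewrite -ExD; first 1 last.
  - by apply: bmeasZ; apply: bmeas_trace; exact: bmx_pow.
  - by apply: bmeasZ; apply: bmeas_trace; exact: bmx_pow.
  apply: Ex_le => [||w].
  - by apply: bmeas_trace; apply: bmx_mul => //; exact: bmx_pow.
  - by apply: bmeasD; apply: bmeasZ; apply: bmeas_trace; exact: bmx_pow.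
  apply: le_trans (trace_young r (psdM w) (psdY' j w) s0) _.
  rewrite lerD2l ler_wpM2l ?invr_ge0 ?(ltW s0) //.
  by rewrite -/(Y w) (YE j) //; exact: trace_rank1_le.
have XE : X = \sum_(j in S) Ex P (fun w => qform (Y w ^+ r) (y j w)).
  rewrite -Ex_sum; last by move=> j _; apply: bmeas_qform => //; exact: bmx_pow.
  congr (Ex P _); apply/funext => w; rewrite exprS -[_ * _]/(Y w *m Y w ^+ r).
  rewrite mulmx_suml raddf_sum /=; apply: eq_bigr => j _.
  by rewrite -mulmxA mxtrace_mulC /mxtrace big_ord1.
have X0 : 0 <= X.
  by apply: Ex_ge0 => w; apply: trace_pow_ge0; apply: psd_sum => k _; exact: psd_gram.
have EM0 : 0 <= EM by apply: Ex_ge0 => w; exact: trace_pow_ge0.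
have := ler_sum (index_enum 'I_n) step.
rewrite -XE big_split /= sumr_const -mulr_sumr.
set Sg := \sum_(i in S) _; move=> h.
have Sn : #|S|%:R <= n%:R :> R by rewrite ler_nat -[X in (_ <= X)%N]card_ord max_card.
have h2 : X <= n%:R * (D1 * (s ^+ r * EM + s^-1 * X)) + D2 * Sg.
  apply: (le_trans h); rewrite lerD2r -[_ *+ #|S|]mulr_natl ler_wpM2r //.
  by rewrite mulr_ge0 ?(ltW D1_gt0) // addr_ge0 // mulr_ge0 ?exprn_ge0 ?invr_ge0 ?(ltW s0).
have nD : n%:R * (D1 * (s ^+ r * EM + s^-1 * X)) = s ^+ r.+1 * EM / 2 + X / 2.
  rewrite exprS /s; field; rewrite pnatr_eq0 -lt0n n_gt0 gt_eqF //.
(* [X] is the mean of a bounded function, so X/2 moves to the left; this doubles the remaining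
   terms. *)
rewrite nD in h2; lra.
Qed.

End Rosenthal.
End Vectors.

(** * Decoupling and trace moments of the cross Gram matrix *)

Section Decoupling.
Variable R : realType.

(** Such a set is [j |: A] with [A] free among the n - 2 other indices. *)
Lemma card_separating_sets n (j k : 'I_n) : j != k ->
  (4 * #|[set T : {set 'I_n} | (j \in T) && (k \notin T)]%SET|)%N = (2 ^ n)%N.
Proof.
move=> jk; pose U := [set: 'I_n]%SET :\ k :\ j.
have -> : [set T : {set 'I_n} | (j \in T) && (k \notin T)]%SET = [set j |: A | A in powerset U]%SET.
  apply/setP => T; rewrite inE; apply/idP/imsetP => [/andP[jT kT]|[A]].
    exists (T :\ j); last by rewrite finset.setD1K.
    rewrite powersetE; apply/fintype.subsetP => l; rewrite !inE => /andP[lj lT].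
    by rewrite lj andbT /=; apply: contraNneq kT => <-.
  rewrite powersetE => /fintype.subsetP AU ->; rewrite !inE eqxx /= negb_or eq_sym jk /=.
  by apply/negP => /AU; rewrite !inE eqxx /= andbF.
rewrite card_in_imset => [|A B]; last first.
  rewrite !powersetE => /fintype.subsetP AU /fintype.subsetP BU E.
  have jA : j \notin A by apply/negP => /AU; rewrite !inE eqxx.
  have jB : j \notin B by apply/negP => /BU; rewrite !inE eqxx.
  by rewrite -(finset.setU1K jA) E finset.setU1K.
rewrite card_powerset /U.
have E1 := cardsD1 j ([set: 'I_n]%SET :\ k); have E2 := cardsD1 k [set: 'I_n]%SET.
rewrite !inE jk /= in E1; rewrite inE cardsT card_ord E1 in E2.
by rewrite [in RHS]E2 !expnS mulnA.
Qed.

(** Exact decoupling: a quarter of all subsets contain j and miss k. The average over subsets takes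
    the place of a random selection of rows. *)
Lemma decoupling_sum n (f : 'I_n -> 'I_n -> R) :
  2 ^+ n * (\sum_j \sum_(k | k != j) f j k) =
  4 * \sum_(T : {set 'I_n}) \sum_(j in T) \sum_(k in ~: T) f j k.
Proof.
have E (T : {set 'I_n}) : \sum_(j in T) \sum_(k in ~: T) f j k =
    \sum_j \sum_k if (j \in T) && (k \notin T) then f j k else 0.
  rewrite big_mkcond /=; apply: eq_bigr => j _; case: (j \in T) => /=.
    by rewrite big_mkcond /=; apply: eq_bigr => k _; rewrite inE.
  by rewrite big1.
under [X in _ = 4 * X]eq_bigr do rewrite E.
rewrite exchange_big /= !mulr_sumr; apply: eq_bigr => j _.
rewrite exchange_big /= !mulr_sumr [LHS]big_mkcond /=; apply: eq_bigr => k _.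
rewrite -big_mkcond /= sumr_const.
case: eqVneq => [->|kj].
  by rewrite (_ : #|_| = 0%N) ?mulr0n ?mulr0 //; apply: eq_card0 => T;
    apply/negP; rewrite unfold_in => /andP[jT /negP].
rewrite /= -[f j k *+ _]mulr_natl mulrA; congr (_ * _).
rewrite -natrX -natrM; congr (_%:R); rewrite -(@card_separating_sets _ j k) 1?eq_sym //.
by congr (_ * _)%N; apply: eq_card => T; rewrite inE.
Qed.

End Decoupling.

Section Numerics.
Variable R : realType.

Definition log_ratio (p : nat) : R := p%:R / ln (p%:R + 1).

Lemma exprD_ge (a b : R) p : 0 <= a -> 0 <= b -> (0 < p)%N ->
  a ^+ p + b ^+ p <= (a + b) ^+ p.
Proof.
move=> a0 b0; case: p => // p _; elim: p => [|p IH]; first by rewrite !expr1.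
rewrite exprS [b ^+ _]exprS [_ ^+ p.+2]exprS.
apply: le_trans (_ : (a + b) * (a ^+ p.+1 + b ^+ p.+1) <= _).
  rewrite mulrDl !mulrDr.
  have := mulr_ge0 a0 (exprn_ge0 p.+1 b0); have := mulr_ge0 b0 (exprn_ge0 p.+1 a0).
  lra.
by rewrite ler_wpM2l // addr_ge0.
Qed.

Lemma expR1_le4 : expR 1 <= 4 :> R.
Proof.
have h : 1 / 2 <= expR (- (1 / 2)) :> R by apply: le_trans (expR_ge1Dx _); lra.
have e4 : expR (- (1 / 2)) ^+ 2 * expR 1 = 1 :> R.
  by rewrite -expRM_natl -expRD (_ : _ + _ = 0) ?expR0 //; field.
have h4 : (1 / 2) ^+ 2 <= expR (- (1 / 2)) ^+ 2 :> R.
  by rewrite lerXn2r ?nnegrE ?expR_ge0 //; lra.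
have := ler_wpM2r (ltW (expR_gt0 (1 : R))) h4; rewrite e4; lra.
Qed.

Lemma ln_succ_gt0 p : (0 < p)%N -> 0 < ln (p%:R + 1) :> R.
Proof. by move=> p0; rewrite ln_gt0 // ltrDr ltr0n. Qed.

Lemma ln_succ_le p : ln (p%:R + 1) <= p%:R :> R.
Proof. by rewrite addrC; apply: le_ln1Dx; rewrite (@lt_le_trans _ _ 0) ?ltrN10. Qed.

Lemma log_ratio_ge1 p : (0 < p)%N -> 1 <= log_ratio p.
Proof. by move=> p0; rewrite ler_pdivlMr ?ln_succ_gt0 // mul1r ln_succ_le. Qed.

Lemma pow1D_le_expR (x : R) k : 0 <= x -> (1 + x) ^+ k <= expR (x * k%:R).
Proof.
move=> x0; rewrite expRM_natr lerXn2r ?nnegrE ?expR_ge0 ?addr_ge0 //.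
exact: expR_ge1Dx.
Qed.

(* The choice delta = ln(p+1)/(2p) produces the factor p/ln(p+1). *)
Lemma young_weight1 p r : p = r.+1 -> (1 + ln (p%:R + 1) / (2 * p%:R)) ^+ r <= 4 * log_ratio p.
Proof.
move=> pE; have p0 : (0 < p)%N by rewrite pE.
have pR : 0 < p%:R :> R by rewrite ltr0n.
have l0 := ln_succ_gt0 p0.
have d0 : 0 <= ln (p%:R + 1) / (2 * p%:R) :> R by rewrite divr_ge0 ?mulr_ge0 ?(ltW l0).
apply: le_trans (pow1D_le_expR _ d0) _.
apply: le_trans (_ : expR (ln (p%:R + 1) / 2) <= _).
  rewrite ler_expR -mulrA ler_wpM2l ?(ltW l0) // invfM -mulrA ler_piMr // ler_pdivrMl // mulr1.
  by rewrite ler_nat pE.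
set s := expR _.
have s0 : 0 < s by exact: expR_gt0.
have ss : s ^+ 2 = p%:R + 1.
  rewrite -expRM_natr (_ : _ * 2 = ln (p%:R + 1)); last by field.
  by rewrite lnK // posrE addr_gt0.
have p1 : 1 <= p%:R :> R by rewrite ler1n.
have ls : ln (p%:R + 1) <= 2 * s.
  have s1 : -1 < s - 1 by rewrite ltrBrDl subrr.
  by rewrite -ss lnXn // mulr2n; have := le_ln1Dx s1; rewrite addrC subrK; lra.
rewrite /log_ratio mulrA ler_pdivlMr //.
apply: le_trans (_ : s * (2 * s) <= _); first by rewrite ler_wpM2l // ltW.
by rewrite mulrCA -expr2 ss; lra.
Qed.

(** The companion weight for the same delta: 1 + 1/delta = 1 + 2 p/ln(p+1), which is at most three
    times [log_ratio R p]. *)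
Lemma young_weight2 p r : p = r.+1 ->
  (1 + (ln (p%:R + 1) / (2 * p%:R))^-1) ^+ r <= (3 * log_ratio p) ^+ p.
Proof.
move=> pE; have p0 : (0 < p)%N by rewrite pE.
have l1 := log_ratio_ge1 p0.
rewrite invf_div -[2 * _ / _]mulrA -/(log_ratio p).
apply: le_trans (_ : (3 * log_ratio p) ^+ r <= _).
  by rewrite lerXn2r ?nnegrE //; lra.
by apply: ler_weXn2l; [lra|rewrite pE].
Qed.

(** The choice delta = 1/p serves the inner moments: the main weight stays bounded and the other one
    costs a factor of order p per power, which [moment_choice] later trades for ln n. *)
Lemma young_weight3 p r : p = r.+1 -> (1 + p%:R^-1) ^+ r <= 4 :> R.
Proof.
move=> pE; have p0 : 0 < p%:R :> R by rewrite pE ltr0n.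
apply: le_trans (pow1D_le_expR _ _) _; first by rewrite invr_ge0 ltW.
apply: le_trans expR1_le4; rewrite ler_expR ler_pdivrMl // mulr1 ler_nat pE //.
Qed.

Lemma young_weight4 p r : p = r.+1 -> (1 + p%:R^-1^-1) ^+ r <= (2 * p%:R) ^+ p :> R.
Proof.
move=> pE; have p1 : 1 <= p%:R :> R by rewrite pE ler1n.
rewrite invrK; apply: le_trans (_ : (2 * p%:R) ^+ r <= _).
  by rewrite lerXn2r ?nnegrE //; lra.
by apply: ler_weXn2l; [lra|rewrite pE].
Qed.

End Numerics.

Section MatrixMoment.
Context {dsp : measure_display} {T : measurableType dsp} {R : realType} {n d : nat}.
Variables (P : probability T R) (z : 'I_n -> T -> 'cV[R]_d).
Hypothesis zm : forall k B, borel_cV B -> measurable (z k @^-1` B).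
Hypothesis zi : independent_vectors P z.
Hypothesis zn : forall k w, dotv (z k w) (z k w) = d%:R.
Hypothesis ziso : forall k a b, Ex P (fun w => z k w a 0 * z k w b 0) = (a == b)%:R.
Variables (p r : nat) (tau Mx : R).
Hypothesis pE : p = r.+1.
Hypothesis nd : (n <= d)%N.
Hypothesis tau0 : 0 <= tau.
Hypothesis zmom : forall k u,
  Ex P (fun w => dotv (z k w) u ^+ (2 * p)) <= tau ^+ (2 * p) * dotv u u ^+ p.
(** [Mx] stands for the p-th power of the maximum in B(n, p). *)
Hypothesis Mx1 : n%:R ^+ p <= Mx.
Hypothesis Mx2 : n%:R * tau ^+ (2 * p) <= Mx.

(** Rows outside [J] are set to 0 instead of being removed, so that the size does not depend on
    [J]. *)
Definition rows_in (J : {set 'I_n}) w : 'M[R]_(n, d) :=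
  \matrix_(k, a) (z k w a 0 *+ (k \in J)).

Definition cross_row J k w : 'rV[R]_n := (rows_in J w *m z k w)^T.

(** The form of this matrix at v is the sum, over k in [S], of the squared inner products of z_k
    with the combination of the rows outside [S] that has the coefficients v_l. *)
Definition cross_gram (S : {set 'I_n}) w : 'M[R]_n :=
  \sum_(k in S) (cross_row (~: S) k w)^T *m cross_row (~: S) k w.

Let bz k : bmx (z k).
Proof. by apply: (bmx_block zm (J := [set k]%SET)); apply: bmx_vector; rewrite ?inE. Qed.

Lemma dotv_mx (u v : 'cV[R]_d) : (u^T *m v) 0 0 = dotv u v.
Proof. by rewrite mxE; apply: eq_bigr => j _; rewrite mxE. Qed.

Lemma dotvC (u v : 'cV[R]_d) : dotv u v = dotv v u.
Proof. by apply: eq_bigr => j _; rewrite mulrC. Qed.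

Lemma trace_pow11 (M : 'M[R]_1) k : \tr (M ^+ k) = M 0 0 ^+ k.
Proof.
rewrite /mxtrace big_ord1; elim: k => [|k IH]; first by rewrite !expr0 mxE eqxx.
by rewrite !exprS -IH -[M * _]/(M *m _) mxE big_ord1.
Qed.

Let pow_split (x y : R) : 0 <= x -> 0 <= y ->
  (2 * 4 * x) ^+ p + 2 * (2 * p%:R) ^+ p * y ^+ p <= (8 * x + 4 * p%:R * y) ^+ p.
Proof.
move=> x0 y0.
have p0 : (0 < p)%N by rewrite pE.
apply: le_trans (exprD_ge _ _ p0); [|by rewrite mulr_ge0|by rewrite !mulr_ge0].
apply: lerD; first by rewrite -natrM.
rewrite (_ : 4 * p%:R * y = 2 * (2 * p%:R * y)); last by ring.
rewrite [X in _ <= X]exprMn [(2 * p%:R * y) ^+ p]exprMn mulrA.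
rewrite ler_wpM2r ?exprn_ge0 // ler_wpM2r ?exprn_ge0 ?mulr_ge0 //.
by rewrite -{1}(expr1 2) ler_weXn2l // ler1n.
Qed.

Lemma dotv_moment j k : j != k ->
  Ex P (fun w => dotv (z k w) (z j w) ^+ (2 * p)) <= tau ^+ (2 * p) * d%:R ^+ p.
Proof.
move=> jk.
have kj : k \notin [set j]%SET by rewrite finset.in_set1 eq_sym.
have bG dsp' (S : measurableType dsp') (f : S -> R) : bmeas f ->
  bmeas ((fun x => x ^+ (2 * p)) \o f) by move=> bf; exact: bmeasX.
have bzj : @bmx _ (block z [set j]%SET) _ _ _ (z j).
  by apply: bmx_vector => //; rewrite finset.in_set1.
have := @peel_le _ _ _ _ _ P z zm zi zn [set j]%SET k (fun x => x ^+ (2 * p)) (z j)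
  (fun=> tau ^+ (2 * p) * d%:R ^+ p) (fun=> 1) kj bG bzj (bmeas_cst _) (fun=> ler01) (bmeas_cst _).
move=> h; have := h (fun w => _); rewrite Ex_cst mulr1.
under [X in Ex P X]funext do rewrite mulr1.
by apply => w; rewrite -(zn j w).
Qed.

Let D1_le : (1 + p%:R^-1) ^+ r <= 4 :> R := young_weight3 R pE.
Let D2_le : (1 + p%:R^-1^-1) ^+ r <= (2 * p%:R) ^+ p :> R := young_weight4 R pE.

Let pinv0 : 0 < p%:R^-1 :> R.
Proof. by rewrite invr_gt0 ltr0n pE. Qed.

(** The one-dimensional case of [trace_rosenthal]: [A] is the row z_j^T, given which the inner
    products with the rows in [S] are independent. *)
Lemma sum_sqr_moment j (S : {set 'I_n}) : j \notin S ->
  Ex P (fun w => (\sum_(k in S) dotv (z j w) (z k w) ^+ 2) ^+ p) <=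
  (12 * p%:R) ^+ p * (d%:R ^+ p * Mx).
Proof.
move=> jS.
pose A w := (z j w)^T.
have SJ k : k \in S -> k \notin [set j]%SET.
  by move=> kS; rewrite finset.in_set1; apply: contraNneq jS => <-.
have bA : @bmx _ (block z [set j]%SET) _ _ _ A.
  by apply: bmx_tr; apply: bmx_vector => //; rewrite finset.in_set1.
have := trace_rosenthal zm zi zn ziso SJ bA r pinv0.
rewrite -pE.
have E1 w : \tr ((\sum_(k in S) ((A w *m z k w)^T)^T *m (A w *m z k w)^T) ^+ p) =
    (\sum_(k in S) dotv (z j w) (z k w) ^+ 2) ^+ p.
  rewrite trace_pow11 summxE; congr (_ ^+ p); apply: eq_bigr => k _.
  by rewrite mxE big_ord1 !mxE expr2; congr (_ * _); apply: eq_bigr => a _; rewrite mxE.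
have E2 w : \tr ((A w *m (A w)^T) ^+ p) = d%:R ^+ p.
  by rewrite trace_pow11 /A trmxK dotv_mx zn.
have E3 k w : qform 1%:M (A w *m z k w)^T ^+ p = dotv (z k w) (z j w) ^+ (2 * p).
  rewrite qform1E big_ord1 -exprM [_^T 0 0]mxE dotv_mx dotvC; done.
under [X in Ex P X <= _]funext do rewrite E1.
under [X in _ * Ex P X + _]funext do rewrite E2.
under eq_bigr do under [X in Ex P X]funext do rewrite E3.
rewrite Ex_cst => h; apply: (le_trans h).
have p1 : 1 <= p%:R :> R by rewrite ler1n pE.
have dp0 : 0 <= d%:R ^+ p :> R by rewrite exprn_ge0.
have Mx0 : 0 <= Mx by apply: le_trans Mx1; rewrite exprn_ge0.
apply: le_trans (_ : (2 * 4 * 1) ^+ p * (d%:R ^+ p * Mx) +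
    2 * (2 * p%:R) ^+ p * 1 ^+ p * (d%:R ^+ p * Mx) <= _); last first.
  rewrite -mulrDl ler_wpM2r ?mulr_ge0 //.
  apply: le_trans (pow_split ler01 ler01) _.
  by rewrite lerXn2r ?nnegrE //; lra.
apply: lerD.
  apply: le_trans (_ : (2 * 4 * n%:R) ^+ p * d%:R ^+ p <= _).
    rewrite ler_wpM2r // lerXn2r ?nnegrE ?mulr_ge0 ?exprn_ge0 ?addr_ge0 ?(ltW pinv0) //.
    by rewrite ler_wpM2r // ler_wpM2l.
  rewrite mulr1 exprMn -mulrA ler_wpM2l ?exprn_ge0 // mulrC ler_wpM2l //.
rewrite expr1n mulr1 -!mulrA ler_wpM2l // ler_pM ?exprn_ge0 ?addr_ge0 ?invr_ge0 ?(ltW pinv0) //.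
  by apply: sumr_ge0 => k _; apply: Ex_ge0 => w; rewrite exprM exprn_ge0 ?sqr_ge0.
apply: le_trans (_ : \sum_(k in S) tau ^+ (2 * p) * d%:R ^+ p <= _).
  by apply: ler_sum => k /SJ; rewrite finset.in_set1 eq_sym; exact: dotv_moment.
rewrite sumr_const -[_ *+ #|S|]mulr_natl mulrA [X in X <= _]mulrC ler_wpM2l //.
apply: le_trans Mx2; rewrite ler_wpM2r ?exprn_ge0 // ler_nat.
by rewrite -[X in (_ <= X)%N]card_ord max_card.
Qed.

(** [trace_rosenthal] with the identity for [A] bounds the d x d matrix B^T B, whose powers have the
    same traces as those of the n x n matrix B B^T. The assumption n <= d turns n^p d into n d^p. *)
Lemma trace_gram_moment (J : {set 'I_n}) :
  Ex P (fun w => \tr ((rows_in J w *m (rows_in J w)^T) ^+ p)) <=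
  (12 * p%:R) ^+ p * (n%:R * d%:R ^+ p).
Proof.
pose A (w : T) : 'M[R]_d := 1%:M.
have bA : @bmx _ (block z finset.set0) _ _ _ A by exact: bmx_cst.
have SJ k : k \in J -> k \notin (finset.set0 : {set 'I_n}) by rewrite finset.in_set0.
have := trace_rosenthal zm zi zn ziso SJ bA r pinv0; rewrite -pE.
have E1 w : \tr ((\sum_(k in J) ((A w *m z k w)^T)^T *m (A w *m z k w)^T) ^+ p) =
    \tr ((rows_in J w *m (rows_in J w)^T) ^+ p).
  set B := rows_in J w.
  have -> : \sum_(k in J) ((A w *m z k w)^T)^T *m (A w *m z k w)^T = B^T *m B.
    apply/matrixP => a b; rewrite summxE mxE big_mkcond /=; apply: eq_bigr => k _.
    rewrite trmxK /A !mul1mx !mxE big_ord1 !mxE.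
    by case: (k \in J); rewrite ?mulr1n ?mulr0n ?mul0r.
  have Epow k : (B^T *m B) ^+ k.+1 = B^T *m ((B *m B^T) ^+ k *m B).
    elim: k => [|k IH]; first by rewrite expr1 expr0 mul1mx.
    by rewrite exprS IH [(B *m B^T) ^+ k.+1]exprS -!mulmxE !mulmxA.
  by rewrite pE Epow mxtrace_mulC -mulmxA -[_ *m (_ *m _)]/(_ * _) -exprSr.
have E2 w : \tr ((A w *m (A w)^T) ^+ p) = d%:R.
  by rewrite /A trmx1 mulmx1 expr1n mxtrace1.
have E3 k w : qform 1%:M (A w *m z k w)^T ^+ p = d%:R ^+ p.
  rewrite /A mul1mx -(zn k w) qform1E; congr (_ ^+ p).
  by apply: eq_bigr => a _; rewrite mxE expr2.
under [X in Ex P X <= _]funext do rewrite E1.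
under [X in _ * Ex P X + _]funext do rewrite E2.
under eq_bigr do under [X in Ex P X]funext do rewrite E3.
under eq_bigr do rewrite Ex_cst.
rewrite Ex_cst sumr_const => h; apply: (le_trans h).
have p1 : 1 <= p%:R :> R by rewrite ler1n pE.
have dp0 : 0 <= d%:R ^+ p :> R by rewrite exprn_ge0.
apply: le_trans (_ : (2 * 4 * 1) ^+ p * (n%:R * d%:R ^+ p) +
    2 * (2 * p%:R) ^+ p * 1 ^+ p * (n%:R * d%:R ^+ p) <= _); last first.
  rewrite -mulrDl ler_wpM2r ?mulr_ge0 //.
  apply: le_trans (pow_split ler01 ler01) _.
  by rewrite lerXn2r ?nnegrE //; lra.
apply: lerD.
  apply: le_trans (_ : (2 * 4 * n%:R) ^+ p * d%:R <= _).
    rewrite ler_wpM2r // lerXn2r ?nnegrE ?mulr_ge0 ?exprn_ge0 ?addr_ge0 ?(ltW pinv0) //.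
    by rewrite ler_wpM2r // ler_wpM2l.
  rewrite mulr1 exprMn -mulrA ler_wpM2l ?exprn_ge0 // pE exprS [d%:R ^+ _]exprS.
  by rewrite -mulrA ler_wpM2l // mulrC ler_wpM2l // lerXn2r ?nnegrE // ler_nat.
rewrite expr1n mulr1 -!mulrA ler_wpM2l // ler_pM ?exprn_ge0 ?addr_ge0 ?invr_ge0 ?(ltW pinv0) //.
rewrite -[_ *+ #|J|]mulr_natl ler_wpM2r // ler_nat.
by rewrite -[X in (_ <= X)%N]card_ord max_card.
Qed.

(** Given the rows outside [S], the vectors in [cross_gram] are images of independent rows under the
    fixed matrix [rows_in J]. The two terms of [trace_rosenthal] are then controlled by
    [trace_gram_moment] and [sum_sqr_moment]. *)
Lemma cross_gram_moment (S : {set 'I_n}) :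
  Ex P (fun w => \tr (cross_gram S w ^+ p)) <=
  (168 * log_ratio R p * p%:R) ^+ p * (n%:R * Mx * d%:R ^+ p).
Proof.
set J := ~: S.
have SJ k : k \in S -> k \notin J by rewrite finset.in_setC negbK.
have bA : @bmx _ (block z J) _ _ _ (rows_in J).
  move=> k a; under [X in bmeas X]funext do rewrite mxE.
  case: (boolP (k \in J)) => kJ; last by under [X in bmeas X]funext do rewrite mulr0n; exact: bmeas_cst.
  by under [X in bmeas X]funext do rewrite mulr1n; exact: (bmx_vector zn kJ).
have p0 : (0 < p)%N by rewrite pE.
have p1 : 1 <= p%:R :> R by rewrite ler1n.
have L1 := log_ratio_ge1 R p0; set L := log_ratio R p in L1 *.
have L0 : 0 <= L by rewrite (le_trans ler01).
pose delta : R := ln (p%:R + 1) / (2 * p%:R).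
have delta0 : 0 < delta by rewrite divr_gt0 ?ln_succ_gt0 // mulr_gt0 ?ltr0n.
have := trace_rosenthal zm zi zn ziso SJ bA r delta0; rewrite -pE.
have W1 : (1 + delta) ^+ r <= 4 * L by exact: young_weight1.
have W2 : (1 + delta^-1) ^+ r <= (3 * L) ^+ p by exact: young_weight2.
clearbody delta L.
have Mx0 : 0 <= Mx by apply: le_trans Mx1; rewrite exprn_ge0.
have dp0 : 0 <= d%:R ^+ p :> R by rewrite exprn_ge0.
move=> h; apply: (le_trans h).
have E3 k w : qform 1%:M (rows_in J w *m z k w)^T = \sum_(l in J) dotv (z k w) (z l w) ^+ 2.
  rewrite qform1E [RHS]big_mkcond /=; apply: eq_bigr => l _; rewrite !mxE.
  under eq_bigr do rewrite mxE.
  case: (l \in J); last by rewrite big1 ?expr0n // => a _; rewrite mulr0n mul0r.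
  by rewrite dotvC.
under eq_bigr do under [X in Ex P X]funext do rewrite E3.
set N := n%:R * Mx * d%:R ^+ p.
have N0 : 0 <= N by rewrite !mulr_ge0.
(* 96 = 2 * 4 * 12 and 72 = 2 * 3 * 12 combine the weights 4 L and 3 L with the factor 12 p of the
   inner moments; 168 is their sum. *)
apply: le_trans (_ : (96 * L * p%:R) ^+ p * N + (72 * L * p%:R) ^+ p * N <= _); last first.
  have a0 : 0 <= 96 * L * p%:R by rewrite mulr_ge0 // mulr_ge0.
  have b0 : 0 <= 72 * L * p%:R by rewrite mulr_ge0 // mulr_ge0.
  rewrite -mulrDl ler_wpM2r //; apply: le_trans (exprD_ge a0 b0 p0) _.
  by rewrite le_eqVlt; apply/orP; left; apply/eqP; congr (_ ^+ p); ring.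
apply: lerD.
  apply: le_trans (_ : (2 * (4 * L) * n%:R) ^+ p * ((12 * p%:R) ^+ p * (n%:R * d%:R ^+ p)) <= _).
    apply: ler_pM; rewrite ?exprn_ge0 ?mulr_ge0 ?exprn_ge0 ?addr_ge0 ?(ltW delta0) //.
    - apply: Ex_ge0 => w; apply: trace_pow_ge0; have := psd_gram (rows_in J w)^T.
      by rewrite trmxK.
    - rewrite lerXn2r ?nnegrE ?mulr_ge0 ?exprn_ge0 ?addr_ge0 ?(ltW delta0) //; last first.
        by rewrite ler_wpM2r // ler_wpM2l.
    - exact: trace_gram_moment.
  rewrite /N (_ : _ * (_ * (_ * _)) = (96 * L * p%:R) ^+ p * (n%:R * n%:R ^+ p * d%:R ^+ p)).
    rewrite ler_wpM2l ?exprn_ge0 ?mulr_ge0 //.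
    by rewrite ler_wpM2r // ler_wpM2l.
  rewrite mulrA -exprMn (_ : 2 * (4 * L) * n%:R * (12 * p%:R) = 96 * L * p%:R * n%:R); last by ring.
  by rewrite [(_ * n%:R) ^+ p]exprMn; ring.
apply: le_trans (_ : 2 * (3 * L) ^+ p * (n%:R * ((12 * p%:R) ^+ p * (d%:R ^+ p * Mx))) <= _).
  rewrite -!mulrA ler_wpM2l // ler_pM ?exprn_ge0 ?addr_ge0 ?invr_ge0 ?(ltW delta0) //.
    apply: sumr_ge0 => k _; apply: Ex_ge0 => w; rewrite exprn_ge0 // sumr_ge0 // => l _.
    exact: sqr_ge0.
  apply: le_trans (_ : \sum_(k in S) (12 * p%:R) ^+ p * (d%:R ^+ p * Mx) <= _).
    by apply: ler_sum => k kS; apply: sum_sqr_moment; exact: SJ.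
  rewrite sumr_const -[_ *+ #|S|]mulr_natl ler_wpM2r ?mulr_ge0 ?exprn_ge0 ?mulr_ge0 //.
  by rewrite ler_nat -[X in (_ <= X)%N]card_ord max_card.
have -> : 2 * (3 * L) ^+ p * (n%:R * ((12 * p%:R) ^+ p * (d%:R ^+ p * Mx))) =
    2 * (36 * L * p%:R) ^+ p * N.
  rewrite /N (_ : 36 * L * p%:R = 3 * L * (12 * p%:R)); last by ring.
  by rewrite [(3 * L * _) ^+ p]exprMn; ring.
rewrite ler_wpM2r // (_ : 72 * L * p%:R = 2 * (36 * L * p%:R)); last by ring.
rewrite [X in _ <= X]exprMn ler_wpM2r ?exprn_ge0 ?mulr_ge0 //.
by rewrite -{1}(expr1 2) ler_weXn2l // ler1n.
Qed.

End MatrixMoment.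

(** * From trace moments to the mean deviation of the Gram form *)

Section GramDeviation.
Context {dsp : measure_display} {T : measurableType dsp} {R : realType} {n d : nat}.
Variables (P : probability T R) (z : 'I_n -> T -> 'cV[R]_d).

Definition rows_mx w : 'M[R]_(n, d) := \matrix_(k, a) z k w a 0.

Hypothesis zn : forall k w, dotv (z k w) (z k w) = d%:R.

Lemma qform_rows_mx (v : 'rV[R]_n) w : qform 1%:M (v *m rows_mx w) =
  d%:R * qform 1%:M v +
  \sum_j \sum_(k | k != j) v 0 j * v 0 k * dotv (z j w) (z k w).
Proof.
have -> : qform 1%:M (v *m rows_mx w) =
    \sum_j \sum_k v 0 j * v 0 k * dotv (z j w) (z k w).
  rewrite qform1E.
  transitivity (\sum_a \sum_j \sum_k v 0 j * v 0 k * (z j w a 0 * z k w a 0)).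
    apply: eq_bigr => a _; rewrite mxE expr2 mulr_suml; apply: eq_bigr => j _.
    by rewrite mulr_sumr; apply: eq_bigr => k _; rewrite !mxE; ring.
  rewrite exchange_big /=; apply: eq_bigr => j _; rewrite exchange_big /=.
  by apply: eq_bigr => k _; rewrite -mulr_sumr.
rewrite qform1E mulr_sumr -big_split /=; apply: eq_bigr => j _.
by rewrite (bigD1 j) //= zn expr2 mulrC.
Qed.

Definition cross_form (S : {set 'I_n}) (v : 'rV[R]_n) w :=
  \sum_(j in S) \sum_(k in ~: S) v 0 j * v 0 k * dotv (z j w) (z k w).

(** Cauchy-Schwarz in the index j: the coefficients of v_j, for j in [S], are the numbers whose
    squares add up to the form of [cross_gram]. *)
Lemma cross_form_sqr_le S (v : 'rV[R]_n) w : qform 1%:M v = 1 ->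
  cross_form S v w ^+ 2 <= qform (cross_gram z S w) v.
Proof.
move=> v1; pose c j := (v *m (cross_row z (~: S) j w)^T) 0 0.
have QE : cross_form S v w = \sum_(j in S) v 0 j * c j.
  apply: eq_bigr => j _; rewrite /c mxE mulr_sumr [LHS]big_mkcond /=.
  apply: eq_bigr => k _; rewrite trmxK mxE.
  under eq_bigr do rewrite mxE.
  case: (k \in _); last by rewrite big1 ?mulr0 // => a _; rewrite mulr0n mul0r.
  rewrite mulrA dotvC; congr (_ * _).
have gE : qform (cross_gram z S w) v = \sum_(j in S) c j ^+ 2.
  rewrite /qform /cross_gram mulmx_sumr mulmx_suml summxE; apply: eq_bigr => j _.
  rewrite mulmxA -mulmxA mxE big_ord1 expr2; congr (_ * _).
  rewrite /c [LHS]mxE [RHS]mxE; apply: eq_bigr => i _.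
  by rewrite [v^T i 0]mxE [(cross_row _ _ _ _)^T i 0]mxE mulrC.
set Q := cross_form S v w in QE *.
have h : 2 * Q ^+ 2 <= Q ^+ 2 * \sum_(j in S) v 0 j ^+ 2 + qform (cross_gram z S w) v.
  rewrite gE {1}expr2 {2}QE !mulr_sumr -big_split /=; apply: ler_sum => j _.
  have := sqr_ge0 (Q * v 0 j - c j); rewrite sqrrB exprMn mulr2n; lra.
have : Q ^+ 2 * \sum_(j in S) v 0 j ^+ 2 <= Q ^+ 2 * 1.
  rewrite ler_wpM2l ?sqr_ge0 // -v1 qform1E [leRHS](bigID (mem S)) /= lerDl sumr_ge0 //.
  by move=> j _; exact: sqr_ge0.
lra.
Qed.

(** A way to use a p-th moment without roots: either q <= a, or q/a exceeds 1 and is at most its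
    power 2p. If a^(2p) bounds the mean of [t], the right-hand side has mean at most 2 a. *)
Lemma pow_dominate (a q s t : R) p : 0 < a -> 0 <= q -> q ^+ 2 <= s -> s ^+ p <= t ->
  (0 < p)%N -> q <= a * (1 + t / a ^+ (2 * p)).
Proof.
move=> a0 q0 qs st p0; have s0 : 0 <= s := le_trans (sqr_ge0 q) qs.
have t0 : 0 <= t := le_trans (exprn_ge0 p s0) st.
have t1 : 0 <= t / a ^+ (2 * p) by rewrite divr_ge0 // exprn_ge0 // ltW.
have [qa|aq] := leP q a.
  by apply: (le_trans qa); rewrite ler_peMr ?(ltW a0) // lerDl.
have h : q / a <= t / a ^+ (2 * p).
  apply: le_trans (_ : (q / a) ^+ (2 * p) <= _).
    rewrite -[leLHS]expr1 ler_weXn2l ?muln_gt0 //.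
    by rewrite ler_pdivlMr // mul1r ltW.
  rewrite expr_div_n ler_wpM2r ?invr_ge0 ?exprn_ge0 ?(ltW a0) // exprM.
  by apply: le_trans st; rewrite lerXn2r ?nnegrE ?sqr_ge0.
rewrite mulrDr mulr1 -[leLHS]add0r lerD ?(ltW a0) //.
by rewrite mulrC -ler_pdivrMr.
Qed.

Lemma cross_form_le S (v : 'rV[R]_n) w (a : R) p : 0 < a -> (0 < p)%N ->
  qform 1%:M v = 1 ->
  `|cross_form S v w| <= a * (1 + \tr (cross_gram z S w ^+ p) / a ^+ (2 * p)).
Proof.
move=> a0 p0 v1.
have psdY : psd (cross_gram z S w) by apply: psd_sum => k _; exact: psd_gram.
apply: (@pow_dominate _ _ (qform (cross_gram z S w) v)) => //.
  by rewrite real_normK ?num_real //; exact: cross_form_sqr_le.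
apply: le_trans (qform_pow_le p psdY v1) _.
by apply: qform_le_trace => //; exact: psd_pow.
Qed.

Hypothesis zm : forall k B, borel_cV B -> measurable (z k @^-1` B).
Hypothesis zi : independent_vectors P z.
Hypothesis ziso : forall k a b, Ex P (fun w => z k w a 0 * z k w b 0) = (a == b)%:R.

Lemma bmx_cross_gram S : bmx (cross_gram z S).
Proof.
have bz k : bmx (z k).
  by apply: (bmx_block zm (J := [set k]%SET)); apply: bmx_vector; rewrite ?finset.in_set1.
have br k : bmx (cross_row z (~: S) k).
  apply: bmx_tr; apply: bmx_mul => // i j; under [X in bmeas X]funext do rewrite mxE.
  case: (i \in _).
    by under [X in bmeas X]funext do rewrite mulr1n; exact: bz.
  by under [X in bmeas X]funext do rewrite mulr0n; exact: bmeas_cst.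
by apply: bmx_sum => k _; apply: bmx_mul => //; exact: bmx_tr.
Qed.

(** One random variable has to serve all [v] at once. It is an average over subsets of the trace
    bounds of [cross_form_le], in which v does not occur. *)
Lemma gram_deviation_moment p (tau : R) :
  (0 < p)%N -> (0 < n)%N -> (n <= d)%N -> 0 <= tau ->
  (forall k u,
    Ex P (fun w => dotv (z k w) u ^+ (2 * p)) <= tau ^+ (2 * p) * dotv u u ^+ p) ->
  let b := 168 * log_ratio R p * p%:R * (n%:R `^ p%:R^-1 *
             Num.max n%:R (n%:R `^ p%:R^-1 * tau ^+ 2)) in
  exists g : T -> R, [/\ bmeas g, forall w, 0 <= g w,
    Ex P g <= 8 * Num.sqrt (b / d%:R) &
    forall w (v : 'rV[R]_n),
      `|qform 1%:M (v *m rows_mx w) - d%:R * qform 1%:M v| <= d%:R * g w * qform 1%:M v].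
Proof.
move=> p0 n0 nd tau0 hm; set N := n%:R `^ p%:R^-1; set V := Num.max _ _ => b.
have nR : 0 < n%:R :> R by rewrite ltr0n.
have d0 : (0 < d)%N := leq_trans n0 nd.
have dR : 0 < d%:R :> R by rewrite ltr0n.
have N0 : 0 < N by rewrite powR_gt0.
have NE : N ^+ p = n%:R.
  by rewrite -powR_mulrn ?powR_ge0 // -powRrM mulVf ?pnatr_eq0 -?lt0n // powRr1.
have V0 : 0 < V by rewrite lt_max nR.
have L1 := log_ratio_ge1 R p0.
have b0 : 0 < b.
  have LR0 : 0 < log_ratio R p := lt_le_trans ltr01 L1.
  by apply: mulr_gt0; [apply: mulr_gt0; [apply: mulr_gt0|]|apply: mulr_gt0]; rewrite ?ltr0n.
have Mx1 : n%:R ^+ p <= V ^+ p by rewrite lerXn2r ?nnegrE ?(ltW V0) // le_max lexx.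
have Mx2 : n%:R * tau ^+ (2 * p) <= V ^+ p.
  rewrite -NE exprM -exprMn lerXn2r ?nnegrE ?(ltW V0) ?mulr_ge0 ?(ltW N0) ?sqr_ge0 //.
  by rewrite le_max lexx orbT.
pose a := Num.sqrt (b * d%:R).
have a0 : 0 < a by rewrite sqrtr_gt0 mulr_gt0.
have aE : a ^+ (2 * p) = (b * d%:R) ^+ p.
  by rewrite exprM sqr_sqrtr // mulr_ge0 ?(ltW b0).
have bY S : bmeas (fun w => \tr (cross_gram z S w ^+ p)).
  by apply: bmeas_trace; apply: bmx_pow; exact: bmx_cross_gram.
have EY S : Ex P (fun w => \tr (cross_gram z S w ^+ p)) <= a ^+ (2 * p).
  have pE : p = p.-1.+1 by rewrite prednK.
  apply: le_trans (cross_gram_moment zm zi zn ziso pE nd tau0 hm Mx1 Mx2 S) _.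
  rewrite aE [leRHS]exprMn mulrA ler_wpM2r ?exprn_ge0 // /b [leRHS]exprMn.
  by rewrite [(N * V) ^+ p]exprMn NE.
clearbody b.
pose h S w := a * (1 + \tr (cross_gram z S w ^+ p) / a ^+ (2 * p)).
have bh S : bmeas (h S).
  apply: bmeasZ; apply: bmeasD; first exact: bmeas_cst.
  by under [X in bmeas X]funext do rewrite mulrC; exact: bmeasZ.
have h0 S w : 0 <= h S w.
  rewrite mulr_ge0 ?(ltW a0) // addr_ge0 // divr_ge0 ?exprn_ge0 ?(ltW a0) //.
  by apply: trace_pow_ge0; apply: psd_sum => k _; exact: psd_gram.
have Eh S : Ex P (h S) <= 2 * a.
  have bt : bmeas (fun w => \tr (cross_gram z S w ^+ p) / a ^+ (2 * p)).
    by under [X in bmeas X]funext do rewrite mulrC; exact: bmeasZ.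
  rewrite /h ExZ; last by apply: bmeasD => //; exact: bmeas_cst.
  rewrite ExD //; last exact: bmeas_cst.
  rewrite Ex_cst mulrC ler_wpM2r ?(ltW a0) //.
  under [X in Ex P X]funext do rewrite mulrC.
  rewrite ExZ // -[leRHS]/(1 + 1) lerD2l ler_pdivrMl ?exprn_gt0 // mulr1.
  exact: EY.
(* 4 is the decoupling constant, and the division by d makes the deviation relative. As each summand
   has mean at most 2 a, the factor 8 results. *)
pose c : R := 4 / (2 ^+ n * d%:R).
have c0 : 0 <= c by rewrite divr_ge0 // mulr_ge0 ?exprn_ge0.
exists (fun w => c * \sum_(S : {set 'I_n}) h S w); split.
- by apply: bmeasZ; apply: bmeas_sum => S _; exact: bh.
- by move=> w; rewrite mulr_ge0 // sumr_ge0.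
- rewrite ExZ; last by apply: bmeas_sum => S _; exact: bh.
  rewrite Ex_sum // .
  apply: le_trans (_ : c * \sum_(S : {set 'I_n}) (2 * a) <= _).
    by rewrite ler_wpM2l // ler_sum // => S _; exact: Eh.
  rewrite sumr_const (_ : #|_| = 2 ^ n)%N; last first.
    transitivity #|powerset [set: 'I_n]%SET|; last by rewrite card_powerset cardsT card_ord.
    by apply: eq_card => S; rewrite powersetE finset.subsetT.
  rewrite /c -[_ *+ (2 ^ n)]mulr_natl natrX.
  have -> : 4 / (2 ^+ n * d%:R) * (2 ^+ n * (2 * a)) = 8 * (a / d%:R).
    by field; rewrite expf_neq0 ?pnatr_eq0 //= -?lt0n ?d0.
  rewrite ler_wpM2l // le_eqVlt; apply/orP; left; apply/eqP.
  rewrite /a !sqrtrM ?(ltW b0) // sqrtrV // -mulrA; congr (_ * _).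
  rewrite -[X in _ / X](sqr_sqrtr (ltW dR)) expr2 invfM mulrA divff ?mul1r //.
  by rewrite gt_eqF // sqrtr_gt0.
move=> w v.
rewrite qform_rows_mx addrAC subrr add0r.
have [->|v0] := eqVneq v 0.
  rewrite big1 ?normr0 ?mulr_ge0 ?qform1_ge0 ?sumr_ge0 // => j _.
  by rewrite big1 // => k _; rewrite mxE !mul0r.
have q0 := qform1_gt0 v0.
pose s := Num.sqrt (qform 1%:M v); pose u := s^-1 *: v.
have s0 : 0 < s by rewrite sqrtr_gt0.
have u1 : qform 1%:M u = 1.
  by rewrite qformZ exprVn sqr_sqrtr ?(ltW q0) // mulVf // gt_eqF.
have vu : v = s *: u by rewrite scalerA divff ?gt_eqF // scale1r.
have h2 : 2 ^+ n != 0 :> R by rewrite expf_neq0 ?pnatr_eq0.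
have := decoupling_sum (fun j k => v 0 j * v 0 k * dotv (z j w) (z k w)).
move/(congr1 (fun x => (2 ^+ n)^-1 * x)); rewrite mulKf // => ->.
rewrite -[X in `|_ * (4 * X)|](_ : \sum_(S : {set 'I_n}) s ^+ 2 * cross_form S u w = _); last first.
  apply: eq_bigr => S _; rewrite mulr_sumr; apply: eq_bigr => j _; rewrite mulr_sumr.
  by apply: eq_bigr => k _; rewrite [in RHS]vu ![(s *: u) _ _]mxE; ring.
have i0 : 0 <= (2 ^+ n)^-1 :> R by rewrite invr_ge0 exprn_ge0.
rewrite -mulr_sumr [leLHS]normrM (ger0_norm i0) [`|4 * _|]normrM [`|4|]ger0_norm //.
rewrite [`|s ^+ 2 * _|]normrM (ger0_norm (sqr_ge0 s)).
have sE : s ^+ 2 = qform 1%:M v by rewrite sqr_sqrtr // ltW.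
have -> : d%:R * (c * \sum_S h S w) * qform 1%:M v =
    (2 ^+ n)^-1 * (4 * (s ^+ 2 * \sum_S h S w)).
  by rewrite -sE /c; field; rewrite h2 gt_eqF.
rewrite ler_wpM2l // ler_wpM2l // ler_wpM2l ?sqr_ge0 //.
apply: le_trans (ler_norm_sum _ _ _) _; apply: ler_sum => S _.
exact: cross_form_le.
Qed.

End GramDeviation.

(** * Exponential moments of the off-diagonal Gram form *)

Section SubgaussianMgf.
Context {R : realType}.

(** A power of fixed degree replaces the exponential, so that its mean becomes a finite sum of
    moments and no series is exchanged with an integral. The bound rests on exp(s - s^2) <= 1 + s
    for s = t/N, together with t^2/N <= 1. *)
Lemma expR_le_pow (t : R) N : 0 <= t -> t ^+ 2 <= N%:R -> (0 < N)%N ->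
  expR t <= 4 * (1 + t / N%:R) ^+ N.
Proof.
move=> t0 tN N0; have NR : 0 < N%:R :> R by rewrite ltr0n.
pose s := t / N%:R; have s0 : 0 <= s by rewrite divr_ge0 // ltW.
have s1 : 0 < 1 + s by rewrite ltr_pwDl.
have h : expR (s - s ^+ 2) <= 1 + s.
  apply: le_trans (_ : expR (s / (1 + s)) <= _).
    rewrite ler_expR ler_pdivlMr // -subr_ge0.
    by rewrite (_ : _ - _ = s ^+ 3) ?exprn_ge0 //; ring.
  have := expR_ge1Dx (- (s / (1 + s))).
  rewrite (_ : 1 - s / (1 + s) = (1 + s)^-1); last by field; rewrite gt_eqF.
  by rewrite expRN lef_pV2 // posrE ?expR_gt0.
have tE : t = N%:R * (s - s ^+ 2) + t ^+ 2 / N%:R.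
  by rewrite /s; field; rewrite gt_eqF.
rewrite [X in expR X]tE expRD mulrC ler_pM ?expR_ge0 //.
  apply: le_trans (expR1_le4 R); rewrite ler_expR ler_pdivrMr // mul1r //.
by rewrite expRM_natl lerXn2r ?nnegrE ?expR_ge0 // ltW.
Qed.

Lemma geometric_half_le N : \sum_(m < N) (1 / 2) ^+ m <= 2 :> R.
Proof.
have -> : \sum_(m < N) (1 / 2) ^+ m = 2 - 2 * (1 / 2) ^+ N :> R.
  elim: N => [|N IH]; first by rewrite big_ord0 expr0; ring.
  by rewrite big_ord_recr /= IH exprS; field.
by rewrite lerBlDr lerDl mulr_ge0 // exprn_ge0 // divr_ge0.
Qed.

Lemma bin_pow_le N m : 'C(N, m)%:R <= N%:R ^+ m / m`!%:R :> R.
Proof.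
rewrite ler_pdivlMr ?ltr0n ?fact_gt0 // -natrM -natrX ler_nat bin_ffact.
elim: m N => [|m IH] N; first by rewrite ffactn0 expn0.
by case: N => // N; rewrite ffactSS expnS leq_mul // (leq_trans (IH N)) //; case: (m) => // k; rewrite leq_exp2r.
Qed.

(** m^m / m! is a term of the series of e^m, and e <= 4. *)
Lemma pow_fact_le m : m%:R ^+ m <= 4 ^+ m * m`!%:R :> R.
Proof.
have F0 : 0 < m`!%:R :> R by rewrite ltr0n fact_gt0.
rewrite -ler_pdivrMr //; apply: le_trans (_ : expR m%:R <= _); last first.
  rewrite -[m%:R]mul1r expRM_natr lerXn2r ?nnegrE ?expR_ge0 //.
  exact: expR1_le4.
case: m F0 => [|m] F0; first by rewrite expr0 fact0 divr1 expR0.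
by apply: le_trans (expR_ge1Dxn m (ler0n R m.+1)); rewrite lerDr.
Qed.

Context {dsp : measure_display} {T : measurableType dsp}.
Variables (P : probability T R) (Y : T -> R) (B : R).
Hypothesis bY : bmeas Y.
Hypothesis B0 : 0 < B.
Hypothesis Ymom : forall m, (0 < m)%N -> Ex P (fun w => Y w ^+ (2 * m)) <= (2 * m%:R * B) ^+ m.

(** Y <= 4 B + Y^2/(16 B), by completing the square, reduces exp(Y) to even moments of [Y]. *)
Lemma Ex_expR_le : Ex P (fun w => expR (Y w)) <= 8 * expR (4 * B).
Proof.
(* With this [c] the m-th term is at most (2 m B / c)^m / m! = (m/8)^m / m!, which [pow_fact_le]
   bounds by 2^-m. *)
pose c := 16 * B; have c0 : 0 < c by rewrite mulr_gt0.
have [_ [M hM]] := bY.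
(* Since [Y] is bounded by [M], one degree meets the condition of [expR_le_pow] at all points. *)
have [N hN] : exists N : nat, ((M ^+ 2 / c) ^+ 2 <= N.+1%:R).
  exists (Num.truncn ((M ^+ 2 / c) ^+ 2)).
  by apply: ltW; apply: Num.Theory.real_truncnS_gt; rewrite num_real.
pose V w := 1 + Y w ^+ 2 / c / N.+1%:R.
have bV : bmeas V.
  apply: bmeasD; first exact: bmeas_cst.
  by rewrite (_ : (fun w => _) = (fun w => (c^-1 / N.+1%:R) * Y w ^+ 2));
    [apply: bmeasZ; exact: bmeasX|apply/funext => w; ring].
have step1 w : expR (Y w) <= expR (4 * B) * (4 * V w ^+ N.+1).
  apply: le_trans (_ : expR (4 * B) * expR (Y w ^+ 2 / c) <= _).
    rewrite -expRD ler_expR -subr_ge0.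
    rewrite (_ : _ - _ = (Y w - 8 * B) ^+ 2 / c); last by rewrite /c; field; rewrite gt_eqF.
    by rewrite divr_ge0 ?sqr_ge0 // ltW.
  rewrite ler_wpM2l ?expR_ge0 //; apply: expR_le_pow => //.
    by rewrite divr_ge0 ?sqr_ge0 // ltW.
  apply: le_trans hN; rewrite lerXn2r ?nnegrE ?divr_ge0 ?sqr_ge0 ?(ltW c0) //.
  rewrite ler_pM2r ?invr_gt0 // -[Y w ^+ 2]real_normK ?num_real //.
  by rewrite lerXn2r ?nnegrE ?(le_trans _ (hM w)).
apply: le_trans (_ : Ex P (fun w => expR (4 * B) * (4 * V w ^+ N.+1)) <= _).
  by apply: Ex_le => //; [exact: bmeas_expR|do 2 apply: bmeasZ; exact: bmeasX].
rewrite ExZ; last by apply: bmeasZ; exact: bmeasX.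
rewrite ExZ; last exact: bmeasX.
rewrite mulrCA (_ : 8 * _ = 4 * (expR (4 * B) * 2)); last by ring.
rewrite ler_wpM2l // ler_wpM2l ?expR_ge0 //.
pose a m : R := (c^-1 / N.+1%:R) ^+ m * 'C(N.+1, m)%:R.
have VE : (fun w => V w ^+ N.+1) = (fun w => \sum_(m < N.+2) a m * Y w ^+ (2 * m)).
  apply/funext => w; rewrite /V exprDn; apply: eq_bigr => m _.
  rewrite expr1n mul1r /a exprM -mulr_natr [X in X ^+ m](_ : _ = (c^-1 / N.+1%:R) * Y w ^+ 2).
    by rewrite exprMn; ring.
  by ring.
rewrite VE Ex_sum => [|m _]; last by apply: bmeasZ; exact: bmeasX.
apply: le_trans (geometric_half_le N.+2); apply: ler_sum => m _.
rewrite ExZ; last exact: bmeasX.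
have a0 : 0 <= a m by rewrite mulr_ge0 // exprn_ge0 // divr_ge0 // invr_ge0 ltW.
have [m0|m0] := posnP m.
  have -> : m = ord0 :> 'I_N.+2 by apply: val_inj.
  by rewrite /a /= !expr0 bin0 mul1r mul1r; under [X in Ex P X]funext do rewrite expr0; rewrite Ex_cst.
apply: le_trans (ler_wpM2l a0 (Ymom m0)) _.
rewrite /a; have := bin_pow_le N.+1 m; have := pow_fact_le m.
have F0 : 0 < m`!%:R :> R by rewrite ltr0n fact_gt0.
have NR : 0 < N.+1%:R :> R by rewrite ltr0n.
move=> h1 h2.
apply: le_trans (_ : (c^-1 / N.+1%:R) ^+ m * (N.+1%:R ^+ m / m`!%:R) * (2 * m%:R * B) ^+ m <= _).
  rewrite ler_wpM2r ?exprn_ge0 ?mulr_ge0 ?(ltW B0) // ler_wpM2l // exprn_ge0 //.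
  by rewrite divr_ge0 ?invr_ge0 ?(ltW c0).
have -> : (c^-1 / N.+1%:R) ^+ m * (N.+1%:R ^+ m / m`!%:R) * (2 * m%:R * B) ^+ m =
    (1 / 8) ^+ m * (m%:R ^+ m / m`!%:R).
  have -> : (c^-1 / N.+1%:R) ^+ m * (N.+1%:R ^+ m / m`!%:R) * (2 * m%:R * B) ^+ m =
     (c^-1 / N.+1%:R * N.+1%:R * (2 * B) * m%:R) ^+ m / m`!%:R.
    by rewrite (_ : 2 * m%:R * B = 2 * B * m%:R) ?[(_ * m%:R) ^+ m]exprMn ?[(_ * (2 * B)) ^+ m]exprMn ?[(_ * N.+1%:R) ^+ m]exprMn; ring.
  rewrite exprMn mulrA; congr (_ * _ * _); congr (_ ^+ m).
  by rewrite /c; field; rewrite !gt_eqF.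
apply: le_trans (_ : (1 / 8) ^+ m * 4 ^+ m <= _).
  by rewrite ler_wpM2l ?exprn_ge0 // ler_pdivrMr.
by rewrite -exprMn le_eqVlt; apply/orP; left; apply/eqP; congr (_ ^+ m); field.
Qed.

End SubgaussianMgf.

Section ExponentialMoment.
Context {dsp : measure_display} {T : measurableType dsp} {R : realType} {n d : nat}.
Variables (P : probability T R) (z : 'I_n -> T -> 'cV[R]_d).
Hypothesis zm : forall k B, borel_cV B -> measurable (z k @^-1` B).
Hypothesis zi : independent_vectors P z.
Hypothesis zn : forall k w, dotv (z k w) (z k w) = d%:R.
Variable L : R.
Hypothesis L0 : 0 < L.
Hypothesis zmgf : forall k u,
  Ex P (fun w => expR (dotv (z k w) u)) <= 8 * expR (L * dotv u u).

Let bz k : bmx (z k).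
Proof. by apply: (bmx_block zm (J := [set k]%SET)); apply: bmx_vector; rewrite ?finset.in_set1. Qed.

Lemma dotvZl (c : R) (u v : 'cV[R]_d) : dotv (c *: u) v = c * dotv u v.
Proof. by rewrite /dotv mulr_sumr; apply: eq_bigr => j _; rewrite mxE mulrA. Qed.

Lemma dotv_suml (I : Type) (s : seq I) (p : pred I) (F : I -> 'cV[R]_d) v :
  dotv (\sum_(i <- s | p i) F i) v = \sum_(i <- s | p i) dotv (F i) v.
Proof.
rewrite /dotv exchange_big /=; apply: eq_bigr => j _.
by rewrite summxE mulr_suml.
Qed.

Lemma dotv_ge0 (u : 'cV[R]_d) : 0 <= dotv u u.
Proof. by apply: sumr_ge0 => j _; rewrite -expr2 sqr_ge0. Qed.

(** The rows in [U] are integrated out one by one, given the rows in [J] on which [v] depends. Each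
    contributes a factor 8 and an exponential that is stored in the weight [H], which is arbitrary
    for the sake of this induction. *)
Lemma peel_expR m (U J : {set 'I_n}) (x : 'I_n -> R) (v : T -> 'cV[R]_d) (H : T -> R) :
  #|U| = m -> (forall k, k \in U -> k \notin J) ->
  @bmx _ (block z J) _ _ _ v -> @bmeas _ (block z J) _ H -> (forall w, 0 <= H w) ->
  Ex P (fun w => expR (\sum_(j in U) x j * dotv (z j w) (v w)) * H w) <=
  8 ^+ m * Ex P (fun w => expR (L * (\sum_(j in U) x j ^+ 2) * dotv (v w) (v w)) * H w).
Proof.
move=> + + bv; elim: m U H => [|m IH] U H cU UJ bH H0.
  have U0 : U = finset.set0 by apply/eqP; rewrite -cards_eq0 cU.
  rewrite U0 expr0 mul1r le_eqVlt; apply/orP; left; apply/eqP.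
  by congr (Ex P _); apply/funext => w; rewrite !big_set0 mulr0 mul0r.
have [k kU] : exists k, k \in U by apply/set0Pn; rewrite -cards_eq0 cU.
pose J' := J :|: (U :\ k); pose U' := U :\ k.
have kJ' : k \notin J' by rewrite !inE eqxx orbF; exact: UJ.
have JJ' : J \subset J' by exact: finset.subsetUl.
have bvJ' : @bmx _ (block z J') _ _ _ v.
  by move=> i j; apply: bmeas_block_subset JJ' (bv i j).
pose S w := \sum_(j in U') x j * dotv (z j w) (v w).
have bS : @bmeas _ (block z J') _ S.
  apply: bmeas_sum => j jU; apply: bmeasZ; apply: bmeas_dotv => //.
  by apply: bmx_vector => //; rewrite finset.in_setU jU orbT.
have bV : @bmeas _ (block z J) _ (fun w => dotv (v w) (v w)) by exact: bmeas_dotv.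
have bHT := bmeas_block zm bH; have bVT := bmeas_block zm bV; have bST := bmeas_block zm bS.
have bG dsp' (W : measurableType dsp') (f : W -> R) : bmeas f -> bmeas ((fun y => expR (x k * y)) \o f).
  by move=> bf; apply: bmeas_expR; exact: bmeasZ.
pose b w := 8 * expR (L * x k ^+ 2 * dotv (v w) (v w)).
have bb : bmeas b by apply: bmeasZ; apply: bmeas_expR; exact: bmeasZ.
have hb w : Ex P (fun w' => expR (x k * dotv (z k w') (v w))) <= b w.
  have := zmgf k (x k *: v w).
  under [X in Ex P X]funext do rewrite dotvC dotvZl dotvC.
  have E : dotv (x k *: v w) (x k *: v w) = x k ^+ 2 * dotv (v w) (v w).
    by rewrite dotvZl dotvC dotvZl mulrA expr2.
  by rewrite E mulrA.
have step := peel_le zm zi zn kJ' bG bvJ'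
  (bmeasM (bmeas_expR bS) (bmeas_block_subset JJ' bH)) (fun w => mulr_ge0 (expR_ge0 _) (H0 w)) bb hb.
have -> : (fun w => expR (\sum_(j in U) x j * dotv (z j w) (v w)) * H w) =
    (fun w => expR (x k * dotv (z k w) (v w)) * (expR (S w) * H w)).
  by apply/funext => w; rewrite (big_setD1 k) //= expRD mulrA.
apply: (le_trans step).
pose H' w := expR (L * x k ^+ 2 * dotv (v w) (v w)) * H w.
have bH' : @bmeas _ (block z J) _ H'.
  by apply: bmeasM => //; apply: bmeas_expR; exact: bmeasZ.
have -> : (fun w => b w * (expR (S w) * H w)) = (fun w => 8 * (expR (S w) * H' w)).
  by apply/funext => w; rewrite /b /H'; ring.
rewrite ExZ; last by apply: bmeasM; [exact: bmeas_expR|exact: (bmeas_block zm bH')].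
have cU' : #|U'| = m by have := cardsD1 k U; rewrite kU cU => -[].
have U'J j : j \in U' -> j \notin J by rewrite !inE => /andP[_]; exact: UJ.
have := IH U' H' cU' U'J bH' (fun w => mulr_ge0 (expR_ge0 _) (H0 w)).
rewrite exprS -mulrA => h; rewrite ler_wpM2l // (le_trans h) // ler_wpM2l ?exprn_ge0 //.
rewrite le_eqVlt; apply/orP; left; apply/eqP; congr (Ex P _); apply/funext => w.
rewrite /H' [in RHS](big_setD1 k) //= mulrA -expRD; congr (_ * _); congr expR; ring.
Qed.

(** Decoupling a form over [S] leads back to forms over subsets of [S], hence the parameter. *)
Definition offdiag_form (S : {set 'I_n}) (x : 'I_n -> R) w :=
  \sum_j \sum_(k | k != j)
    if (j \in S) && (k \in S) then x j * x k * dotv (z j w) (z k w) else 0.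

Lemma bmeas_offdiag S x : bmeas (offdiag_form S x).
Proof.
apply: bmeas_sum => j _; apply: bmeas_sum => k _.
case: ((j \in S) && (k \in S)); last exact: bmeas_cst.
by apply: bmeasZ; exact: bmeas_dotv.
Qed.

Lemma jensen_expR (I : finType) (a : I -> R) (N : R) : 0 < N -> N = #|I|%:R ->
  expR (N^-1 * \sum_i a i) <= N^-1 * \sum_i expR (a i).
Proof.
move=> N0 NE; set m := N^-1 * _.
have E : \sum_i (a i - m) = 0.
  by rewrite sumrB sumr_const -[_ *+ _]mulr_natl -NE /m mulrA divff ?gt_eqF // mul1r subrr.
rewrite -(ler_pM2l N0) mulrA divff ?gt_eqF // mul1r.
apply: le_trans (_ : \sum_i expR m * (1 + (a i - m)) <= _).
  rewrite -mulr_sumr big_split /= E addr0 sumr_const -[_ *+ _]mulr_natl -NE mulr1 mulrC.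
  exact: lexx.
apply: ler_sum => i _; rewrite -[a i in leRHS](subrK m) addrC expRD mulrC ler_wpM2r ?expR_ge0 //.
by rewrite addrC; exact: expR_ge1Dx.
Qed.

Variables (x : 'I_n -> R) (rho : R).
Hypothesis xrho : \sum_j x j ^+ 2 <= rho.
Hypothesis rho0 : 0 < rho.

Let xS (S : {set 'I_n}) : 0 <= \sum_(j in S) x j ^+ 2 <= rho.
Proof.
rewrite sumr_ge0 => [|j _]; last exact: sqr_ge0.
rewrite (le_trans _ xrho) // [leRHS](bigID (mem S)) /= lerDl sumr_ge0 // => j _.
exact: sqr_ge0.
Qed.

(** The parameter after one round of decoupling: the factor 4 gets squared when a row is integrated
    out, which gives L (4 l)^2 rho. *)
Let theta l := 16 * L * rho * l ^+ 2.

(** Decoupling and convexity of the exponential reduce to a fixed subset [U]. Integrating out the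
    rows in both [S] and [U] leaves an exponential of |u|^2, where [u] combines the rows of [S]
    outside [U]. Expanding |u|^2 gives a diagonal part, at most d rho, and again an off-diagonal
    form. *)
Lemma decoupled_expR_le (S : {set 'I_n}) (l M : R) :
  (forall S', Ex P (fun w => expR (theta l * offdiag_form S' x w)) <= M) ->
  Ex P (fun w => expR (l * offdiag_form S x w)) <= 8 ^+ n * expR (theta l * rho * d%:R) * M.
Proof.
move=> hM.
have theta0 : 0 <= theta l by rewrite mulr_ge0 ?sqr_ge0 // !mulr_ge0 // ltW.
pose u (V : {set 'I_n}) w := \sum_(k in V) x k *: z k w.
have bu V : @bmx _ (block z V) _ _ _ (u V).
  move=> i j; under [X in bmeas X]funext do rewrite summxE.
  apply: bmeas_sum => k kV; under [X in bmeas X]funext do rewrite mxE.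
  by apply: bmeasZ; exact: (bmx_vector zn kV).
pose a (U : {set 'I_n}) w := \sum_(j in S :&: U) 4 * l * x j * dotv (z j w) (u (S :\: U) w).
have N0 : 0 < 2 ^+ n :> R by rewrite exprn_gt0.
have NE : 2 ^+ n = #|{set 'I_n}|%:R :> R.
  by rewrite -[in RHS]cardsT -powersetT card_powerset cardsT card_ord natrX.
have QE w : l * offdiag_form S x w = (2 ^+ n)^-1 * \sum_(U : {set 'I_n}) a U w.
  have := decoupling_sum (fun j k =>
    if (j \in S) && (k \in S) then x j * x k * dotv (z j w) (z k w) else 0).
  move/(congr1 (fun y => (2 ^+ n)^-1 * (l * y))); rewrite mulrCA mulKf ?gt_eqF // => ->.
  congr (_ * _); rewrite mulrA mulr_sumr; apply: eq_bigr => U _.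
  rewrite /a mulr_sumr [LHS]big_mkcond [RHS]big_mkcond /=; apply: eq_bigr => j _.
  rewrite inE andbC; case: (j \in U) => //=; case: (j \in S) => /=; last first.
    by rewrite big1 ?mulr0.
  rewrite /u dotvC dotv_suml !mulr_sumr [LHS]big_mkcond [RHS]big_mkcond /=.
  apply: eq_bigr => k _; rewrite !inE; case: (k \in U) => //=.
  by case: (k \in S) => /=; rewrite ?mulr0 // dotvZl dotvC; ring.
have ba U : bmeas (a U).
  apply: bmeas_sum => j _; apply: bmeasZ; apply: bmeas_dotv => //.
  exact: bmx_block (bu _).
apply: le_trans (_ : Ex P (fun w => (2 ^+ n)^-1 * \sum_(U : {set 'I_n}) expR (a U w)) <= _).
  apply: Ex_le => [||w].
  - by apply: bmeas_expR; apply: bmeasZ; exact: bmeas_offdiag.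
  - by apply: bmeasZ; apply: bmeas_sum => U _; exact: bmeas_expR.
  - by rewrite QE; exact: jensen_expR.
rewrite ExZ; last by apply: bmeas_sum => U _; exact: bmeas_expR.
rewrite Ex_sum; last by move=> U _; exact: bmeas_expR.
rewrite ler_pdivrMl // [X in X * (_ * _)]NE mulr_natl -sumr_const.
apply: ler_sum => U _; set V := S :\: U; set W := S :&: U.
have WV k : k \in W -> k \notin V by rewrite !inE => /andP[_ ->].
have h := @peel_expR _ W V (fun j => 4 * l * x j) (u V) (fun=> 1) (erefl #|W|) WV (bu V)
  (bmeas_cst 1) (fun=> ler01).
have M0 : 0 <= M by apply: le_trans (hM S); apply: Ex_ge0 => w; exact: expR_ge0.
move: h; under [X in Ex P X <= _]funext do rewrite mulr1.
under [X in _ * Ex P X]funext do rewrite mulr1.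
move=> h; apply: (le_trans h).
have uE w : dotv (u V w) (u V w) = d%:R * \sum_(j in V) x j ^+ 2 + offdiag_form V x w.
  rewrite {1}/u dotv_suml /offdiag_form mulr_sumr.
  rewrite [X in _ = X + _]big_mkcond /= [LHS]big_mkcond /= -big_split /=; apply: eq_bigr => j _.
  case: (boolP (j \in V)) => jV /=; last by rewrite big1 // addr0.
  rewrite dotvZl /u dotvC dotv_suml mulr_sumr big_mkcond /= (bigD1 j) //= jV dotvZl zn.
  congr (_ + _); first by rewrite expr2; ring.
  apply: eq_bigr => k kj; case: ifP => // _.
  by rewrite dotvZl dotvC; ring.
apply: le_trans (_ : 8 ^+ n * Ex P (fun w => expR (theta l * rho * d%:R) *
    expR (theta l * offdiag_form V x w)) <= _); last first.
  rewrite ExZ; last by apply: bmeas_expR; apply: bmeasZ; exact: bmeas_offdiag.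
  by rewrite -[leRHS]mulrA ler_wpM2l ?exprn_ge0 // ler_wpM2l ?expR_ge0.
apply: ler_pM; rewrite ?exprn_ge0 //.
- by apply: Ex_ge0 => w; exact: expR_ge0.
- by rewrite ler_weXn2l ?ler1n // -[X in (_ <= X)%N]card_ord max_card.
apply: Ex_le => [||w].
- by apply: bmeas_expR; apply: bmeasZ; apply: bmeas_dotv; exact: bmx_block (bu V).
- by apply: bmeasZ; apply: bmeas_expR; apply: bmeasZ; exact: bmeas_offdiag.
rewrite -expRD ler_expR.
have [/andP[w0 w1] /andP[v0 v1]] := (xS W, xS V).
apply: le_trans (_ : theta l * dotv (u V w) (u V w) <= _).
  rewrite ler_wpM2r ?dotv_ge0 //.
  under eq_bigr do rewrite exprMn.
  rewrite -mulr_sumr /theta (_ : 16 * L * rho * l ^+ 2 = L * ((4 * l) ^+ 2 * rho)); last by ring.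
  by rewrite ler_wpM2l ?(ltW L0) // ler_wpM2l ?sqr_ge0.
by rewrite uE mulrDr lerD2r -mulrA ler_wpM2l // mulrC ler_wpM2r.
Qed.

(* [decoupled_expR_le] bounds the maximum over S of the exponential moments by a
   constant times its own square root. *)
Lemma offdiag_expR_le (S : {set 'I_n}) (l : R) : 0 < l -> 32 * L * rho * l <= 1 ->
  forall s, s = l \/ s = - l ->
  Ex P (fun w => expR (s * offdiag_form S x w)) <=
  4 * 64 ^+ n * expR (2 * (theta l * rho * d%:R)).
Proof.
move=> l0 hl.
pose F S' := Ex P (fun w => expR (l * offdiag_form S' x w)).
have bF s S' : bmeas (fun w => expR (s * offdiag_form S' x w)).
  by apply: bmeas_expR; apply: bmeasZ; exact: bmeas_offdiag.
(* The subset changes from one side of the estimate to the other, so the inequality closes up only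
   for the largest of these moments. *)
pose S0 := [arg max_(S' > finset.set0) F S']%O.
have FS0 S' : F S' <= F S0.
  by rewrite /S0; case: (@Order.TotalTheory.arg_maxP _ _ _ _ xpredT F) => // i _; apply.
have F0 : F finset.set0 = 1.
  rewrite /F (_ : (fun w => _) = fun=> 1) ?Ex_cst //; apply/funext => w.
  rewrite /offdiag_form big1 ?mulr0 ?expR0 // => j _; rewrite big1 // => k _.
  by rewrite finset.in_set0.
pose q := Num.sqrt (F S0).
have F1 : 1 <= F S0 by rewrite -F0.
have q1 : 1 <= q by rewrite -sqrtr1 ler_wsqrtr.
have qq : q ^+ 2 = F S0 by rewrite sqr_sqrtr // (le_trans ler01).
have q0 : 0 < q := lt_le_trans ltr01 q1.
have theta0 : 0 <= theta l by rewrite mulr_ge0 ?sqr_ge0 // !mulr_ge0 // ltW.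
have thl : theta l <= l / 2.
  rewrite /theta (_ : _ * l ^+ 2 = (32 * L * rho * l) * (l / 2)); last by field.
  by rewrite -[leRHS]mul1r ler_wpM2r // divr_ge0 // ltW.
(* As theta <= l/2, for y >= 0 the exponential is at most exp(l y / 2), hence at most (exp(l y)/q +
   q)/2; for y < 0 it is at most 1. The mean is then at most 1 + q <= 2 q. *)
have hM S' : Ex P (fun w => expR (theta l * offdiag_form S' x w)) <= 2 * q.
  apply: le_trans (_ : Ex P (fun w => 1 + (q^-1 / 2 * expR (l * offdiag_form S' x w) + q / 2)) <= _).
    apply: Ex_le => [||w]; first exact: bF.
      apply: bmeasD; first exact: bmeas_cst.
      by apply: bmeasD; [exact: bmeasZ|exact: bmeas_cst].
    set y := offdiag_form _ _ _.
    have [y0|y0] := leP 0 y; last first.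
      rewrite -[leLHS]addr0 lerD //; last first.
        by rewrite addr_ge0 ?mulr_ge0 ?expR_ge0 ?invr_ge0 ?(ltW q0).
      by rewrite -expR0 ler_expR mulr_ge0_le0 // ltW.
    rewrite -[leLHS]add0r lerD //.
    apply: le_trans (_ : expR (l / 2 * y) <= _); first by rewrite ler_expR ler_wpM2r.
    have -> : expR (l * y) = expR (l / 2 * y) ^+ 2.
      by rewrite -expRM_natl; congr expR; field.
    rewrite -subr_ge0 (_ : _ - _ = (expR (l / 2 * y) - q) ^+ 2 / (2 * q)).
      by rewrite divr_ge0 ?sqr_ge0 // mulr_ge0 // ltW.
    by field; rewrite gt_eqF.
  rewrite ExD; first 1 last.
  - exact: bmeas_cst.
  - by apply: bmeasD; [exact: bmeasZ|exact: bmeas_cst].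
  rewrite ExD; first 1 last; [exact: bmeasZ|exact: bmeas_cst|].
  rewrite !Ex_cst ExZ //.
  have : q^-1 / 2 * F S' <= q^-1 / 2 * q ^+ 2.
    by rewrite ler_wpM2l ?qq // divr_ge0 // invr_ge0 ltW.
  rewrite (_ : q^-1 / 2 * q ^+ 2 = q / 2); last by field; rewrite gt_eqF.
  by rewrite -/(F S'); lra.
set E := expR (theta l * rho * d%:R).
have E0 : 0 < E by exact: expR_gt0.
have h8 : 0 < 8 ^+ n :> R by rewrite exprn_gt0.
have := decoupled_expR_le S0 hM; rewrite -/(F S0) -qq -/E => hq.
(* The estimate reads q^2 <= 8^n E (2 q), where the positive q cancels. *)
have qle : q <= 2 * (8 ^+ n * E).
  by rewrite -(ler_pM2r q0) -expr2 (le_trans hq) // le_eqVlt; apply/orP; left; apply/eqP; ring.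
(* [theta] is even, so one more round, started from the bound 2 q, covers the negative parameter as
   well. *)
move=> s sl.
have thE : theta s = theta l by case: sl => ->; rewrite /theta ?sqrrN.
have := @decoupled_expR_le S s (2 * q); rewrite thE => /(_ hM) h.
apply: (le_trans h); apply: le_trans (_ : 8 ^+ n * E * (2 * (2 * (8 ^+ n * E))) <= _).
  by rewrite ler_wpM2l ?mulr_ge0 ?(ltW h8) ?(ltW E0) // ler_wpM2l.
rewrite (_ : 64 = 8 * 8) ?exprMn; last by rewrite -natrM.
by rewrite (expRM_natl 2 (theta l * rho * d%:R)) -/E le_eqVlt; apply/orP; left; apply/eqP; ring.
Qed.

End ExponentialMoment.

(** * A lattice net for forms with zero diagonal *)

Section LatticeNet.
Variables (R : realType) (n : nat).
Hypothesis n0 : (0 < n)%N.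

(** The integers from -2n to 2n; the shape of the index type separates the negative ones in
    [gaussian_sum_le]. *)
Definition lattice_coord (i : 'I_(2 * n + (2 * n).+1)) : R := i%:R - (2 * n)%:R.

Definition lattice_point (f : {ffun 'I_n -> 'I_(2 * n + (2 * n).+1)}) (j : 'I_n) : R :=
  lattice_coord (f j) / Num.sqrt n%:R.

(** After the scaling by 1/sqrt(n) in [lattice_point], this is the ball of radius 2. *)
Definition in_net (f : {ffun 'I_n -> 'I_(2 * n + (2 * n).+1)}) : bool :=
  \sum_j lattice_coord (f j) ^+ 2 <= 4 * n%:R.

Let nR : 0 < n%:R :> R. Proof. by rewrite ltr0n. Qed.

Lemma expRN_sqr_le k : expR (- (k%:R ^+ 2)) <= (1 / 2) ^+ k :> R.
Proof.
apply: le_trans (_ : expR (k%:R * -1) <= _).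
  rewrite ler_expR mulrN1 lerN2 -natrX ler_nat; case: k => // k.
  by rewrite -{1}(expn1 k.+1) leq_pexp2l.
rewrite expRM_natl lerXn2r ?nnegrE ?expR_ge0 ?divr_ge0 //.
have := expR_ge1Dx (1 : R); rewrite expRN div1r => h.
by rewrite lef_pV2 ?posrE ?expR_gt0.
Qed.

Lemma gaussian_sum_le : \sum_i expR (- lattice_coord i ^+ 2) <= 4 :> R.
Proof.
rewrite big_split_ord /=.
have h1 : \sum_(i < 2 * n) expR (- lattice_coord (lshift (2 * n).+1 i) ^+ 2) <= 2 :> R.
  apply: le_trans (geometric_half_le (2 * n)).
  rewrite (reindex_inj rev_ord_inj) /=; apply: ler_sum => i _.
  have il := ltn_ord i.
  rewrite /lattice_coord /= natrB // -sqrrN (_ : - _ = i.+1%:R); last by ring.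
  apply: le_trans (expRN_sqr_le _) _; rewrite exprS.
  by rewrite ler_piMl ?exprn_ge0 ?divr_ge0 //; lra.
have h2 : \sum_(i < (2 * n).+1) expR (- lattice_coord (rshift (2 * n) i) ^+ 2) <= 2 :> R.
  apply: le_trans (geometric_half_le (2 * n).+1); apply: ler_sum => i _.
  rewrite /lattice_coord /= natrD (_ : _ - _ = i%:R); last by ring.
  exact: expRN_sqr_le.
lra.
Qed.

(** Gaussian counting: on the net, 1 is at most exp(4 n) times the product of the weights
    exp(-k_j^2). Summed over the whole box the weights factorise into n sums, each at most 4, and
    e^4 * 4 <= 4^5 = 1024. *)
Lemma card_net_le : #|in_net|%:R <= 1024 ^+ n :> R.
Proof.
rewrite -sum1_card natr_sum /=.
apply: le_trans (_ : \sum_(f : {ffun 'I_n -> 'I_(2 * n + (2 * n).+1)}) expR (4 * n%:R) * \prod_j expR (- lattice_coord (f j) ^+ 2) <= _).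
  rewrite big_mkcond /=; apply: ler_sum => f _; case: ifP => [fN|_]; last first.
    by rewrite mulr_ge0 ?expR_ge0 // prodr_ge0 // => j _; exact: expR_ge0.
  rewrite -expR_sum -expRD sumrN -[leLHS]expR0 ler_expR subr_ge0; exact: fN.
rewrite -mulr_sumr -(bigA_distr_bigA (fun=> fun i => expR (- lattice_coord i ^+ 2))) /=.
rewrite prodr_const card_ord (_ : 1024 = 4 ^+ 4 * 4); last by ring.
have sum0 : 0 <= \sum_i expR (- lattice_coord i ^+ 2) :> R.
  by apply: sumr_ge0 => i _; exact: expR_ge0.
rewrite exprMn; apply: ler_pM; rewrite ?expR_ge0 ?exprn_ge0 //.
  rewrite expRM_natr lerXn2r ?nnegrE ?expR_ge0 ?exprn_ge0 //.
  rewrite -[4 in leLHS]mulr1 expRM_natl lerXn2r ?nnegrE ?expR_ge0 //; exact: expR1_le4.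
by rewrite lerXn2r ?nnegrE // gaussian_sum_le.
Qed.

Lemma qform_round (G : 'M[R]_n) (v : 'rV[R]_n) (l u : 'I_n -> R) :
  (forall i, G i i = 0) -> (forall i, l i <= v 0 i <= u i) ->
  exists x : 'rV[R]_n, (forall i, x 0 i = l i \/ x 0 i = u i) /\ qform G v <= qform G x.
Proof.
move=> G0 lvu.
suff : forall m, (m <= n)%N -> exists x : 'rV[R]_n,
    [/\ forall i : 'I_n, (i < m)%N -> x 0 i = l i \/ x 0 i = u i,
        forall i : 'I_n, (m <= i)%N -> x 0 i = v 0 i & qform G v <= qform G x].
  by move=> /(_ n (leqnn n)) [x [h1 _ h2]]; exists x; split => // i; exact: h1.
elim=> [|m IH] mn; first by exists v; split.
have [x [h1 h2 h3]] := IH (ltnW mn).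
pose i := Ordinal mn; pose e : 'rV[R]_n := delta_mx 0 i.
pose b := (e *m G *m x^T) 0 0 + (x *m G *m e^T) 0 0.
(* The coefficient of t^2 is a diagonal entry of [G], which vanishes; the sign of the slope [b] then
   decides which end of the interval is taken. *)
have E t : qform G (x + t *: e) = qform G x + t * b.
  have ee : (e *m G *m e^T) 0 0 = 0.
    by rewrite /e trmx_delta -rowE -colE !mxE.
  rewrite /qform linearD linearZ /= !mulmxDl !mulmxDr -!scalemxAl -!scalemxAr.
  rewrite /b; move: ee; move: (x *m G *m x^T) (e *m G *m x^T) (x *m G *m e^T) (e *m G *m e^T).
  by move=> p q r t' t0; rewrite !mxE t0; ring.
have xi : x 0 i = v 0 i by apply: h2.
have upd t (j : 'I_n) : (x + t *: e) 0 j = x 0 j + t *+ (j == i).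
  by rewrite !mxE eqxx /= mulr_natr.
have fin t : (x 0 i + t = l i \/ x 0 i + t = u i) -> 0 <= t * b ->
  exists x0 : 'rV[R]_n,
    [/\ forall i : 'I_n, (i < m.+1)%N -> x0 0 i = l i \/ x0 0 i = u i,
        forall i : 'I_n, (m < i)%N -> x0 0 i = v 0 i & qform G v <= qform G x0].
  move=> ht tb; exists (x + t *: e); split => [j jm|j jm|].
  - rewrite upd; have [->|ji] := eqVneq j i; first by rewrite mulr1n.
    rewrite mulr0n addr0; apply: h1; rewrite ltn_neqAle -ltnS jm andbT.
    by apply: contra ji => /eqP jE; apply/eqP/val_inj.
  - rewrite upd (_ : (j == i) = false) ?mulr0n ?addr0 ?h2 ?(ltnW jm) //.
    by apply/negbTE; apply: contraTneq jm => ->; rewrite ltnn.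
  - by rewrite E (le_trans h3) // lerDl.
have /andP[li ui] := lvu i.
have [b0|b0] := leP 0 b.
  apply: (fin (u i - v 0 i)); first by right; rewrite xi addrC subrK.
  by rewrite mulr_ge0 // subr_ge0.
apply: (fin (l i - v 0 i)); first by left; rewrite xi addrC subrK.
by rewrite mulr_le0 ?subr_le0 // ltW.
Qed.

(* With zero diagonal the form is affine in each coordinate, hence maximal at a
   vertex of the lattice cell containing v. *)
Lemma qform_net_le (G : 'M[R]_n) (v : 'rV[R]_n) : (forall i, G i i = 0) ->
  qform 1%:M v = 1 -> exists f, in_net f /\ qform G v <= qform G (\row_j lattice_point f j).
Proof.
move=> G0 v1; pose s : R := Num.sqrt n%:R.
have s0 : 0 < s by rewrite sqrtr_gt0.
have ss : s ^+ 2 = n%:R by rewrite sqr_sqrtr // ltW.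
pose fl i := Num.floor (s * v 0 i).
have flb i : (fl i)%:~R <= s * v 0 i <= (fl i + 1)%:~R.
  by rewrite floor_le ltW // floorD1_gt.
have lvu i : (fl i)%:~R / s <= v 0 i <= (fl i + 1)%:~R / s.
  by rewrite ler_pdivrMr // ler_pdivlMr // mulrC flb.
have [x [hx hq]] := qform_round G0 lvu.
pose k i := if x 0 i == (fl i)%:~R / s then fl i else fl i + 1.
have xk i : x 0 i = (k i)%:~R / s.
  by rewrite /k; case: eqVneq => // /eqP xn; case: (hx i) => // /xn.
have kv i : `|(k i)%:~R - s * v 0 i| <= 1.
  have /andP[f1 f2] := flb i; rewrite ler_norml; move: f2; rewrite /k intrD.
  by case: ifP => _; rewrite ?intrD => f2; apply/andP; split; lra.
have vs i : v 0 i ^+ 2 <= 1.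
  by rewrite -v1 qform1E (bigD1 i) //= lerDl sumr_ge0 // => j _; exact: sqr_ge0.
have n1 : 1 <= n%:R :> R by rewrite ler1n.
have sn : s <= n%:R.
  by rewrite -[leRHS]ger0_norm // -sqrtr_sqr ler_wsqrtr // expr2 ler_peMr.
have kb i : `|(k i)%:~R : R| <= (2 * n)%:R.
  have sv : `|s * v 0 i| <= s.
    rewrite normrM (ger0_norm (ltW s0)) ler_piMr ?(ltW s0) //.
    by rewrite -(ler_pXn2r (n := 2)) ?nnegrE // expr1n real_normK ?num_real.
  have := ler_normD ((k i)%:~R - s * v 0 i) (s * v 0 i); rewrite subrK natrM.
  have := kv i; lra.
have kb0 i : 0 <= k i + (2 * n)%:Z.
  rewrite -(ler0z R) intrD -[(2 * n)%:Z%:~R]/((2 * n)%:R).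
  by have := kb i; rewrite ler_norml => /andP[]; lra.
have kbn i : (absz (k i + (2 * n)%:Z)%R < 2 * n + (2 * n).+1)%N.
  have : k i + (2 * n)%:Z <= (2 * n + 2 * n)%:Z.
    rewrite -(ler_int R) intrD -![_%:Z%:~R]/(_%:R) natrD lerD2r.
    by have := kb i; rewrite ler_norml => /andP[].
  by have := kb0 i; lia.
pose f := [ffun i => Ordinal (kbn i)].
have fk i : lattice_coord (f i) = (k i)%:~R.
  rewrite /lattice_coord ffunE /= natr_absz ger0_norm // intrD addrK; done.
exists f; split; last first.
  rewrite (_ : \row_j _ = x) //; apply/rowP => i.
  by rewrite mxE /lattice_point fk xk.
(* Rounding moves each scaled coordinate by at most 1, so k^2 <= 2 (s v)^2 + 2; with |v| = 1 and s^2
   = n the sum is 4 n. *)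
rewrite /in_net; apply: le_trans (_ : \sum_i (2 * (s * v 0 i) ^+ 2 + 2) <= _).
  apply: ler_sum => i _; rewrite fk.
  have : ((k i)%:~R - s * v 0 i) ^+ 2 <= 1.
    by rewrite -[leLHS]real_normK ?num_real // expr_le1.
  have := sqr_ge0 ((k i)%:~R - 2 * (s * v 0 i)); rewrite !sqrrB.
  set a := (k i)%:~R; set b := s * v 0 i => h1 h2.
  have : 2 * (a ^+ 2 - a * b *+ 2 + b ^+ 2) <= 2 by lra.
  have : (a ^+ 2 - a * (2 * b) *+ 2 + (2 * b) ^+ 2) = a ^+ 2 - 2 * (a * b *+ 2) + 4 * b ^+ 2 by ring.
  lra.
rewrite big_split /= sumr_const card_ord -mulr_sumr.
under eq_bigr do rewrite exprMn ss.
rewrite -mulr_sumr -qform1E v1 mulr1 -[_ *+ _]mulr_natl; lra.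
Qed.

End LatticeNet.

(** * Deviation of the Gram form with high probability *)

Section GramDeviationProbability.
Context {dsp : measure_display} {T : measurableType dsp} {R : realType} {n d : nat}.
Variables (P : probability T R) (z : 'I_n -> T -> 'cV[R]_d) (K : R).
Hypothesis zm : forall k B, borel_cV B -> measurable (z k @^-1` B).
Hypothesis zi : independent_vectors P z.
Hypothesis zn : forall k w, dotv (z k w) (z k w) = d%:R.
Hypothesis K0 : 0 < K.
Hypothesis zmom : forall k u m, (0 < m)%N ->
  Ex P (fun w => dotv (z k w) u ^+ (2 * m)) <= (2 * m%:R * (K ^+ 2 * dotv u u)) ^+ m.
Hypothesis n0 : (0 < n)%N.

Let bz k : bmx (z k).
Proof. by apply: (bmx_block zm (J := [set k]%SET)); apply: bmx_vector; rewrite ?finset.in_set1. Qed.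

Lemma subgaussian_mgf k u :
  Ex P (fun w => expR (dotv (z k w) u)) <= 8 * expR (4 * K ^+ 2 * dotv u u).
Proof.
have bu : bmeas (fun w => dotv (z k w) u) by apply: bmeas_dotv => //; exact: bmx_cst.
have [u0|u0] := eqVneq (dotv u u) 0.
  have uE j : u j 0 = 0.
    apply/eqP; rewrite -sqrf_eq0 expr2; move/eqP: u0; rewrite psumr_eq0 => [/allP h|i _].
      exact: h (mem_index_enum j).
    by rewrite -expr2 sqr_ge0.
  rewrite (_ : (fun w => _) = fun=> 1) ?Ex_cst.
    by rewrite u0 mulr0 expR0 mulr1 ler1n.
  by apply/funext => w; rewrite /dotv big1 ?expR0 // => j _; rewrite uE mulr0.
have uu : 0 < K ^+ 2 * dotv u u by rewrite mulr_gt0 ?exprn_gt0 // lt_neqAle eq_sym u0 dotv_ge0.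
by rewrite -[4 * _ * _]mulrA; apply: Ex_expR_le => // m m0; exact: zmom.
Qed.

Let Q (f : {ffun 'I_n -> 'I_(2 * n + (2 * n).+1)}) := offdiag_form z [set: 'I_n]%SET (lattice_point R f).

Let bQ f : bmeas (Q f).
Proof. exact: bmeas_offdiag. Qed.

Let L0 : 0 < 4 * K ^+ 2.
Proof. by rewrite mulr_gt0 ?exprn_gt0. Qed.

(** The case L = 4 K^2 and rho = 4 of [offdiag_expR_le]: 512 = 32 * 4 * 4 and 2048 = 2 * 16 * 4 * 4
    * 4. *)
Lemma net_expR_le f (l s : R) : in_net R f -> 0 < l -> 512 * K ^+ 2 * l <= 1 ->
  s = l \/ s = - l ->
  Ex P (fun w => expR (s * Q f w)) <= 4 * 64 ^+ n * expR (2048 * K ^+ 2 * l ^+ 2 * d%:R).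
Proof.
move=> fN l0 hl sl.
have xr : \sum_j lattice_point R f j ^+ 2 <= 4.
  rewrite /lattice_point; under eq_bigr do rewrite expr_div_n sqr_sqrtr //.
  by rewrite -mulr_suml ler_pdivrMr ?ltr0n.
have h4 : 0 < 4 :> R by [].
have hl' : 32 * (4 * K ^+ 2) * 4 * l <= 1.
  by rewrite (_ : 32 * _ * _ * _ = 512 * K ^+ 2 * l) //; ring.
have := offdiag_expR_le zm zi zn L0 subgaussian_mgf xr h4 [set: 'I_n]%SET l0 hl' sl.
rewrite (_ : 2 * _ = 2048 * K ^+ 2 * l ^+ 2 * d%:R) //; ring.
Qed.

(** [qform_net_le] for the off-diagonal Gram matrix and for its negative gives the two signs, with
    the same [s] on the net and on the sphere. *)
Lemma net_controls w (s : R) : (forall f, in_net R f -> `|Q f w| <= s) ->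
  forall v : 'rV[R]_n,
    `|qform 1%:M (v *m rows_mx z w) - d%:R * qform 1%:M v| <= s * qform 1%:M v.
Proof.
move=> hs v; pose G := \matrix_(j, k) if k != j then dotv (z j w) (z k w) else 0.
have qG (x : 'rV[R]_n) : qform G x =
    \sum_j \sum_(k | k != j) x 0 j * x 0 k * dotv (z j w) (z k w).
  rewrite /qform mxE; under eq_bigr do rewrite mxE mulr_suml.
  rewrite exchange_big /=; apply: eq_bigr => j _.
  rewrite [RHS]big_mkcond /=; apply: eq_bigr => k _.
  by rewrite !mxE; case: eqVneq => _ /=; rewrite ?mulr0 ?mul0r // mulrAC.
have QG f : qform G (\row_j lattice_point R f j) = Q f w.
  rewrite qG; apply: eq_bigr => j _; apply: eq_bigr => k _.
  by rewrite !finset.in_setT !mxE.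
rewrite qform_rows_mx // addrAC subrr add0r -qG.
have [->|v0] := eqVneq v 0.
  have q0 (A : 'M[R]_n) : qform A (0 : 'rV[R]_n) = 0 by rewrite /qform !mul0mx mxE.
  by rewrite !q0 normr0 mulr0.
have q0 := qform1_gt0 v0.
pose c := Num.sqrt (qform 1%:M v); pose u := c^-1 *: v.
have c0 : 0 < c by rewrite sqrtr_gt0.
have cc : c ^+ 2 = qform 1%:M v by rewrite sqr_sqrtr // ltW.
have u1 : qform 1%:M u = 1 by rewrite qformZ exprVn cc mulVf // gt_eqF.
have qGu (A : 'M[R]_n) : qform A v = c ^+ 2 * qform A u.
  by rewrite -qformZ scalerA divff ?gt_eqF // scale1r.
rewrite qGu -cc [leLHS]normrM (ger0_norm (sqr_ge0 c)) mulrC ler_wpM2r ?sqr_ge0 //.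
have G0 i : G i i = 0 by rewrite mxE eqxx.
have GN i : (- G) i i = 0 by rewrite mxE G0 oppr0.
have [f [fN hf]] := qform_net_le n0 G0 u1.
have [f' [fN' hf']] := qform_net_le n0 GN u1.
have qN (x : 'rV[R]_n) : qform (- G) x = - qform G x.
  by rewrite /qform mulmxN mulNmx mxE.
rewrite !qN !QG in hf hf'.
have := hs _ fN; have := hs _ fN'; rewrite !ler_norml => /andP[a1 a2] /andP[b1 b2].
by apply/andP; split; lra.
Qed.

Lemma gram_deviation_prob (eps : R) : 0 <= eps ->
  let s := Num.max eps (eps ^+ 2) in
  exists A : set T, [/\ measurable A,
    forall w, A w -> forall v : 'rV[R]_n,
      `|qform 1%:M (v *m rows_mx z w) - d%:R * qform 1%:M v| <= s * d%:R * qform 1%:M v &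
    ((1 - 2 * ((2 ^+ 18) ^+ n * expR (- (8192^-1 / K ^+ 2 * (eps ^+ 2 * d%:R)))))%:E <= P A)%E].
Proof.
move=> eps0 s.
(* 8192%:R is a unary numeral, on which conversion is intractable. *)
have [c [c0 c512 c2048 ->]] : exists c : R,
    [/\ 0 < c, 512 * c = 8^-1, 2048 * c = 2^-1 & 8192^-1 = c / 2].
  by exists 4096^-1; split; [rewrite invr_gt0 ltr0n|field|field|field].
have s0 : 0 <= s by rewrite le_max eps0.
(* For s = 0 the asserted lower bound on the probability is negative, and the empty event will
   do. *)
have [sz|sn0] := eqVneq s 0.
  have -> : eps = 0 by apply/le_anti; rewrite eps0 andbT -sz le_max lexx.
  exists set0; split=> //; rewrite measure0 expr0n /= mul0r mulr0 oppr0 expR0 mulr1 lee_fin.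
  have : 1 <= (2 ^+ 18) ^+ n :> R by rewrite !exprn_ege1 // ler1n.
  lra.
have s_gt0 : 0 < s by rewrite lt_neqAle eq_sym sn0.
have K2 : 0 < K ^+ 2 by rewrite exprn_gt0.
(* Truncation at 1 keeps the parameter [l] in the admissible range, while s m = eps^2 in both
   regimes: a deviation of max(eps, eps^2) thus yields an exponent in eps^2. *)
pose m := Num.min s 1.
have m0 : 0 < m by rewrite lt_min s_gt0 ltr01.
have [m1 ms] : m <= 1 /\ m <= s by rewrite !ge_min !lexx orbT.
have sm : s * m = eps ^+ 2.
  rewrite /m /s; have [e1|e1] := leP eps 1.
    have e2 : eps ^+ 2 <= eps by rewrite expr2 ler_piMr.
    by rewrite (max_idPl e2) (min_idPl e1) expr2.
  have e2 : eps <= eps ^+ 2 by rewrite expr2 ler_peMr // ltW.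
  by rewrite (max_idPr e2) (min_idPr (le_trans (ltW e1) e2)) mulr1.
have [l lE] : exists l, l = c * m / K ^+ 2 by eexists.
have l0 : 0 < l by rewrite lE divr_gt0 // mulr_gt0.
have hl : 512 * K ^+ 2 * l <= 1.
  rewrite (_ : _ * l = 512 * c * m); last by rewrite lE; field; rewrite gt_eqF.
  rewrite c512; lra.
(* Chernoff and union bound in one function: where W < 1 every summand is below 1, which gives |Q f|
   < s d; elsewhere W >= 1, so Markov's inequality bounds the exceptional probability by the mean of
   [W]. *)
pose W w := \sum_(f | in_net R f)
  (expR (- (l * (s * d%:R))) * (expR (l * Q f w) + expR (- l * Q f w))).
have bE e f : bmeas (fun w => expR (e * Q f w)) by apply: bmeas_expR; exact: bmeasZ.
have bW : bmeas W.
  by apply: bmeas_sum => f _; apply: bmeasZ; exact: bmeasD.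
have W0 w : 0 <= W w.
  by apply: sumr_ge0 => f _; rewrite mulr_ge0 ?expR_ge0 // addr_ge0 ?expR_ge0.
pose A := [set w | W w < 1].
have mA : measurable A.
  rewrite (_ : A = W @^-1` `]-oo, 1[%classic); last by apply/seteqP; split => w; rewrite /= in_itv.
  by rewrite -[X in measurable X]setTI; case: bW => mW _; exact: mW.
exists A; split => // [w Aw|].
  apply: net_controls => f fN.
  have h : expR (- (l * (s * d%:R))) * (expR (l * Q f w) + expR (- l * Q f w)) < 1.
    apply: le_lt_trans Aw; rewrite /W (bigD1 f) //= lerDl; apply: sumr_ge0 => f' _.
    by rewrite mulr_ge0 ?expR_ge0 // addr_ge0 ?expR_ge0.
  rewrite mulrDr -!expRD in h.
  have h1 := expR_gt0 (- (l * (s * d%:R)) + l * Q f w).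
  have h2 := expR_gt0 (- (l * (s * d%:R)) + - l * Q f w).
  have h3 : - (l * (s * d%:R)) + l * Q f w < 0 by rewrite -ltr_expR expR0; lra.
  have h4 : - (l * (s * d%:R)) + - l * Q f w < 0 by rewrite -ltr_expR expR0; lra.
  rewrite addrC subr_lt0 in h3; rewrite [- l * _]mulNr -opprD oppr_lt0 in h4.
  rewrite ler_norml; apply/andP; split; rewrite -(ler_pM2l l0); last exact: ltW.
  by rewrite mulrN lerNl -subr_ge0 opprK ltW.
have EW : Ex P W <= 2 * ((2 ^+ 18) ^+ n * expR (- (c / 2 / K ^+ 2 * (eps ^+ 2 * d%:R)))).
  rewrite /W Ex_sum; last by move=> f _; apply: bmeasZ; exact: bmeasD.
  pose B : R := 8 * 64 ^+ n * expR (- (c / 2 / K ^+ 2 * (eps ^+ 2 * d%:R))).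
  apply: le_trans (_ : \sum_(f | in_net R f) B <= _).
    apply: ler_sum => f fN; rewrite ExZ; last exact: bmeasD.
    rewrite ExD //.
    have h1 := net_expR_le fN l0 hl (or_introl erefl).
    have h2 := net_expR_le fN l0 hl (or_intror erefl).
    apply: le_trans (_ : expR (- (l * (s * d%:R))) *
        (8 * 64 ^+ n * expR (2048 * K ^+ 2 * l ^+ 2 * d%:R)) <= _).
      by rewrite ler_wpM2l ?expR_ge0 //; lra.
    rewrite mulrCA /B ler_wpM2l ?mulr_ge0 ?exprn_ge0 // -expRD ler_expR.
    have -> : - (l * (s * d%:R)) + 2048 * K ^+ 2 * l ^+ 2 * d%:R =
        - (c / K ^+ 2 * (s * m * d%:R)) + 2048 * c * (c / K ^+ 2 * (m * m * d%:R)).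
      by rewrite lE; field; rewrite gt_eqF.
    rewrite c2048 sm.
    (* m <= s makes the quadratic term at most half of the linear one. *)
    have : c / K ^+ 2 * (m * m * d%:R) <= c / K ^+ 2 * (s * m * d%:R).
      by rewrite ler_wpM2l ?divr_ge0 ?(ltW K2) ?(ltW c0) // ler_wpM2r // ler_wpM2r // ltW.
    rewrite sm (_ : c / 2 / K ^+ 2 * _ = 2^-1 * (c / K ^+ 2 * (eps ^+ 2 * d%:R))); last by ring.
    lra.
  rewrite sumr_const -[_ *+ _]mulr_natl.
  have cN := card_net_le R n.
  have B0 : 0 <= B by rewrite mulr_ge0 ?expR_ge0 // mulr_ge0 // exprn_ge0.
  apply: le_trans (ler_wpM2r B0 cN) _; rewrite /B !mulrA ler_wpM2r ?expR_ge0 //.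
  (* The size of the net, the constant of the exponential moment, and a spare 4^n that absorbs the 4
     in 8 = 2 * 4. *)
  have -> : 2 ^+ 18 = 1024 * 64 * 4 :> R by ring.
  rewrite !exprMn.
  have h4 : 4 <= 4 ^+ n :> R by rewrite -{1}(expr1 4) ler_weXn2l ?ler1n.
  have aux (x y e : R) : 0 <= x -> 0 <= y -> 4 <= e -> x * 8 * y <= 2 * (x * y * e).
    move=> x0 y0 e4; rewrite (_ : x * 8 * y = 2 * (x * y * 4)); last by ring.
    by rewrite ler_wpM2l // ler_wpM2l // mulr_ge0.
  have n0R k : 0 <= k%:R ^+ n :> R by exact/exprn_ge0/ler0n.
  exact: (aux _ _ _ (n0R 1024%N) (n0R 64%N) h4).
have PC : P A = (1 - P (~` A))%E by rewrite -probability_setC ?setCK //; exact: measurableC.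
have mC : measurable (~` A) by exact: measurableC.
have : ((P (~` A)) <= (Ex P W)%:E)%E.
  rewrite EFin_Ex // -[X in P X]setIT -integral_indic //.
  apply: ge0_le_integral => //.
  - by apply/measurable_EFinP; exact: measurable_indic.
  - by apply/measurable_EFinP; case: bW.
  move=> w _; rewrite lee_fin indicE; case: (boolP (w \in ~` A)) => [|_ //].
  by rewrite inE /A /= => /negP; rewrite -leNgt.
move=> h; rewrite PC EFinB; apply: leeB => //.
by rewrite (le_trans h) // lee_fin.
Qed.

End GramDeviationProbability.

(** * Whitening *)

Section CountableApproximation.
Context {dsp : measure_display} {T : measurableType dsp} {R : realType}.

Lemma bigcup_countType_measurable (I : countType) (F : I -> set T) :
  (forall i, measurable (F i)) -> measurable (\bigcup_i F i).
Proof.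
move=> mF; rewrite (_ : \bigcup_i F i = \bigcup_k (if unpickle k is Some i then F i else set0)).
  by apply: bigcupT_measurable => k; case: unpickle => // i; exact: measurable0.
apply/seteqP; split => w [k _ Fk]; first by exists (pickle k) => //; rewrite pickleK.
by move: Fk; case: unpickle => // i Fi; exists i.
Qed.

Lemma rat_approx (x e : R) : 0 < e -> exists q : rat, `|x - ratr q| < e.
Proof.
move=> e0; have /rat_in_itvoo [q] : x - e < x + e by lra.
by rewrite in_itv /= => /andP[h1 h2]; exists q; rewrite ltr_norml; apply/andP; split; lra.
Qed.

(** Open sets generate the Borel sets, and each is the countable union of the rational boxes inside
    it; a box constrains every coordinate separately. *)
Lemma measurable_fun_cV d (f : T -> 'cV[R]_d) :
  (forall a, measurable_fun [set: T] (fun w => f w a 0)) ->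
  forall B, borel_cV B -> measurable (f @^-1` B).
Proof.
move=> mf B mB.
suff : <<s [set B : set 'cV[R]_d | open B] >> `<=` [set B | measurable (f @^-1` B)] by apply.
apply: smallest_sub => [|U oU /=].
  split => [|A mA|F mF] /=.
  - by rewrite preimage_set0; exact: measurable0.
  - by rewrite setTD preimage_setC; exact: measurableC.
  - by rewrite preimage_bigcup; exact: bigcupT_measurable.
pose box (qr : 'cV[rat]_d * rat) : set 'cV[R]_d :=
  [set v | forall a, `|v a 0 - ratr (qr.1 a 0)| < ratr qr.2].
pose ok qr := box qr `<=` U.
have -> : U = \bigcup_qr (if `[< ok qr >] then box qr else set0).
  apply/seteqP; split => [u Uu|u [qr _]]; last by case: asboolP => // h /h.
  have /nbhs_ballP [e /= e0 eU] : nbhs u U by exact: open_nbhs_nbhs.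
  have [r hr] : exists r : rat, e / 4 < ratr r < e / 2.
    have /rat_in_itvoo [r] : e / 4 < e / 2 by lra.
    by rewrite in_itv /= => hr; exists r.
  have r0 : 0 < ratr r :> R by case/andP: hr => h1 h2; lra.
  have [q hq] : exists q : 'cV[rat]_d, forall a, `|u a 0 - ratr (q a 0)| < ratr r.
    have /choice [q hq] : forall a, exists q : rat, `|u a 0 - ratr q| < ratr r.
      by move=> a; exact: rat_approx.
    by exists (\col_a q a) => a; rewrite mxE.
  exists (q, r) => //; case: asboolP => [_ //|]; case => v hv; apply: eU.
  rewrite /ball /= /mx_ball; split => // a b; rewrite (ord1 b).
  have := hq a; have := hv a; rewrite /= => h1 h2.
  rewrite -ball_normE /=; case/andP: hr => h3 h4.
  have := ler_normD (u a 0 - ratr (q a 0)) (ratr (q a 0) - v a 0).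
  rewrite addrA subrK (distrC (ratr _)); lra.
rewrite preimage_bigcup; apply: bigcup_countType_measurable => qr.
case: asboolP => _; last by rewrite preimage_set0; exact: measurable0.
rewrite (_ : f @^-1` box qr = \big[setI/setT]_(a < d)
    (fun w => f w a 0) @^-1` [set x | `|x - ratr (qr.1 a 0)| < ratr qr.2]).
  apply: bigsetI_measurable => a _; rewrite -[X in measurable X]setTI; apply: mf => //.
  rewrite (_ : [set x | _] = ball (ratr (qr.1 a 0) : R) (ratr qr.2)); first exact: measurable_ball.
  by apply/seteqP; split => x; rewrite -ball_normE /= distrC.
apply/seteqP; split => w /=.
  by move=> h; elim/big_ind: _ => // a _; exact: h.
by move=> h a; move: h; rewrite (bigD1 a) //= => -[].
Qed.

Lemma qform_le_entries d (A : 'M[R]_d) (v : 'rV[R]_d) :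
  qform A v <= (\sum_a \sum_b `|A a b|) * qform 1%:M v.
Proof.
rewrite /qform mxE mulr_suml; under eq_bigr do rewrite mxE mulr_suml.
rewrite exchange_big /=; apply: ler_sum => a _; rewrite mulr_suml; apply: ler_sum => b _.
rewrite [v^T _ _]mxE mulrC mulrA mulrC.
apply: le_trans (ler_norm _) _; rewrite normrM ler_wpM2l //.
have vq c : v 0 c ^+ 2 <= qform 1%:M v.
  by rewrite qform1E (bigD1 c) //= lerDl sumr_ge0 // => j _; exact: sqr_ge0.
rewrite ler_norml -/(qform 1%:M v); have := vq a; have := vq b.
have := sqr_ge0 (v 0 b - v 0 a); have := sqr_ge0 (v 0 b + v 0 a).
rewrite sqrrB sqrrD -mulr_natr; move=> h1 h2 h3 h4; apply/andP; split; lra.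
Qed.

Lemma lambda_lipschitz d (A B : 'M[R]_d) i : A^T = A -> B^T = B -> (0 < i <= d)%N ->
  lambda i A <= lambda i B + \sum_a \sum_b `|A a b - B a b|.
Proof.
move=> sA sB i0d; apply: lambda_le_perturb => // v.
have -> : qform A v = qform B v + qform (A - B) v.
  by rewrite -[in LHS](subrK B A) addrC /qform mulmxDr mulmxDl mxE addrC.
rewrite lerD2l; apply: le_trans (qform_le_entries _ _) _.
by under eq_bigr do under eq_bigr do rewrite !mxE.
Qed.

(* By Weyl's inequality, lambda i A < x iff lambda i B + |A - B|_1 < x for some
   symmetric rational matrix B. *)
Lemma measurable_lambda d (S : T -> 'M[R]_d) i : (0 < i <= d)%N ->
  (forall w, (S w)^T = S w) ->
  (forall a b, measurable_fun [set: T] (fun w => S w a b)) ->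
  measurable_fun [set: T] (fun w => lambda i (S w)).
Proof.
move=> i0d sS mS.
pose ev (B : 'M[rat]_d) : 'M[R]_d := map_mx ratr B.
pose dist (A B : 'M[R]_d) : R := \sum_a \sum_b `|A a b - B a b|.
have mdist B : measurable_fun [set: T] (fun w => dist (S w) B).
  apply: measurable_sum => a; apply: measurable_sum => b.
  by apply: measurableT_comp => //; apply: measurable_funB.
move=> mT; apply: (measurability _ (RGenInftyO.measurableE R)) => //.
move=> _ [_ [x ->] <-]; rewrite setTI.
rewrite (_ : _ @^-1` _ = \bigcup_(B : 'M[rat]_d)
    (if B^T == B then [set w | lambda i (ev B) + dist (S w) (ev B) < x] else set0)).
  apply: bigcup_countType_measurable => B; case: ifP => _; last exact: measurable0.
  rewrite (_ : [set w | _] = (fun w => lambda i (ev B) + dist (S w) (ev B)) @^-1` `]-oo, x[%classic).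
    rewrite -[X in measurable X]setTI.
    by apply: measurable_funD => //; exact: measurable_cst.
  by apply/seteqP; split => w; rewrite /= in_itv.
apply/seteqP; split => w /=; rewrite in_itv /=; last first.
  move=> [B _]; case: eqP => // sB h; apply: le_lt_trans h.
  by apply: lambda_lipschitz => //; rewrite /ev map_trmx sB.
move=> lx; pose e := (x - lambda i (S w)) / (4 * d%:R ^+ 2).
have d0 : 0 < d%:R :> R by rewrite ltr0n; case/andP: i0d; exact: leq_trans.
have e0 : 0 < e by rewrite divr_gt0 ?subr_gt0 // mulr_gt0 // exprn_gt0.
have /choice [q hq] : forall y : R, exists q : rat, `|y - ratr q| < e.
  by move=> y; exact: rat_approx.
pose B : 'M[rat]_d := map_mx q (S w).
have sB : B^T = B by rewrite /B map_trmx sS.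
exists B => //; rewrite sB eqxx /=.
have de : dist (S w) (ev B) <= (x - lambda i (S w)) / 4.
  have -> : (x - lambda i (S w)) / 4 = \sum_(a < d) \sum_(b < d) e.
    rewrite !sumr_const !card_ord -mulrnA -[e *+ _]mulr_natr natrM /e.
    by field; rewrite gt_eqF.
  by apply: ler_sum => a _; apply: ler_sum => b _; rewrite !mxE ltW.
have := lambda_lipschitz (A := ev B) (B := S w) (i := i).
rewrite /ev map_trmx sB sS => /(_ erefl erefl i0d) h.
have dd : \sum_a \sum_b `|ev B a b - S w a b| = dist (S w) (ev B).
  by apply: eq_bigr => a _; apply: eq_bigr => b _; rewrite distrC.
rewrite /ev in dd *; rewrite dd in h; rewrite /ev in de; lra.
Qed.

End CountableApproximation.

Section Whitening.
Context {dsp : measure_display} {T : measurableType dsp} {R : realType} {n d : nat}.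
Variables (P : probability T R) (X : T -> 'M[R]_(n, d)).
Hypotheses (n0 : (0 < n)%N) (nd : (n <= d)%N) (rd : random_design P X).

Definition root_cov : 'M[R]_d := sqrtmx (pop_cov P X).

Lemma ae_exists (Q : T -> Prop) : {ae P, forall w, Q w} -> exists w, Q w.
Proof.
move=> [A [mA PA0 QA]]; apply: contrapT => /forallNP nQ.
have : A = [set: T] by apply/seteqP; split => // w _; apply: QA; exact: nQ.
by move=> AT; move: PA0; rewrite AT (@probability_setT _ _ _ P) => /eqP; rewrite onee_eq0.
Qed.

Lemma enorm_sqrt (u : 'cV[R]_d) : enorm u = Num.sqrt d%:R <-> dotv u u = d%:R.
Proof.
split => [/(congr1 (fun x => x ^+ 2))|]; last by rewrite /enorm => ->.
by rewrite /enorm !sqr_sqrtr // dotv_ge0.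
Qed.

(* On a matrix without a positive semidefinite square root, [sqrtmx] is 0 and
   the whitened rows vanish, against [design_norm]. *)
Lemma root_cov_spec : psd root_cov /\ root_cov *m root_cov = pop_cov P X.
Proof.
have [SP|noS] := pselect (exists S : 'M[R]_d, psd S /\ S *m S = pop_cov P X).
  by rewrite /root_cov /sqrtmx; case: xgetP => [S' _ //|]; case: SP => S hS /(_ S).
have [w /enorm_sqrt] := ae_exists (design_norm rd (Ordinal n0)).
rewrite /whitened /sqrtmx xgetPN; last by move=> S hS; apply: noS; exists S.
have -> : invmx 0 = 0 :> 'M[R]_d.
  rewrite /invmx; case: ifP => // /mulmxV; rewrite mul0mx.
  move=> /matrixP /(_ (Ordinal (leq_trans n0 nd)) (Ordinal (leq_trans n0 nd))).
  by rewrite !mxE eqxx => /esym/eqP; rewrite oner_eq0.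
rewrite mul0mx /dotv big1 => [/esym/eqP|j _]; last by rewrite mxE mul0r.
by rewrite pnatr_eq0 eqn0Ngt (leq_trans n0 nd).
Qed.

Lemma root_cov_unit : root_cov \in unitmx.
Proof.
have := design_invertible rd; case: root_cov_spec => _ <-.
by rewrite unitmx_mul => /andP[].
Qed.

Lemma root_cov_sym : root_cov^T = root_cov.
Proof. by case: root_cov_spec => [[]]. Qed.

Lemma pop_cov_psd : psd (pop_cov P X).
Proof.
case: root_cov_spec => _ <-; rewrite -{1}root_cov_sym; exact: psd_gram.
Qed.

(* The whitened rows have norm sqrt d only almost surely; the exceptional
   values are sent to a vector of norm sqrt d. *)
Definition normalize (u : 'cV[R]_d) : 'cV[R]_d :=
  let v := invmx root_cov *m u in if dotv v v == d%:R then v else const_mx 1.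

Definition white (k : 'I_n) (w : T) : 'cV[R]_d := normalize (rowvec X k w).

Lemma dotv_normalize u : dotv (normalize u) (normalize u) = d%:R.
Proof.
rewrite /normalize; case: eqP => // _; rewrite /dotv.
by under eq_bigr do rewrite !mxE mulr1; rewrite sumr_const card_ord.
Qed.

Let cT := g_sigma_algebraType [set B : set 'cV[R]_d | open B].

Lemma measurable_coord (a : 'I_d) : measurable_fun [set: cT] (fun u : cT => (u : 'cV[R]_d) a 0).
Proof. by move=> _ B mB; rewrite setTI; exact: borel_cV_coord. Qed.

Lemma bmeas_normalize a : bmeas (fun u : cT => normalize u a 0).
Proof.
split.
  pose v (u : cT) b := \sum_c invmx root_cov b c * (u : 'cV[R]_d) c 0.
  have mv b : measurable_fun [set: cT] (fun u => v u b).
    by apply: measurable_sum => c; apply: measurable_funM => //; exact: measurable_coord.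
  rewrite (_ : (fun u => _) = fun u => if \sum_b v u b * v u b == d%:R then v u a else 1).
    apply: measurable_fun_ifT => //; apply: measurable_fun_eqr => //.
    by apply: measurable_sum => b; exact: measurable_funM.
  apply/funext => u; rewrite /normalize /dotv.
  rewrite (_ : \sum_j _ = \sum_b v u b * v u b); last by apply: eq_bigr => b _; rewrite !mxE.
  by case: ifP; rewrite mxE.
exists (Num.sqrt d%:R) => u; rewrite -sqrtr_sqr ler_wsqrtr //.
rewrite -(dotv_normalize u) /dotv (bigD1 a) //= -expr2 lerDl.
by apply: sumr_ge0 => b _; rewrite -expr2 sqr_ge0.
Qed.

Lemma normalize_borel B : borel_cV B -> borel_cV (normalize @^-1` B).
Proof.
by apply: (@measurable_fun_cV _ cT) => a; case: (bmeas_normalize a).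
Qed.

Lemma rowvec_measurable k B : borel_cV B -> measurable (rowvec X k @^-1` B).
Proof.
apply: measurable_fun_cV => a; rewrite /rowvec.
by under [X in measurable_fun _ X]funext do rewrite !mxE; exact: (design_measurable rd).
Qed.

Lemma white_measurable k B : borel_cV B -> measurable (white k @^-1` B).
Proof. by move=> mB; exact: (rowvec_measurable k (normalize_borel mB)). Qed.

Lemma white_independent : independent_vectors P white.
Proof.
move=> J B mB; apply: (design_independent rd (B := fun k => normalize @^-1` B k)).
by move=> k kJ; apply: normalize_borel; exact: mB.
Qed.

Lemma white_norm k w : dotv (white k w) (white k w) = d%:R.
Proof. exact: dotv_normalize. Qed.

Lemma ae_white : {ae P, forall w, forall k, white k w = whitened P X k w}.
Proof.
apply: filter_forall => k; apply: filterS (design_norm rd k) => w /enorm_sqrt wd.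
by rewrite /white /normalize -/(whitened P X k w) wd eqxx.
Qed.

Lemma ae_rows_mx : {ae P, forall w, X w = rows_mx white w *m root_cov}.
Proof.
apply: filterS ae_white => w ww; apply/row_matrixP => k.
rewrite row_mul; have -> : row k (rows_mx white w) = (white k w)^T.
  by apply/rowP => a; rewrite !mxE.
rewrite ww /whitened -/root_cov trmx_mul trmx_inv root_cov_sym mulmxKV ?root_cov_unit //.
by rewrite /rowvec trmxK.
Qed.

Lemma bmx_white k : bmx (white k).
Proof.
apply: (bmx_block white_measurable (J := [set k]%SET)).
by apply: (bmx_vector white_norm); rewrite finset.in_set1.
Qed.

Lemma white_identical k l a b : Ex P (fun w => white k w a 0 * white k w b 0) =
  Ex P (fun w => white l w a 0 * white l w b 0).
Proof.
have mr i : measurable_fun [set: T] (rowvec X i : T -> cT).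
  by move=> _ B mB; rewrite setTI; exact: rowvec_measurable.
pose r i : {mfun T >-> cT} :=
  HB.pack (rowvec X i : T -> cT) (isMeasurableFun.Build _ _ _ _ _ (mr i)).
pose f (u : cT) := normalize u a 0 * normalize u b 0.
have bf : bmeas f by apply: bmeasM; exact: bmeas_normalize.
rewrite -[LHS]/(Ex P (f \o r k)) -[RHS]/(Ex P (f \o r l)) -!Ex_distribution //.
apply: EFin_inj; rewrite !EFin_Ex //; apply: eq_measure_integral => A mA _.
exact: (design_identical rd).
Qed.

(** Built from the modified rows: almost surely equal to [sample_cov], but bounded everywhere. *)
Definition white_cov w : 'M[R]_d :=
  n%:R^-1 *: ((rows_mx white w *m root_cov)^T *m (rows_mx white w *m root_cov)).

Lemma ae_sample_cov : {ae P, forall w, sample_cov X w = white_cov w}.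
Proof. by apply: filterS ae_rows_mx => w Xw; rewrite /sample_cov Xw. Qed.

Lemma bmx_rows_white : bmx (rows_mx white).
Proof. by move=> k a; under [X in bmeas X]funext do rewrite mxE; exact: bmx_white. Qed.

Lemma bmx_white_cov : bmx white_cov.
Proof.
move=> a b; under [X in bmeas X]funext do rewrite mxE.
apply: bmeasZ; have bY : bmx (fun w => rows_mx white w *m root_cov).
  by apply: bmx_mul; [exact: bmx_rows_white|exact: bmx_cst].
by apply: bmx_mul => //; exact: bmx_tr.
Qed.

Lemma measurable_sample_cov a b : measurable_fun [set: T] (fun w => sample_cov X w a b).
Proof. by apply/measurable_EFinP; exact: (measurable_int P (design_integrable rd a b)). Qed.

Lemma pop_covE a b : pop_cov P X a b = Ex P (fun w => white_cov w a b).
Proof.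
rewrite mxE unlock /Ex /Rintegral; congr fine; apply: ae_eq_integral => //.
- by apply/measurable_EFinP; exact: measurable_sample_cov.
- by apply/measurable_EFinP; case: (bmx_white_cov a b).
- by apply: filterS ae_sample_cov => w ->.
Qed.

(** The covariance only records an average over the rows. As all rows have the same second moments
    [E], it equals S E S with [S] the root; comparison with S S and invertibility of [S] give
    [E = 1%:M]. *)
Lemma white_isotropic k a b : Ex P (fun w => white k w a 0 * white k w b 0) = (a == b)%:R.
Proof.
pose E : 'M[R]_d := \matrix_(a, b) Ex P (fun w => white k w a 0 * white k w b 0).
suff /matrixP/(_ a b) : E = 1%:M by rewrite !mxE.
have SES : root_cov *m E *m root_cov = root_cov *m root_cov.
  apply/matrixP => i j; case: root_cov_spec => _ ->; rewrite pop_covE.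
  have bw l c e : bmeas (fun w => white l w c 0 * white l w e 0).
    by apply: bmeasM; exact: bmx_white.
  have -> : (fun w => white_cov w i j) = fun w => \sum_l \sum_c \sum_e
      (n%:R^-1 * (root_cov i c * root_cov e j)) * (white l w c 0 * white l w e 0).
    apply/funext => w; rewrite !mxE mulr_sumr; apply: eq_bigr => l _.
    rewrite !mxE big_distrlr mulr_sumr /=; apply: eq_bigr => c _; rewrite mulr_sumr.
    apply: eq_bigr => e _; rewrite !mxE -{1}root_cov_sym mxE; ring.
  rewrite Ex_sum => [|l _]; last first.
    by apply: bmeas_sum => c _; apply: bmeas_sum => e _; exact: bmeasZ.
  rewrite (eq_bigr (fun=> n%:R^-1 * (root_cov *m E *m root_cov) i j)) => [|l _].
    rewrite sumr_const card_ord -[_ *+ n]mulr_natl mulrA mulfV ?mul1r //.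
    by rewrite pnatr_eq0 -lt0n.
  rewrite Ex_sum => [|c _]; last by apply: bmeas_sum => e _; exact: bmeasZ.
  rewrite mxE; under [in RHS]eq_bigr do rewrite mxE mulr_suml.
  rewrite exchange_big mulr_sumr; apply: eq_bigr => c _.
  rewrite Ex_sum => [|e _]; last exact: bmeasZ.
  rewrite mulr_sumr; apply: eq_bigr => e _.
  by rewrite ExZ // (white_identical l k) mxE; ring.
have U := root_cov_unit.
by rewrite -(mulKmx U E) -(mulmxK U (root_cov *m E)) SES mulmxK ?mulVmx.
Qed.

End Whitening.

(** * Moments of the whitened rows and eigenvalues of the sample covariance *)

Section WhiteningConsequences.
Context {dsp : measure_display} {T : measurableType dsp} {R : realType} {n d : nat}.
Variables (P : probability T R) (X : T -> 'M[R]_(n, d)).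
Hypotheses (n0 : (0 < n)%N) (nd : (n <= d)%N) (rd : random_design P X).

Notation z := (white P X).
Let d0 : (0 < d)%N := leq_trans n0 nd.

Lemma powR_norm_even (x : R) m : `|x| `^ (2 * m)%:R = x ^+ (2 * m).
Proof. by rewrite powR_mulrn // -normrX ger0_norm // exprM exprn_ge0 // sqr_ge0. Qed.

Lemma measurable_whitened k u :
  measurable_fun [set: T] (fun w => dotv (whitened P X k w) u).
Proof.
apply: measurable_sum => a; apply: measurable_funM => //.
under [X in measurable_fun _ X]funext do rewrite mxE.
apply: measurable_sum => b; apply: measurable_funM => //.
by under [X in measurable_fun _ X]funext do rewrite !mxE; exact: (design_measurable rd).
Qed.

Let bz k u : bmeas (fun w => dotv (z k w) u).
Proof. by apply: bmeas_dotv; [exact: bmx_white|exact: bmx_cst]. Qed.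

(** For an even exponent the power of the absolute value is a polynomial, bounded on the modified
    rows; this is the passage from extended norms to [Ex]. *)
Lemma Lnorm_whitened k u m : (0 < m)%N ->
  ('N[P]_(((2 * m)%:R : R)%:E)[(fun w => (dotv (whitened P X k w) u)%:E)] `^ (2 * m)%:R)%E =
  (Ex P (fun w => dotv (z k w) u ^+ (2 * m)))%:E.
Proof.
move=> m0; rewrite poweR_Lnorm; last by rewrite pnatr_eq0 muln_eq0 negb_or /= -lt0n.
rewrite EFin_Ex; last exact: bmeasX.
apply: ae_eq_integral => //.
- rewrite (_ : (fun w => _) = EFin \o (fun w => dotv (whitened P X k w) u ^+ (2 * m))).
    by apply/measurable_EFinP; apply: measurable_funX; exact: measurable_whitened.
  by apply/funext => w; rewrite /= powR_norm_even.
- by apply/measurable_EFinP; case: (bmeasX (2 * m) (bz k u)).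
- by apply: filterS (ae_white rd) => w ww _ /=; rewrite powR_norm_even ww.
Qed.

Lemma moment_of_Lnorm (m : nat) (M : R) : (0 < m)%N -> 0 <= M ->
  (forall k u, sphere R d u ->
    ('N[P]_(((2 * m)%:R : R)%:E)[(fun w => (dotv (whitened P X k w) u)%:E)] <= M%:E)%E) ->
  forall k u, Ex P (fun w => dotv (z k w) u ^+ (2 * m)) <= M ^+ (2 * m) * dotv u u ^+ m.
Proof.
move=> m0 M0 hM k u.
have [u0|u0] := eqVneq (dotv u u) 0.
  have -> : u = 0.
    apply/colP => a; rewrite mxE; apply/eqP; rewrite -sqrf_eq0 expr2; apply/eqP.
    have /psumr_eq0P -> // : \sum_j u j 0 * u j 0 = 0 by exact: u0.
    by move=> j _; rewrite -expr2 sqr_ge0.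
  rewrite (_ : (fun w => _) = fun=> 0).
    by rewrite Ex_cst mulr_ge0 ?exprn_ge0 ?dotv_ge0.
  apply/funext => w; rewrite /dotv big1 => [|j _]; last by rewrite mxE mulr0.
  by rewrite expr0n muln_eq0 /= gtn_eqF.
have ug : 0 < dotv u u by rewrite lt_neqAle eq_sym u0 dotv_ge0.
pose s := Num.sqrt (dotv u u); have s0 : 0 < s by rewrite sqrtr_gt0.
have s2 : s ^+ 2 = dotv u u by rewrite sqr_sqrtr // ltW.
have dZ (y : 'cV[R]_d) c v : dotv y (c *: v) = c * dotv y v by rewrite dotvC dotvZl dotvC.
pose v := s^-1 *: u.
have vS : sphere R d v.
  rewrite /sphere /= /enorm dotvZl dZ mulrA -invfM -expr2 s2 mulVf ?sqrtr1 //.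
have uE : u = s *: v by rewrite scalerA mulfV ?scale1r // gt_eqF.
have := gt0_ler_poweR (ler0n R (2 * m)) _ _ (hM k v vS).
rewrite !in_itv /= !leey lee_fin M0 Lnorm_ge0 => /(_ erefl erefl).
rewrite Lnorm_whitened // powR_mulrn // lee_fin => h.
rewrite (_ : (fun w => _) = fun w => s ^+ (2 * m) * dotv (z k w) v ^+ (2 * m)).
  have sm : s ^+ (2 * m) = dotv u u ^+ m by rewrite exprM s2.
  rewrite ExZ; last exact: bmeasX.
  by rewrite mulrC sm; apply: ler_wpM2r => //; apply: exprn_ge0; exact: ltW.
by apply/funext => w; rewrite {1}uE dZ exprMn.
Qed.

Lemma Lnorm_whitened_le k u m : (0 < m)%N -> sphere R d u ->
  ('N[P]_(((2 * m)%:R : R)%:E)[(fun w => (dotv (whitened P X k w) u)%:E)] <= (Num.sqrt d%:R)%:E)%E.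
Proof.
move=> m0 uS.
have m2 : (2 * m)%:R != 0 :> R by rewrite pnatr_eq0 muln_eq0 negb_or /= -lt0n.
have u1 : dotv u u = 1.
  by move: uS; rewrite /sphere /= /enorm => /(congr1 (fun x => x ^+ 2)); rewrite sqr_sqrtr ?dotv_ge0 ?expr1n.
set N := 'N[P]_ _ [ _ ]%E.
have -> : N = (N `^ ((2 * m)%:R * (2 * m)%:R^-1))%E by rewrite mulfV // poweRe1 // Lnorm_ge0.
rewrite poweRrM /N Lnorm_whitened //.
rewrite poweR_EFin lee_fin.
have s0 : 0 <= Num.sqrt d%:R :> R by exact: sqrtr_ge0.
have -> : Num.sqrt d%:R = (Num.sqrt d%:R ^+ (2 * m)) `^ ((2 * m)%:R^-1) :> R.
  by rewrite -powR_mulrn // -powRrM mulfV // powRr1.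
apply: ge0_ler_powR; rewrite ?nnegrE ?invr_ge0 ?exprn_ge0 //.
  by apply: Ex_ge0 => w; rewrite exprM exprn_ge0 // sqr_ge0.
rewrite -[leRHS](Ex_cst P); apply: Ex_le => [||w]; [exact: bmeasX|exact: bmeas_cst|].
rewrite exprM [leRHS]exprM sqr_sqrtr // lerXn2r ?nnegrE ?sqr_ge0 //.
have [c cE] : exists c, c = dotv (z k w) u by eexists.
rewrite -cE; have : 0 <= \sum_j (z k w j 0 - c * u j 0) ^+ 2.
  by apply: sumr_ge0 => j _; exact: sqr_ge0.
have -> : \sum_j (z k w j 0 - c * u j 0) ^+ 2 =
    dotv (z k w) (z k w) - 2 * c * dotv (z k w) u + c ^+ 2 * dotv u u.
  rewrite /dotv !mulr_sumr -sumrB -big_split; apply: eq_bigr => j _ /=; ring.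
by rewrite white_norm u1 -cE; lra.
Qed.

(** The bound sqrt(d) of [Lnorm_whitened_le] makes [max_moment] finite, so that [fine] loses
    nothing. *)
Lemma max_moment_fin m k u : (0 < m)%N -> sphere R d u ->
  ('N[P]_(((2 * m)%:R : R)%:E)[(fun w => (dotv (whitened P X k w) u)%:E)] <=
   (fine (max_moment P (whitened P X) (2 * m)))%:E)%E.
Proof.
move=> m0 uS; set N := 'N[P]_ _ [ _ ]%E; set mm := max_moment _ _ _.
have Nmm : (N <= mm)%E.
  rewrite /mm /max_moment (bigD1 k) //= le_max; apply/orP; left.
  by apply: ereal_sup_ubound; exists u.
have mmd : (mm <= (Num.sqrt d%:R)%:E)%E.
  rewrite /mm /max_moment; elim/big_ind: _ => [|x y hx hy|i _]; first exact: leNye.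
    by rewrite ge_max hx.
  by apply: ge_ereal_sup => _ [v vS <-]; exact: Lnorm_whitened_le.
rewrite fineK // fin_numE; apply/andP; split.
  by rewrite gt_eqF // (lt_le_trans _ Nmm) // (lt_le_trans _ (Lnorm_ge0 _ _ _)).
by rewrite lt_eqF // (le_lt_trans mmd) // ltry.
Qed.

Lemma white_cov_le i (w : T) (s : R) : (0 < i <= n)%N -> 0 < 1 + s ->
  (forall v : 'rV[R]_n, qform 1%:M (v *m rows_mx z w) <= d%:R * (1 + s) * qform 1%:M v) ->
  n%:R / d%:R * lambda i (white_cov P X w) <= lambda i (pop_cov P X) * (1 + s).
Proof.
move=> /andP[i0 i_n] s0 h.
have dR : 0 < d%:R :> R by rewrite ltr0n.
have nR : 0 < n%:R :> R by rewrite ltr0n.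
have [pr rr] := root_cov_spec n0 nd rd.
have := lambda_sandwich_le (i := i) (c := n%:R^-1) (pop_cov_psd n0 nd rd) (design_invertible rd) rr pr.
move=> /(_ _ _ (d%:R * (1 + s))) => H.
rewrite -ler_pdivlMl ?divr_gt0 //.
have := H n (rows_mx z w); rewrite invr_ge0 ltW // mulr_gt0 // i0 (leq_trans i_n nd).
move=> /(_ erefl erefl erefl h) hh; apply: le_trans hh _.
by rewrite le_eqVlt; apply/orP; left; apply/eqP; field; rewrite !gt_eqF.
Qed.

Lemma white_cov_ge i (w : T) (s : R) : (0 < i <= n)%N ->
  (forall v : 'rV[R]_n, d%:R * (1 - s) * qform 1%:M v <= qform 1%:M (v *m rows_mx z w)) ->
  lambda (i + d - n) (pop_cov P X) * (1 - s) <= n%:R / d%:R * lambda i (white_cov P X w).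
Proof.
move=> i0n h.
have dR : 0 < d%:R :> R by rewrite ltr0n.
have nR : 0 < n%:R :> R by rewrite ltr0n.
have [pr rr] := root_cov_spec n0 nd rd.
have n1 : 0 <= n%:R^-1 :> R by rewrite invr_ge0 ltW.
have hh := lambda_sandwich_ge (pop_cov_psd n0 nd rd) (design_invertible rd) rr pr n1 i0n nd h.
rewrite -ler_pdivrMl ?divr_gt0 //; apply: le_trans _ hh.
by rewrite le_eqVlt; apply/orP; left; apply/eqP; field; rewrite !gt_eqF.
Qed.

Lemma gram_psd (Y : 'M[R]_(n, d)) : psd (n%:R^-1 *: (Y^T *m Y)).
Proof.
have /psdP [sY hY] := psd_gram Y; apply/psdP; split => [|v]; first by rewrite linearZ /= sY.
by rewrite /qform -scalemxAr -scalemxAl mxE mulr_ge0 ?invr_ge0 //; exact: hY.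
Qed.

Lemma measurable_lambda_sample_cov i : (0 < i <= n)%N ->
  measurable_fun [set: T] (fun w => lambda i (sample_cov X w)).
Proof.
move=> /andP[i0 i_n]; apply: measurable_lambda => [|w|a b].
- by rewrite i0 (leq_trans i_n).
- by case: (gram_psd (X w)).
- exact: (measurable_sample_cov rd).
Qed.

Lemma measurable_lambda_white_cov i : (0 < i <= n)%N ->
  measurable_fun [set: T] (fun w => lambda i (white_cov P X w)).
Proof.
move=> /andP[i0 i_n]; apply: measurable_lambda => [|w|a b].
- by rewrite i0 (leq_trans i_n).
- by case: (gram_psd (rows_mx z w *m root_cov P X)).
- by case: (bmx_white_cov rd a b).
Qed.

End WhiteningConsequences.

(** * Eigenvalue bounds for sub-gaussian rows *)

Section SubgaussianDesign.
Context {dsp : measure_display} {T : measurableType dsp} {R : realType} {n d : nat}.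
Variables (P : probability T R) (X : T -> 'M[R]_(n, d)).
Hypotheses (n0 : (0 < n)%N) (nd : (n <= d)%N) (rd : random_design P X).

(** The exponent p = 2m in the supremum gives the norm bound sqrt(2m) K on the unit sphere. *)
Lemma psi2_moment (K : R) :
  (\big[maxe/-oo]_(k < n) psi2_norm P (whitened P X k) <= K%:E)%E -> 0 <= K ->
  forall k u m, (0 < m)%N ->
  Ex P (fun w => dotv (white P X k w) u ^+ (2 * m)) <= (2 * m%:R * (K ^+ 2 * dotv u u)) ^+ m.
Proof.
move=> hK K0 k u m m0.
have m2 : 0 < (2 * m)%:R :> R by rewrite ltr0n muln_gt0.
have h : 0 <= Num.sqrt (2 * m)%:R * K by rewrite mulr_ge0 // sqrtr_ge0.
apply: le_trans (moment_of_Lnorm rd m0 h _ k u) _ => [l v vS|].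
  have hl : (psi2_norm P (whitened P X l) <= K%:E)%E.
    by apply: le_trans hK; rewrite (bigD1 l) //= le_max lexx.
  rewrite EFinM -lee_pdivrMl ?sqrtr_gt0 //; apply: le_trans hl.
  apply: ereal_sup_ubound; exists v, (2 * m)%:R; split => //.
  by rewrite ler1n muln_gt0.
rewrite exprM [(_ * _) ^+ 2]exprMn sqr_sqrtr ?(ltW m2) // -exprMn natrM.
by rewrite le_eqVlt; apply/orP; left; apply/eqP; congr (_ ^+ m); ring.
Qed.

Lemma measurable_all_eigenvalues (a b : nat -> R) (e : R) :
  measurable [set w | forall i : nat, (1 <= i <= n)%N ->
    a i <= e * lambda i (sample_cov X w) <= b i].
Proof.
pose F i := [set w | a i <= e * lambda i (sample_cov X w) <= b i].
have : measurable (\bigcap_(i in [set i | (1 <= i <= n)%N]) F i); last exact.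
apply: bigcap_measurable; first by exists 1%N; rewrite /= n0.
move=> i i0n; rewrite (_ : F i = (fun w => e * lambda i (sample_cov X w)) @^-1` `[a i, b i]%classic).
  rewrite -[X in measurable X]setTI; apply: measurable_funM => //.
  exact: (measurable_lambda_sample_cov nd rd).
by apply/seteqP; split => w; rewrite /F /= in_itv.
Qed.

Lemma subgaussian_eigenvalues (K : R) :
  (\big[maxe/-oo]_(k < n) psi2_norm P (whitened P X k) <= K%:E)%E -> 0 < K ->
  forall eps, 0 <= eps ->
  ((1 - 2 * ((2 ^+ 18) ^+ n * expR (- (8192^-1 / K ^+ 2 * (eps ^+ 2 * d%:R)))))%:E <=
   P [set w | forall i : nat, (1 <= i <= n)%N ->
     (lambda (i + d - n) (pop_cov P X) * (1 - Num.max eps (eps ^+ 2))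
       <= n%:R / d%:R * lambda i (sample_cov X w)
       <= lambda i (pop_cov P X) * (1 + Num.max eps (eps ^+ 2)))%R])%E.
Proof.
move=> hK K0 eps eps0.
have [A [mA hA PA]] := gram_deviation_prob (white_measurable rd) (white_independent rd)
  (white_norm P X) K0 (psi2_moment hK (ltW K0)) n0 eps0.
set s := Num.max eps (eps ^+ 2) in hA *; set G := [set w | _].
have s0 : 0 <= s by rewrite le_max eps0.
have [N [mN PN0 hN]] := ae_sample_cov n0 nd rd.
have mG : measurable G by exact: measurable_all_eigenvalues.
(* The null set where sample covariance and modified covariance differ is removed from [A] at no
   cost in probability. *)
apply: le_trans PA _; apply: le_trans (_ : P (A `\` N) <= _)%E; last first.
  apply: le_measure; rewrite ?inE //; first exact: measurableD.
  move=> w [Aw Nw] i i0n.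
  have -> : sample_cov X w = white_cov P X w by apply: contrapT => h; apply: Nw; exact: hN.
  have hv v := hA w Aw v.
  rewrite (white_cov_ge n0 nd rd (w := w)) // ?(white_cov_le n0 nd rd (w := w)) //.
  - by rewrite ltr_pwDl.
  - by move=> v; have := hv v; rewrite ler_norml => /andP[_]; lra.
  - by move=> v; have := hv v; rewrite ler_norml => /andP[+ _]; lra.
have -> : P A = (P (A `&` N) + P (A `\` N))%E.
  by rewrite addeC [in LHS](measureDI _ mA mN).
suff -> : P (A `&` N) = 0%E by rewrite add0e.
apply/eqP; rewrite -measure_le0 -PN0.
by apply: le_measure; rewrite ?inE //; exact: measurableI.
Qed.

End SubgaussianDesign.

(** Here eps^2 d = (K sqrt(N/h) sqrt(n) + t)^2. Dropping the cross term leaves an exponent of at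
    least N n + (h/K^2) t^2, whose first part cancels N^n because N <= e^N. This determines the
    constant C_K. *)
Lemma subgaussian_tail (R : realType) (N h K : R) (n d : nat) (t eps : R) :
  0 < N -> 0 < h -> 0 < K -> (0 < d)%N -> 0 <= t ->
  eps = K * Num.sqrt (N / h) * Num.sqrt (n%:R / d%:R) + t / Num.sqrt d%:R ->
  N ^+ n * expR (- (h / K ^+ 2 * (eps ^+ 2 * d%:R))) <= expR (- (h / K ^+ 2 * t ^+ 2)).
Proof.
move=> N0 h0 K0 d0 t0 epsE'.
have dR : 0 < d%:R :> R by rewrite ltr0n.
have D0 : 0 < Num.sqrt d%:R :> R by rewrite sqrtr_gt0.
have c0 : 0 < h / K ^+ 2 by rewrite divr_gt0 // exprn_gt0.
pose r := Num.sqrt (N / h); pose q := Num.sqrt n%:R : R.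
have r2 : r ^+ 2 = N / h by rewrite sqr_sqrtr // ltW // divr_gt0.
have q2 : q ^+ 2 = n%:R by rewrite sqr_sqrtr.
have r0 : 0 <= r by exact: sqrtr_ge0.
have q0 : 0 <= q by exact: sqrtr_ge0.
have epsE : eps ^+ 2 * d%:R = (K * r * q + t) ^+ 2.
  rewrite epsE' -/r [Num.sqrt (n%:R / _)]sqrtrM // -/q sqrtrV //.
  rewrite (_ : K * r * q + t = (K * r * (q / Num.sqrt d%:R) + t / Num.sqrt d%:R) * Num.sqrt d%:R).
    by rewrite exprMn sqr_sqrtr.
  by field; rewrite gt_eqF.
have le1 : N * n%:R + h / K ^+ 2 * t ^+ 2 <= h / K ^+ 2 * (eps ^+ 2 * d%:R).
  have -> : N * n%:R = h / K ^+ 2 * (K ^+ 2 * r ^+ 2 * q ^+ 2).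
    by rewrite r2 q2; field; rewrite !gt_eqF.
  rewrite -mulrDr epsE ler_wpM2l ?(ltW c0) //.
  have : 0 <= K * r * q * t by rewrite !mulr_ge0 // ltW.
  have [x xE] : exists x, x = K * r * q by eexists.
  rewrite -!exprMn -xE => xt.
  rewrite sqrrD -[_ *+ 2]mulr_natl; lra.
apply: le_trans (_ : N ^+ n * expR (- (N * n%:R) - h / K ^+ 2 * t ^+ 2) <= _).
  by rewrite ler_wpM2l ?exprn_ge0 ?(ltW N0) // ler_expR; lra.
rewrite expRD mulrA ger_pMl ?expR_gt0 // expRN expRM_natr.
rewrite ler_pdivrMr ?exprn_gt0 ?expR_gt0 // mul1r lerXn2r ?nnegrE ?expR_ge0 ?(ltW N0) //.
by apply: le_trans (expR_ge1Dx N); rewrite lerDr.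
Qed.

(** * Choice of the moment and eigenvalue bounds in expectation *)

Section MomentChoice.
Variable R : realType.

Lemma ln2_ge : 2^-1 <= ln 2 :> R.
Proof.
rewrite -[leLHS](@expRK R) ler_ln ?posrE ?expR_gt0 //.
have := @expR1_le4 R; have h := expR_gt0 (2^-1 : R).
have -> : expR 1 = expR 2^-1 * expR 2^-1 :> R by rewrite -expRD; congr expR; lra.
by nra.
Qed.

(** p/ln(p+1) is increasing up to a constant: from q to p the logarithm grows by at most p/q - 1,
    and ln(q+1) >= 1/2. *)
Lemma log_ratio_le q p : (0 < q)%N -> (q <= p)%N -> log_ratio R q <= 3 * log_ratio R p.
Proof.
move=> q0 qp; have p0 := leq_trans q0 qp.
have qR : 0 < q%:R :> R by rewrite ltr0n.
have pR : 0 < p%:R :> R by rewrite ltr0n.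
have qp' : q%:R <= p%:R :> R by rewrite ler_nat.
have lq := ln_succ_gt0 R q0; have lp := ln_succ_gt0 R p0.
rewrite /log_ratio ler_pdivrMr // mulrAC mulrA ler_pdivlMr //.
have lq2 : 2^-1 <= ln (q%:R + 1) :> R.
  apply: le_trans ln2_ge _; rewrite ler_ln ?posrE ?addr_gt0 // -natr1.
  by rewrite lerD2r ler1n.
have : ln (p%:R + 1) <= ln (q%:R + 1) + (p%:R / q%:R - 1) :> R.
  rewrite -lerBlDl -ln_div ?posrE ?addr_gt0 //.
  apply: le_trans (_ : ln (p%:R / q%:R) <= _).
    rewrite ler_ln ?posrE ?divr_gt0 ?addr_gt0 // ler_pdivrMr ?addr_gt0 //.
    rewrite mulrAC ler_pdivlMr //; nra.
  rewrite -[X in ln X](subrK 1) addrC; apply: le_ln1Dx.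
  by rewrite ltrBrDl subrr divr_gt0.
move=> h; have := ler_wpM2l (ltW qR) h.
rewrite mulrDr mulrBr mulrCA mulfV ?gt_eqF // !mulr1 => h2.
by apply: le_trans h2 _; nra.
Qed.

(* For p > log n the factor n^(1/p) is bounded, and q is about log n. *)
Lemma moment_choice (n p : nat) (a : R) : (1 < n)%N -> (0 < p)%N -> 0 <= a ->
  exists q, [/\ (0 < q)%N, (q <= p)%N &
    168 * log_ratio R q * q%:R * (n%:R `^ q%:R^-1 * Num.max n%:R (n%:R `^ q%:R^-1 * a)) <=
    168 * 144 * (log_ratio R p * n%:R `^ p%:R^-1 * Num.max n%:R (n%:R `^ p%:R^-1 * a) * ln n%:R)].
Proof.
move=> n1 p0 a0; pose l : R := ln n%:R.
have n1R : 1 <= n%:R :> R by rewrite ler1n ltnW.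
have l1 : 2^-1 <= l.
  by apply: le_trans ln2_ge _; rewrite ler_ln ?posrE ?ltr0n ?ler_nat // ltnW.
have l0 : 0 <= l by apply: le_trans l1; rewrite invr_ge0.
(* An integer between ln n and 3 ln n; the upper bound uses ln n >= 1/2. *)
have [p1 [p10 lp1 p1l]] : exists k : nat, [/\ (0 < k)%N, l <= k%:R & k%:R <= 3 * l].
  have /andP[h1 h2] := truncn_itv l0.
  exists (Num.truncn l).+1; split => //; first exact: ltW.
  by rewrite -natr1; lra.
pose x q : R := n%:R `^ q%:R^-1; pose m q := Num.max n%:R (x q * a).
have x1 q : 1 <= x q.
  by rewrite -(powRr0 n%:R) ler_powR // invr_ge0.
have A1 q : (0 < q)%N -> 1 <= log_ratio R q by exact: log_ratio_ge1.
have m0 q : 0 <= m q by rewrite le_max ler0n.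
suff [q [q0 qp h]] : exists q, [/\ (0 < q)%N, (q <= p)%N &
    log_ratio R q * q%:R * (x q * m q) <= 144 * (log_ratio R p * x p * m p * l)].
  exists q; split => //; rewrite -!mulrA; apply: ler_wpM2l; first exact: ler0n.
  by move: h; rewrite !mulrA.
have Ap : 0 <= log_ratio R p by apply: le_trans (A1 p p0).
have xp : 0 <= x p by apply: le_trans (x1 p).
have B0 : 0 <= log_ratio R p * x p * m p by rewrite mulr_ge0 // mulr_ge0.
have [pp1|p1p] := leqP p p1.
  exists p; split => //.
  rewrite (_ : _ * (x p * m p) = log_ratio R p * x p * m p * p%:R); last by ring.
  rewrite mulrCA ler_wpM2l //; apply: le_trans (_ : p1%:R <= _); first by rewrite ler_nat.
  lra.
exists p1; split => //; first exact: ltnW.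
(* Since ln n <= p1, the number n^(1/p1) is at most e. *)
have x4 : x p1 <= 4.
  apply: le_trans (expR1_le4 R); rewrite /x /powR gt_eqF; last by rewrite ltr0n ltnW.
  by rewrite ler_expR mulrC ler_pdivrMr ?ltr0n // mul1r.
have m4 : m p1 <= 4 * m p.
  rewrite ge_max; apply/andP; split.
    apply: le_trans (_ : m p <= _); first by rewrite le_max lexx.
    by rewrite ler_peMl // ler1n.
  apply: le_trans (_ : 4 * (x p * a) <= _); last by rewrite ler_wpM2l // le_max lexx orbT.
  rewrite mulrA ler_wpM2r //; apply: le_trans x4 _; rewrite ler_peMr //.
have hA := log_ratio_le p10 (ltnW p1p).
have x0 : 0 <= x p1 by apply: le_trans (x1 p1).
(* 144 = 3 * 3 * 4 * 4, with one factor each for [log_ratio], p1, n^(1/p1) and the maximum. *)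
apply: le_trans (_ : 3 * log_ratio R p * (3 * l) * (4 * x p * (4 * m p)) <= _).
  have A0 : 0 <= log_ratio R p1 by apply: le_trans (A1 p1 p10).
  apply: ler_pM => //; try by rewrite mulr_ge0.
    by apply: ler_pM.
  apply: ler_pM => //; apply: le_trans x4 _; rewrite ler_peMr //.
by rewrite le_eqVlt; apply/orP; left; apply/eqP; ring.
Qed.

End MomentChoice.

Section ExpectedEigenvalues.
Context {dsp : measure_display} {T : measurableType dsp} {R : realType} {n d : nat}.
Variables (P : probability T R) (X : T -> 'M[R]_(n, d)).
Hypotheses (n0 : (0 < n)%N) (nd : (n <= d)%N) (rd : random_design P X).

(** Monotonicity of the norms in the exponent, without roots: [amgm_pow] for f^2/B, integrated. *)
Lemma moment_interpolation (f : T -> R) (B : R) q p : bmeas f -> 0 < B -> (0 < q)%N -> (q <= p)%N ->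
  Ex P (fun w => f w ^+ (2 * p)) <= B ^+ p -> Ex P (fun w => f w ^+ (2 * q)) <= B ^+ q.
Proof.
move=> bf B0 q0 qp hp; have p0 := leq_trans q0 qp.
have pR : 0 < p%:R :> R by rewrite ltr0n.
have qR : q%:R <= p%:R :> R by rewrite ler_nat.
pose r : R := q%:R / p%:R.
have r0 : 0 <= r by rewrite divr_ge0.
have Bp : 0 < B ^+ p by rewrite exprn_gt0.
have Bq : 0 < B ^+ q by rewrite exprn_gt0.
apply: le_trans (_ : Ex P (fun w => B ^+ q * (1 - r) + B ^+ q * (r / B ^+ p) * f w ^+ (2 * p)) <= _).
  apply: Ex_le => [||w].
  - exact: bmeasX.
  - by apply: bmeasD; [exact: bmeas_cst|apply: bmeasZ; exact: bmeasX].
  have t0 : 0 <= f w ^+ 2 / B by rewrite divr_ge0 ?sqr_ge0 // ltW.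
  have := amgm_pow t0 qp p0; rewrite -/r !expr_div_n -!exprM => h.
  rewrite [leLHS](_ : _ = B ^+ q * (f w ^+ (2 * q) / B ^+ q)); last by field; rewrite gt_eqF.
  rewrite [leRHS](_ : _ = B ^+ q * (1 - r + r * (f w ^+ (2 * p) / B ^+ p))).
    by rewrite ler_wpM2l // ltW.
  by field; rewrite !gt_eqF.
rewrite ExD; [|exact: bmeas_cst|by apply: bmeasZ; exact: bmeasX].
rewrite Ex_cst ExZ; last exact: bmeasX.
rewrite -[leRHS]mulr1 -mulrA -mulrDr; apply: ler_wpM2l; first exact: ltW.
have : r / B ^+ p * Ex P (fun w => f w ^+ (2 * p)) <= r / B ^+ p * B ^+ p.
  by rewrite ler_wpM2l // divr_ge0 // ltW.
rewrite mulfVK ?gt_eqF //; lra.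
Qed.

(** The comparison holds pointwise with [g w] in place of eps. Its two sides are affine in [g] with
    nonnegative eigenvalues as factors, so a bound on the mean of [g] is enough. *)
Lemma expected_eigenvalue (g : T -> R) (eps : R) i : bmeas g -> (forall w, 0 <= g w) ->
  Ex P g <= eps ->
  (forall w (v : 'rV[R]_n),
    `|qform 1%:M (v *m rows_mx (white P X) w) - d%:R * qform 1%:M v| <= d%:R * g w * qform 1%:M v) ->
  (0 < i <= n)%N ->
  ((lambda (i + d - n) (pop_cov P X) * (1 - eps))%:E
     <= (n%:R / d%:R)%:E * 'E_P[(fun w => lambda i (sample_cov X w))]
     <= (lambda i (pop_cov P X) * (1 + eps))%:E)%E.
Proof.
move=> bg g0 hg dev i0n.
have d0 : (0 < d)%N := leq_trans n0 nd.
have dR : 0 < d%:R :> R by rewrite ltr0n.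
have nR : 0 < n%:R :> R by rewrite ltr0n.
have nd0 : 0 < n%:R / d%:R :> R by rewrite divr_gt0.
have /andP[i0 i_n] := i0n; have i0d : (0 < i <= d)%N by rewrite i0 (leq_trans i_n).
have j0d : (0 < i + d - n <= d)%N by lia.
pose L w := lambda i (white_cov P X w).
have lamS j : (0 < j <= d)%N -> 0 <= lambda j (pop_cov P X).
  by move=> jd; apply: lambda_ge0 => //; exact: pop_cov_psd.
have L0 w : 0 <= L w by apply: lambda_ge0 => //; exact: gram_psd.
have LU w : n%:R / d%:R * L w <= lambda i (pop_cov P X) * (1 + g w).
  apply: white_cov_le => //; first by rewrite ltr_pwDl.
  by move=> v; have := dev w v; rewrite ler_norml => /andP[_]; lra.
have LL w : lambda (i + d - n) (pop_cov P X) * (1 - g w) <= n%:R / d%:R * L w.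
  apply: white_cov_ge => //.
  by move=> v; have := dev w v; rewrite ler_norml => /andP[+ _]; lra.
have bL : bmeas L.
  split; first exact: measurable_lambda_white_cov.
  have [_ [M hM]] := bg; exists ((n%:R / d%:R)^-1 * (lambda i (pop_cov P X) * (1 + M))) => w.
  rewrite ger0_norm // ler_pdivlMl //; apply: le_trans (LU w) _.
  by apply: ler_wpM2l; rewrite ?lamS // lerD2l (le_trans (ler_norm _)).
have -> : ('E_P[(fun w => lambda i (sample_cov X w))] = (Ex P L)%:E)%E.
  rewrite expectation.unlock.
  rewrite (EFin_Ex P bL).
  apply: (@ae_eq_integral _ _ _ P setT); first exact: measurableT.
  - by apply/measurable_EFinP; exact: (measurable_lambda_sample_cov nd rd).
  - by apply/measurable_EFinP; case: bL.
  - by apply: filterS (ae_sample_cov n0 nd rd) => w ww _; rewrite /L ww.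
rewrite -EFinM !lee_fin -ExZ //; apply/andP; split.
  apply: le_trans (_ : Ex P (fun w => lambda (i + d - n) (pop_cov P X) * (1 - g w)) <= _).
    rewrite ExZ; last by apply: bmeasB => //; exact: bmeas_cst.
    apply: ler_wpM2l; first exact: lamS.
    have -> : (fun w => 1 - g w) = fun w => 1 + -1 * g w by apply/funext => w; rewrite mulN1r.
    rewrite ExD ?ExZ ?Ex_cst //; [lra|exact: bmeas_cst|exact: bmeasZ].
  by apply: Ex_le => //; apply: bmeasZ => //; apply: bmeasB => //; exact: bmeas_cst.
apply: le_trans (_ : Ex P (fun w => lambda i (pop_cov P X) * (1 + g w)) <= _).
  by apply: Ex_le => //; apply: bmeasZ => //; apply: bmeasD => //; exact: bmeas_cst.
rewrite ExZ; last by apply: bmeasD => //; exact: bmeas_cst.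
apply: ler_wpM2l; first exact: lamS.
by rewrite ExD ?Ex_cst ?lerD2l //; exact: bmeas_cst.
Qed.

Lemma design_gram_deviation p : (0 < p)%N ->
  let M := fine (max_moment P (whitened P X) (2 * p)) in
  exists g : T -> R, [/\ bmeas g, forall w, 0 <= g w,
    Ex P g <= Num.sqrt (moment_bound (64 * (168 * 144)) n p M / d%:R) &
    forall w (v : 'rV[R]_n), `|qform 1%:M (v *m rows_mx (white P X) w) - d%:R * qform 1%:M v| <=
      d%:R * g w * qform 1%:M v].
Proof.
(* A single row has no off-diagonal part, so the deviation is 0. *)
move=> p0 M; have [n1|n1] := leqP n 1.
  exists (fun=> 0); split => // [||w v]; [exact: bmeas_cst|by rewrite Ex_cst sqrtr_ge0|].
  rewrite (qform_rows_mx (white_norm P X)) addrC addKr big1 ?normr0 ?mulr0 ?mul0r // => j _.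
  rewrite big_pred0 // => k; apply/negbTE; rewrite negbK; apply/eqP/val_inj.
  by move: (ltn_ord j) (ltn_ord k) => /=; lia.
(* The interpolation requires a positive moment bound. Raising |M| to at least 1 does not enlarge
   the maximum in B(n, p), which already contains n >= n^(1/p). *)
pose tau : R := Num.max `|M| 1.
have t1 : 1 <= tau by rewrite le_max lexx orbT.
have t0 : 0 < tau by apply: lt_le_trans t1.
have mp k u : Ex P (fun w => dotv (white P X k w) u ^+ (2 * p)) <= tau ^+ (2 * p) * dotv u u ^+ p.
  apply: moment_of_Lnorm => // [|l v vS]; first exact: ltW.
  apply: le_trans (max_moment_fin rd l p0 vS) _.
  by rewrite lee_fin -/M (le_trans (ler_norm M)) // le_max lexx.
have [q [q0 qp hq]] := moment_choice n1 p0 (sqr_ge0 tau).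
have mq k u : Ex P (fun w => dotv (white P X k w) u ^+ (2 * q)) <= tau ^+ (2 * q) * dotv u u ^+ q.
  have [u0|u0] := eqVneq u 0.
    rewrite (_ : (fun w => _) = fun=> 0).
      by rewrite Ex_cst mulr_ge0 ?exprn_ge0 ?dotv_ge0 // ltW.
    apply/funext => w; rewrite /dotv big1 => [|j _]; last by rewrite u0 mxE mulr0.
    by rewrite expr0n muln_eq0 /= gtn_eqF.
  rewrite exprM -exprMn; apply: (moment_interpolation _ _ q0 qp).
  - by apply: bmeas_dotv; [exact: bmx_white|exact: bmx_cst].
  - rewrite mulr_gt0 ?exprn_gt0 // lt_neqAle dotv_ge0 andbT eq_sym.
    apply: contra u0; rewrite psumr_eq0 => [/allP h|j _]; last by rewrite -expr2 sqr_ge0.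
    apply/eqP/colP => a; rewrite mxE; apply/eqP; rewrite -sqrf_eq0 expr2.
    by apply: h; rewrite mem_index_enum.
  - by rewrite exprMn -exprM.
have [g [bg g0 hg dev]] := gram_deviation_moment (white_norm P X) (white_measurable rd)
  (white_independent rd) (white_isotropic n0 nd rd) q0 n0 nd (ltW t0) mq.
exists g; split => //; apply: le_trans hg _.
have dR : 0 < d%:R :> R by rewrite ltr0n (leq_trans n0).
pose x : R := n%:R `^ p%:R^-1.
have n1R : 1 <= n%:R :> R by rewrite ler1n ltnW.
have x0 : 0 <= x by exact: powR_ge0.
have xn : x <= n%:R.
  by rewrite -[leRHS]powRr1 // /x ler_powR // invf_le1 ?ler1n // ltr0n.
have mM : Num.max n%:R (x * tau ^+ 2) <= Num.max n%:R (x * M ^+ 2).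
  rewrite ge_max; apply/andP; split; first by rewrite le_max lexx.
  rewrite le_max /tau; have [h|h] := leP `|M| 1; first by rewrite expr1n mulr1 xn.
  by rewrite -normrX ger0_norm ?sqr_ge0 // lexx orbT.
have l0 : 0 <= ln n%:R :> R by rewrite ln_ge0.
have A0 : 0 <= log_ratio R p by apply: le_trans (log_ratio_ge1 R p0).
(* Under the root, 8^2 = 64 joins the constant 168 * 144. *)
have -> : 8 = Num.sqrt (8 ^+ 2) :> R by rewrite sqrtr_sqr ger0_norm.
rewrite -sqrtrM ?sqr_ge0 //; apply: ler_wsqrtr; rewrite [8 ^+ 2 * _]mulrA; apply: ler_wpM2r.
  by rewrite invr_ge0 ltW.
apply: le_trans (ler_wpM2l (sqr_ge0 8) hq) _.
rewrite /moment_bound -/(log_ratio R p) -/x.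
apply: le_trans (_ : 8 ^+ 2 * (168 * 144 *
    (log_ratio R p * x * Num.max n%:R (x * M ^+ 2) * ln n%:R)) <= _).
  apply: ler_wpM2l; first exact: sqr_ge0.
  apply: ler_wpM2l; first by apply: mulr_ge0; exact: ler0n.
  by apply: ler_wpM2r => //; apply: ler_wpM2l => //; exact: mulr_ge0.
by rewrite le_eqVlt; apply/orP; left; apply/eqP; ring.
Qed.

End ExpectedEigenvalues.

Theorem theorem11 (R : realType) :
  (forall K : R, exists C c : R, [/\ 0 < C, 0 < c &
     forall (n d : nat) (dsp : measure_display) (T : measurableType dsp)
            (P : probability T R) (X : T -> 'M[R]_(n, d)),
       (0 < n)%N -> (n <= d)%N -> random_design P X ->
       (forall k, subgaussian P (whitened P X k)) ->
       (\big[maxe/-oo]_(k < n) psi2_norm P (whitened P X k) = K%:E)%E ->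
       forall t : R, 0 <= t ->
       let eps := C * Num.sqrt (n%:R / d%:R) + t / Num.sqrt d%:R in
       ((1 - 2 * expR (- (c * t ^+ 2)))%:E <=
        P [set w | forall i : nat, (1 <= i <= n)%N ->
             (lambda (i + d - n) (pop_cov P X) * (1 - Num.max eps (eps ^+ 2))
               <= n%:R / d%:R * lambda i (sample_cov X w)
               <= lambda i (pop_cov P X) * (1 + Num.max eps (eps ^+ 2)))%R])%E])
  /\
  (exists C : R, 0 < C /\
     forall (n d : nat) (dsp : measure_display) (T : measurableType dsp)
            (P : probability T R) (X : T -> 'M[R]_(n, d)),
       (0 < n)%N -> (n <= d)%N -> random_design P X ->
       forall p : nat, (0 < p)%N ->
       forall i : nat, (1 <= i <= n)%N ->
       (* [max_moment] is finite here, since |<z_k, u>| <= sqrt d a.s. *)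
       let M := fine (max_moment P (whitened P X) (2 * p)) in
       let eps := Num.sqrt (moment_bound C n p M / d%:R) in
       ((lambda (i + d - n) (pop_cov P X) * (1 - eps))%:E
          <= (n%:R / d%:R)%:E * 'E_P[(fun w => lambda i (sample_cov X w))]
          <= (lambda i (pop_cov P X) * (1 + eps))%:E)%E).
Proof.
split=> [K|].
  have [h [h0 hE]] : exists h : R, 0 < h /\ 8192^-1 = h.
    by exists 8192^-1; split; [rewrite invr_gt0 ltr0n|].
  have [N [N0 NE]] : exists N : R, 0 < N /\ 2 ^+ 18 = N.
    by exists (2 ^+ 18); split; [rewrite exprn_gt0|].
  (* [K] is an arbitrary real at this point; |K| + 1 is a positive upper bound that depends on it
     alone. *)
  pose K1 := `|K| + 1; have K10 : 0 < K1 by rewrite ltr_wpDl.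
  exists (K1 * Num.sqrt (N / h)), (h / K1 ^+ 2); split.
  - by rewrite mulr_gt0 // sqrtr_gt0 divr_gt0.
  - by rewrite divr_gt0 // exprn_gt0.
  move=> n d dsp T P X n0 nd rd _ hK t t0; cbv zeta.
  set eps := _ * Num.sqrt (_ / d%:R) + _.
  have eps0 : 0 <= eps.
    rewrite addr_ge0 // ?divr_ge0 ?sqrtr_ge0 //.
    by apply: mulr_ge0; rewrite ?sqrtr_ge0 //; apply: mulr_ge0; rewrite ?sqrtr_ge0 // ltW.
  have hK1 : (\big[maxe/-oo]_(k < n) psi2_norm P (whitened P X k) <= K1%:E)%E.
    by rewrite hK lee_fin /K1 (le_trans (ler_norm K)) // lerDl.
  apply: le_trans (subgaussian_eigenvalues n0 nd rd hK1 K10 eps0).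
  rewrite hE NE lee_fin lerD2l lerN2; apply: ler_wpM2l => //.
  exact: (@subgaussian_tail R N h K1 n d t eps N0 h0 K10 (leq_trans n0 nd) t0 erefl).
exists (64 * (168 * 144)); split; first by rewrite !mulr_gt0 // ltr0n.
move=> n d dsp T P X n0 nd rd p p0 i i0n; cbv zeta.
have [g [bg g0 hg dev]] := design_gram_deviation n0 nd rd p0.
exact: (expected_eigenvalue n0 nd rd bg g0 hg dev i0n).
Qed.
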